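(* Let $H$ be a separable real Hilbert space and let $A$ be a self-adjoint nonnegative (possibly unbounded) linear operator on $H$ with dense domain $D(A)$. Assume that there exist a countable (not necessarily complete) orthonormal system $\{e_k\}_{k\ge 1}$ in $H$ and an increasing unbounded sequence $\{\lambda_k\}_{k\ge 1}$ of positive real numbers such that $Ae_k=\lambda_k^2e_k$ for every $k\ge 1$. Let $\omega:[0,+\infty)\to[0,+\infty)$ be a continuous increasing function such that $\omega(0)=0$, $\omega(a+b)\le\omega(a)+\omega(b)$ for every $a\ge 0$, $b\ge 0$, and such that the function $\sigma\mapsto\sigma/\omega(\sigma)$ is nondecreasing. Let $\varphi:[0,+\infty)\to[1,+\infty)$ be a function such that $$\lim_{\sigma\to+\infty}\frac{\sigma}{\varphi(\sigma)}\,\omega\left(\frac1\sigma\right)=+\infty .$$ Then there exist a function $m:[0,+\infty)\to[1/2,3/2]$, a real number $T_0>0$, and a function $u:[0,T_0]\to H$ such that (i) $m$ is $\omega$-continuous; (ii) $(u(0),u'(0))\in\mathcal{G}_{\varphi,r,3/4}(A)\times\mathcal{G}_{\varphi,r,1/4}(A)$ for every $r>0$; (iii) $u\in C^1([0,T_0];D(A^{1/4}))\cap C^0([0,T_0];D(A^{3/4}))$ is a solution of $$u''(t)+m\left(|A^{1/2}u(t)|^2\right)Au(t)=0;$$ (iv) for every $t\in(0,T_0]$ we have that $(u(t),u'(t))\notin V_\beta$ for every $\beta>1/2$.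
   Context: $|x|$ denotes the norm of $x\in H$. A function $f:X\to\mathbb{R}$ with $X\subseteq\mathbb{R}$ is $\omega$-continuous if there is a constant $L\in\mathbb{R}$ with $|f(a)-f(b)|\le L\,\omega(|a-b|)$ for all $a,b\in X$. The powers $A^\beta$ ($\beta\ge0$), with domains $D(A^\beta)$, are those given by the spectral theorem. The phase spaces are $V_\beta:=D(A^{(\beta+1)/2})\times D(A^{\beta/2})$. Spaces $\mathcal{G}_{\varphi,r,\beta}(A)$ (for $r>0$, $\beta>0$): if $u=\sum_k u_k e_k$ lies in the closed span of orthonormal eigenvectors $e_k$ with $Ae_k=\lambda_k^2e_k$, set $$\|u\|^2_{\varphi,r,\beta}:=\sum_{k}\lambda_k^{4\beta}u_k^2\exp\left(r\varphi(\lambda_k)\right),$$ and $\mathcal{G}_{\varphi,r,\beta}(A):=\{u\in H:\|u\|^2_{\varphi,r,\beta}<+\infty\}$. (For a general $A$ and general $u\in H$ the sum is replaced by the corresponding spectral integral given by the spectral theorem.) The differential equation is understood in the usual weak sense (as an equality in the dual space $D(A^{-1/4})$ of $D(A^{1/4})$). *)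

(* Defs.v *)
From HB Require Import structures.
From mathcomp Require Import all_boot all_order all_algebra.
From mathcomp Require Import sesquilinear.
From mathcomp Require Import all_classical all_reals all_analysis.

Set Implicit Arguments.
Unset Strict Implicit.
Unset Printing Implicit Defensive.

Import Order.TTheory GRing.Theory Num.Theory.
Import numFieldNormedType.Exports.

Local Open Scope classical_set_scope.
Local Open Scope ring_scope.

(* A real Hilbert space is a complete normed space H with a positive definite
   symmetric bilinear form ip, {dot H for idfun}, inducing the norm of H. *)
Definition norm_from_dot (R : realType) (H : completeNormedModType R)
    (ip : {dot H for idfun}) : Prop :=
  forall u : H, `|u| ^+ 2 = ip u u.

Definition separable_space (T : topologicalType) : Prop :=
  exists S : set T, countable S /\ dense S.

(* An unbounded operator is a pair (D, A): only the values of A on its domain D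
   are meaningful. *)
Section UnboundedOperators.
Context {R : realType} {H : completeNormedModType R}.
Variable ip : {dot H for idfun}.
Implicit Types (D : set H) (A : H -> H).

Definition linear_on D A : Prop :=
  D 0 /\ forall (a : R) (u v : H), D u -> D v ->
    D (a *: u + v) /\ A (a *: u + v) = a *: A u + A v.

(* The right-hand side of the equivalence says that v is in the domain of the
   adjoint and is mapped to w by the adjoint. *)
Definition self_adjoint D A : Prop :=
  [/\ linear_on D A, dense D &
      forall v w : H,
        (D v /\ A v = w) <-> (forall u, D u -> ip (A u) v = ip u w)].

Definition nonneg_op D A : Prop := forall u, D u -> 0 <= ip (A u) u.

End UnboundedOperators.

Section SpectralCalculus.
Context {R : realType} {H : completeNormedModType R}.
Variable ip : {dot H for idfun}.

(* E is a projection-valued measure on the Borel sets of R, carried by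
   [0, +oo[; E B is irrelevant when B is not a Borel set. *)
Record projection_valued_measure (E : set R -> H -> H) : Prop := PVM {
  pvm_linear : forall B, measurable B -> linear (E B) ;
  pvm_sym : forall B u v, measurable B -> ip (E B u) v = ip u (E B v) ;
  pvm_setI : forall B C u, measurable B -> measurable C ->
    E (B `&` C) u = E B (E C u) ;
  pvm_total : forall u, E `[0, +oo[%classic u = u ;
  pvm_sigma_additive : forall (F : (set R)^nat) (u : H),
    (forall n, measurable (F n)) -> trivIset setT F ->
    series (fun n => E (F n) u) @ \oo --> E (\bigcup_n F n) u }.

Variable E : set R -> H -> H.

Definition spec_meas (u : H) (B : set R) : \bar R := (ip (E B u) u)%:E.

(* The functional calculus f(A) := \int f dE, for f real-valued on [0, +oo[. *)
Definition spec_dom (f : R -> R) : set H :=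
  [set u | (\int[spec_meas u]_(s in `[0%R, +oo[%classic) (f s ^+ 2)%R%:E
             < +oo)%E].

(* The integral of f against the signed measure B |-> ip (E B u) w, which is
   (spec_meas (u + w) - spec_meas (u - w)) / 4 by polarization. *)
Definition spec_form (f : R -> R) (u w : H) : R :=
  (fine (\int[spec_meas (u + w)%R]_(s in `[0%R, +oo[%classic) (f s)%:E)%E
   - fine (\int[spec_meas (u - w)%R]_(s in `[0%R, +oo[%classic) (f s)%:E)%E) / 4.

Definition spec_graph (f : R -> R) (u v : H) : Prop :=
  spec_dom f u /\ forall w, spec_dom f w -> ip v w = spec_form f u w.

(* The unique v with spec_graph f u v when u is in spec_dom f, junk otherwise. *)
Definition spec_op (f : R -> R) (u : H) : H := get (spec_graph f u).

(* A = \int s dE(s), with equality of domains. By the spectral theorem a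
   self-adjoint nonnegative A has exactly one spectral resolution E, and the
   powers of A and the spectral integrals below are the ones taken with it. *)
Definition spectral_resolution (D : set H) (A : H -> H) : Prop :=
  [/\ projection_valued_measure E, D = spec_dom id &
      forall u, D u -> spec_graph id u (A u)].

Definition pow_dom (b : R) : set H := spec_dom (fun s => s `^ b).
Definition pow_op (b : R) : H -> H := spec_op (fun s => s `^ b).

Definition phase_space (b : R) : set (H * H) :=
  pow_dom ((b + 1) / 2) `*` pow_dom (b / 2).

(* With s = lambda^2 the weight lambda^(4b) exp (r phi(lambda)) becomes
   s^(2b) exp (r phi(sqrt s)). On the closed span of eigenvectors spec_meas u
   is discrete, and the integral is the sum of the weights against u_k^2 even
   if phi is not measurable. *)
Definition gevrey_space (phi : R -> R) (r b : R) : set H :=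
  [set u | (\int[spec_meas u]_(s in `[0%R, +oo[%classic)
             (s `^ (2 * b) * expR (r * phi (Num.sqrt s)))%R%:E < +oo)%E].

Definition graph_norm (b : R) (v : H) : R := `|v| + `|pow_op b v|.

(* C^0([0, T]; D(A^b)) *)
Definition C0_pow (b T : R) (u : R -> H) : Prop :=
  forall t : R, t \in `[0, T] -> pow_dom b (u t) /\
    graph_norm b (u s - u t) @[s --> within `[0, T]%classic (nbhs t)] --> 0.

(* u is in C^1([0, T]; D(A^b)), with derivative du (one-sided at 0 and T). *)
Definition C1_pow (b T : R) (u du : R -> H) : Prop :=
  [/\ C0_pow b T u, C0_pow b T du &
      forall t : R, t \in `[0, T] ->
        graph_norm b ((s - t)^-1 *: (u s - u t) - du t)
          @[s --> within (`[0, T]%classic `\ t) (nbhs t)] --> 0].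

(* Norm of the dual space D(A^(-b)) of D(A^b). *)
Definition dual_norm (b : R) (l : H -> R) : \bar R :=
  ereal_sup [set `|l v|%:E | v in [set v | pow_dom b v /\ graph_norm b v <= 1]].

(* The function f : [0, T] -> H, each f t being viewed as the functional ip (f t),
   has derivative df in D(A^(-b)). *)
Definition dual_derivative (b T : R) (f : R -> H) (df : R -> H -> R) : Prop :=
  forall t : R, t \in `[0, T] ->
    dual_norm b (fun v => (s - t)^-1 * (ip (f s) v - ip (f t) v) - df t v)
      @[s --> within (`[0, T]%classic `\ t) (nbhs t)] --> 0%E.

(* For u in D(A^(3/4)), A u is the functional ip (A^(3/4) u) (A^(1/4) v) on
   D(A^(1/4)). *)
Definition kirchhoff_solution (m : R -> R) (T : R) (u du : R -> H) : Prop :=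
  [/\ C1_pow (1 / 4) T u du, C0_pow (3 / 4) T u &
      exists ddu : R -> H -> R, dual_derivative (1 / 4) T du ddu /\
        forall (t : R) (v : H), t \in `[0, T] -> pow_dom (1 / 4) v ->
          ddu t v + m (`|pow_op (1 / 2) (u t)| ^+ 2) *
            ip (pow_op (3 / 4) (u t)) (pow_op (1 / 4) v) = 0].

End SpectralCalculus.

Definition omega_continuous (R : realType) (omega : R -> R) (X : set R)
    (f : R -> R) : Prop :=
  exists L : R, forall a b : R, X a -> X b ->
    `|f a - f b| <= L * omega `|a - b|.

(* Main.v *)
Require Import Defs.
From HB Require Import structures.
From mathcomp Require Import all_boot all_order all_algebra.
From mathcomp Require Import sesquilinear.
From mathcomp Require Import all_classical all_reals all_analysis measurable_realfun.
From mathcomp Require Import ring lra.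
Import Order.TTheory GRing.Theory Num.Theory.
Import numFieldNormedType.Exports.
Local Open Scope classical_set_scope.
Local Open Scope ring_scope.

Set Implicit Arguments.
Unset Strict Implicit.
Unset Printing Implicit Defensive.

(* As long as t |-> |A^(1/2) u(t)|^2 is strictly increasing, every solution of
   the linear equation u'' + c(t) A u = 0 solves Kirchhoff's equation with m the
   composition of c with the inverse of that function.  So it is enough to find
   an omega-continuous c and a linear solution which loses derivatives
   instantly; an additional low frequency mode with large data makes
   |A^(1/2) u|^2 expanding, and m inherits the continuity modulus of c.

   The linear example is of Colombini-De Giorgi-Spagnolo type.  On intervals
   I_k accumulating at 0, c oscillates around 1 with amplitude
   eps_k = omega(1 / g_k) and in resonance with a rapidly increasing subsequence
   of frequencies g_k.  The corresponding mode is explicit on I_k, where its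
   energy is multiplied by exp(2 eps_k g_k |I_k|), and the hypothesis on phi says
   that this beats exp(k phi(g_k)) if g_k is large.  Before I_k the coefficient
   is so close to 1 (relative to g_k) that the energy of the mode is almost
   constant; after I_k the energy changes by a factor which only depends on the
   earlier frequencies.  Hence the energy of the mode is Gevrey-small at time 0,
   but after I_k it is bounded below by a quantity fixed before g_k is chosen,
   so that any power of g_k makes it large. *)

(** * Orthonormal series in a Hilbert space *)

(** Each mode is measured by [L * energy L y z], that is L^3 y^2 + L z^2, whose sum over the modes
    is |A^(3/4) u|^2 + |A^(1/4) u'|^2, the level of V_(1/2). It has to stay summable while its
    product with every positive power of L is unbounded at each t > 0. So each resonant mode is kept
    between 2^-(k+1) from above and a bound from below that involves only the preceding frequency.
    The same upper bound controls |2 L^2 y z|, the derivative of L^2 y^2, so that the resonant modes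
    together change |A^(1/2) u|^2 at rate at most 1. The low mode contributes rate at least 2. Hence
    the inverse function is 1-Lipschitz, and m keeps the constant of c. Two energies are compared
    with Gronwall's inequality: g^2 y^2 + z^2 costs g |1 - c|, which is affordable before I_k; c g^2
    y^2 + z^2 costs |c'| / c, in which the frequency g of the mode does not occur, and serves after
    I_k. As [A] is arbitrary off the span of the e_k, the eigenvector equations must first be turned
    into statements on the spectral measures; afterwards everything concerns coefficient
    sequences. *)

Lemma cvgn_of_sqr_le (R : realType) (V : completeNormedModType R) (u : nat -> V) (r : nat -> R) :
  (forall n m, (n <= m)%N -> `|u m - u n| ^+ 2 <= r m - r n) -> cvgn r -> cvgn u.
Proof.
move=> ur cr; apply/cauchy_cvgP; apply: cauchy_exP => e e0.
have ndr : nondecreasing_seq r.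
  by move=> n m nm; rewrite -subr_ge0; exact: le_trans (sqr_ge0 _) (ur _ _ nm).
have [N _ HN] := (cvgrPdist_lt _ _).1 cr (e ^+ 2) (exprn_gt0 2 e0).
exists (u N); exists N => // n /= Nn.
rewrite -ball_normE /= distrC -(ltr_pXn2r (n := 2)) ?nnegrE ?(ltW e0)//.
apply: le_lt_trans (ur _ _ Nn) _.
have := HN N (leqnn N); have := nondecreasing_cvgn_le ndr cr n.
have := nondecreasing_cvgn_le ndr cr N => h1 h2.
rewrite ger0_norm ?subr_ge0//; lra.
Qed.

Section InnerProduct.
Context {R : realType} {H : completeNormedModType R} (ip : {dot H for idfun}).
Hypothesis Hip : norm_from_dot ip.
Implicit Types u v w : H.

Lemma ipDl u v w : ip (u + v) w = ip u w + ip v w.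
Proof. exact: linearDl. Qed.

Lemma ipDr u v w : ip w (u + v) = ip w u + ip w v.
Proof. exact: linearDr. Qed.

Lemma ipZl a v w : ip (a *: v) w = a * ip v w.
Proof. exact: linearZl_LR. Qed.

Lemma ipZr a v w : ip v (a *: w) = a * ip v w.
Proof. exact: linearZr_LR. Qed.

Lemma ipC u v : ip u v = ip v u.
Proof. by rewrite hermC expr0 mul1r. Qed.

Lemma ipBl u v w : ip (u - v) w = ip u w - ip v w.
Proof. exact: linearBl. Qed.

Lemma ipBr u v w : ip w (u - v) = ip w u - ip w v.
Proof. exact: linearBr. Qed.

Lemma ip_suml I (r : seq I) (F : I -> H) v : ip (\sum_(i <- r) F i) v = \sum_(i <- r) ip (F i) v.
Proof. exact: linear_sumlz. Qed.

Lemma ip_sumr I (r : seq I) (F : I -> H) v : ip v (\sum_(i <- r) F i) = \sum_(i <- r) ip v (F i).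
Proof. exact: linear_sumr. Qed.

Lemma sqr_normB u v : `|u - v| ^+ 2 = `|u| ^+ 2 - 2 * ip u v + `|v| ^+ 2.
Proof. by rewrite !Hip ipBl !ipBr (ipC v u); ring. Qed.

Lemma ip_eq0 u : ip u u = 0 -> u = 0.
Proof. by rewrite -Hip => /eqP; rewrite sqrf_eq0 normr_eq0 => /eqP. Qed.

Lemma cauchy_schwarz u v : `|ip u v| <= `|u| * `|v|.
Proof.
rewrite -(ler_pXn2r (n := 2)) ?nnegrE ?mulr_ge0// exprMn real_normK ?num_real//.
have [->|v0] := eqVneq v 0; first by rewrite normr0 expr0n mulr0 (ipC _ 0) linear0l expr0n.
have := sqr_ge0 `|(`|v| ^+ 2) *: u - (ip u v) *: v|.
have v2 : 0 < `|v| ^+ 2 by rewrite exprn_gt0 ?normr_gt0.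
rewrite sqr_normB ipZl ipZr !normrZ !exprMn real_normK ?num_real// (real_normK (num_real (ip u v))).
set a := `|v| ^+ 2 in v2 *; set b := `|u| ^+ 2; set c := ip u v.
have -> : a ^+ 2 * b - 2 * (a * (c * c)) + c ^+ 2 * a = a * (b * a - c ^+ 2) by ring.
by rewrite pmulr_rge0// subr_ge0.
Qed.

Lemma cvg_ipl {T : Type} {F : set_system T} {FF : Filter F} (x : T -> H) (l : H) :
  x @ F --> l -> forall v, (fun t => ip (x t) v) @ F --> ip l v.
Proof.
move=> xl v; apply/cvgrPdist_le => e e0.
have p : 0 < `|v| + 1 by rewrite ltr_wpDl.
near=> t; rewrite -ipBl; apply: le_trans (cauchy_schwarz _ _) _.
have ht : `|l - x t| <= e / (`|v| + 1).
  by near: t; move/cvgrPdist_le: xl; apply; exact: divr_gt0.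
apply: le_trans (ler_wpM2r _ ht) _ => //.
by rewrite -mulrA ler_piMr// ?(ltW e0)// mulrC ler_pdivrMr// mul1r lerDl.
Unshelve. all: by end_near. Qed.

Lemma cvg_ip2 {T : Type} {F : set_system T} {FF : Filter F} (x y : T -> H) (l m : H) :
  x @ F --> l -> y @ F --> m -> (fun t => ip (x t) (y t)) @ F --> ip l m.
Proof.
move=> xl ym.
(* Polarization reduces joint continuity to continuity of the norm. *)
have -> : (fun t => ip (x t) (y t)) =
  (fun t => (`|x t| ^+ 2 - `|x t - y t| ^+ 2 + `|y t| ^+ 2) / 2).
  by apply/funext => t; rewrite sqr_normB; field.
have -> : ip l m = (`|l| ^+ 2 - `|l - m| ^+ 2 + `|m| ^+ 2) / 2 by rewrite sqr_normB; field.
apply: cvgMl; apply: cvgD; first apply: cvgB.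
- by apply: (cvg_comp _ (fun z : R => z ^+ 2) (cvg_norm xl)); exact: exprn_continuous.
- by apply: (cvg_comp _ (fun z : R => z ^+ 2) (cvg_norm (cvgB xl ym))); exact: exprn_continuous.
- by apply: (cvg_comp _ (fun z : R => z ^+ 2) (cvg_norm ym)); exact: exprn_continuous.
Qed.

Lemma cvg_sqr_norm {T : Type} {F : set_system T} {FF : Filter F} (x : T -> H) (l : H) :
  x @ F --> l -> (fun t => `|x t| ^+ 2) @ F --> `|l| ^+ 2.
Proof.
by move=> xl; rewrite Hip; under eq_fun do rewrite Hip; exact: cvg_ip2.
Qed.

Section Orthonormal.
Variable f : nat -> H.
Hypothesis f_on : forall j k, ip (f j) (f k) = (j == k)%:R.

Definition l2seq (x : nat -> R) := cvgn (series (fun k => x k ^+ 2)).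

Definition vec (x : nat -> R) : H := limn (series (fun k => x k *: f k)).

Lemma ip_sum_orthonormal (x : nat -> R) m n k :
  ip (\sum_(m <= i < n) x i *: f i) (f k) = if (m <= k < n)%N then x k else 0.
Proof.
rewrite ip_suml; under eq_bigr do rewrite ipZl f_on.
case: ifPn => [/andP[mk kn]|mkn].
  rewrite (bigD1_seq k) ?mem_index_iota ?mk ?iota_uniq//= eqxx mulr1 big1 ?addr0//.
  by move=> i /negbTE ->; rewrite mulr0.
rewrite big_nat big1// => i mi.
by case: eqP mkn => [<-|_ _]; rewrite ?mi// mulr0.
Qed.

Lemma sqr_norm_sum_orthonormal (x : nat -> R) m n :
  `|\sum_(m <= i < n) x i *: f i| ^+ 2 = \sum_(m <= i < n) x i ^+ 2.
Proof.
rewrite Hip ip_sumr; apply: eq_big_nat => i mi.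
by rewrite ipZr ip_sum_orthonormal mi expr2.
Qed.

Lemma cvg_vec x : l2seq x -> series (fun k => x k *: f k) @ \oo --> vec x.
Proof.
move=> xl; suff : cvgn (series (fun k => x k *: f k)) by [].
apply: (cvgn_of_sqr_le _ xl) => n m nm.
by rewrite !sub_series_geq// sqr_norm_sum_orthonormal.
Qed.

Lemma cvg_ip_vec x w : l2seq x -> series (fun k => x k * ip (f k) w) @ \oo --> ip (vec x) w.
Proof.
move=> /cvg_vec/cvg_ipl/(_ w); apply: cvg_trans; apply: near_eq_cvg; near=> n.
by rewrite /series/= ip_suml; apply: eq_bigr => i _; rewrite ipZl.
Unshelve. all: by end_near. Qed.

Lemma ip_vec x k : l2seq x -> ip (vec x) (f k) = x k.
Proof.
move=> xl; have /cvg_ipl/(_ (f k)) h := cvg_vec xl.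
apply: (cvg_unique _ h) => //; apply: cvg_near_cst; near=> n.
rewrite /series/= ip_sum_orthonormal leq0n/=.
by have -> : (k < n)%N by near: n; exact: nbhs_infty_gt.
Unshelve. all: by end_near. Qed.

Lemma cvg_sqr_norm_vec x : l2seq x -> series (fun k => x k ^+ 2) @ \oo --> `|vec x| ^+ 2.
Proof.
move=> /cvg_vec/cvg_sqr_norm; apply: cvg_trans; apply: near_eq_cvg; near=> n.
by rewrite /series/= sqr_norm_sum_orthonormal.
Unshelve. all: by end_near. Qed.

Lemma sqr_norm_vec_le x M : l2seq x -> (forall n, series (fun k => x k ^+ 2) n <= M) ->
  `|vec x| ^+ 2 <= M.
Proof.
move=> /cvg_sqr_norm_vec xl xM; have <- := cvg_lim (@Rhausdorff R) xl.
by apply: limr_le; [apply/cvg_ex; eexists; exact: xl | exact: nearW].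
Qed.

Lemma vec_eq_lim x l : series (fun k => x k *: f k) @ \oo --> l -> vec x = l.
Proof. exact: cvg_lim. Qed.

Lemma l2seqZD a x y : l2seq x -> l2seq y -> l2seq (fun k => a * x k + y k).
Proof.
move=> lx ly.
have : cvgn (series (fun k => 2 * (a ^+ 2 * x k ^+ 2 + y k ^+ 2))).
  have -> : series (fun k => 2 * (a ^+ 2 * x k ^+ 2 + y k ^+ 2)) =
     (fun n => 2 * (a ^+ 2 * series (fun k => x k ^+ 2) n + series (fun k => y k ^+ 2) n)).
    by apply/funext => n; rewrite /series/= -mulr_sumr big_split/= -mulr_sumr.
  by apply: is_cvgMr; apply: is_cvgD => //; exact: is_cvgMr.
apply: series_le_cvg => n; rewrite ?sqr_ge0//.
  have := sqr_ge0 (a * x n); have := sqr_ge0 (y n); rewrite exprMn; lra.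
have := sqr_ge0 (a * x n - y n); lra.
Qed.

Lemma vecZD a x y : l2seq x -> l2seq y -> vec (fun k => a * x k + y k) = a *: vec x + vec y.
Proof.
move=> /cvg_vec lx /cvg_vec ly; apply: vec_eq_lim.
have -> : series (fun k => (a * x k + y k) *: f k) =
   (fun n => a *: series (fun k => x k *: f k) n + series (fun k => y k *: f k) n).
  apply/funext => n; rewrite /series/= scaler_sumr -big_split/=.
  by apply: eq_bigr => i _; rewrite scalerDl scalerA.
by apply: cvgD => //; apply: cvgZr.
Qed.

Lemma l2seqZ a x : l2seq x -> l2seq (fun k => a * x k).
Proof.
move=> lx; have -> : (fun k => a * x k) = (fun k => (a - 1) * x k + x k).
  by apply/funext => k; ring.
exact: l2seqZD.
Qed.

Lemma vecZ a x : l2seq x -> vec (fun k => a * x k) = a *: vec x.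
Proof.
move=> lx; have -> : (fun k => a * x k) = (fun k => (a - 1) * x k + x k).
  by apply/funext => k; ring.
by rewrite vecZD// scalerBl scale1r subrK.
Qed.

Lemma l2seqB x y : l2seq x -> l2seq y -> l2seq (fun k => x k - y k).
Proof.
move=> lx ly; have -> : (fun k => x k - y k) = (fun k => (-1) * y k + x k).
  by apply/funext => k; ring.
exact: l2seqZD.
Qed.

Lemma vecB x y : l2seq x -> l2seq y -> vec x - vec y = vec (fun k => x k - y k).
Proof.
move=> lx ly; have := vecZD (-1) ly lx.
rewrite scaleN1r addrC => <-; congr vec; apply/funext => k; ring.
Qed.

Lemma bessel w n : \sum_(0 <= k < n) ip w (f k) ^+ 2 <= `|w| ^+ 2.
Proof.
have := sqr_ge0 `|w - \sum_(0 <= k < n) ip w (f k) *: f k|.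
rewrite sqr_normB sqr_norm_sum_orthonormal ip_sumr.
under [X in 2 * X]eq_bigr do rewrite ipZr -expr2.
lra.
Qed.

Lemma l2seq_coef w : l2seq (fun k => ip w (f k)).
Proof.
apply: nondecreasing_is_cvgn.
  by apply: nondecreasing_series => i _ _; exact: sqr_ge0.
by exists (`|w| ^+ 2) => _ [n _ <-]; exact: bessel.
Qed.

(** The system [f] may be incomplete, so the coefficients alone do not determine [w]. Parseval's
    equality does: it makes the squared distance from [w] to its projection vanish. [spec_op_vec]
    identifies its vector in this way. *)
Lemma vec_coef w : series (fun k => ip w (f k) ^+ 2) @ \oo --> `|w| ^+ 2 ->
  vec (fun k => ip w (f k)) = w.
Proof.
move=> wl; apply/esym/eqP; rewrite -subr_eq0; apply/eqP/ip_eq0.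
have cl : l2seq (fun k => ip w (f k)) by exact: l2seq_coef.
have eqn : `|w| ^+ 2 = `|vec (fun k => ip w (f k))| ^+ 2.
  exact: (cvg_unique _ wl (cvg_sqr_norm_vec cl)).
have h : series (fun k => ip w (f k) ^+ 2) @ \oo --> ip (vec (fun k => ip w (f k))) w.
  have := cvg_ip_vec (w := w) cl; apply: cvg_trans; apply: near_eq_cvg; near=> n.
  by rewrite /series/=; apply: eq_bigr => i _; rewrite (ipC _ w) expr2.
have e2 : `|w| ^+ 2 = ip (vec (fun k => ip w (f k))) w by exact: (cvg_unique _ wl h).
by rewrite -Hip sqr_normB -eqn ipC -e2; ring.
Unshelve. all: by end_near. Qed.

End Orthonormal.
End InnerProduct.
Arguments cvg_ipl {R H ip} Hip {T F FF x l} xl v : rename.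
Arguments cvg_ip_vec {R H ip} Hip {f} f_on {x} w _ : rename.

(** * Spectral measures and functional calculus *)

Lemma cvgn_eq (R : realType) (u : nat -> R) (a b : R) : u @ \oo --> a -> u @ \oo --> b -> a = b.
Proof. by move=> ua ub; exact: (cvg_unique _ ua ub). Qed.

Lemma ecvgn_eq (R : realType) (u : nat -> \bar R) (a b : \bar R) :
  u @ \oo --> a -> u @ \oo --> b -> a = b.
Proof. by move=> ua ub; exact: (cvg_unique _ ua ub). Qed.

Lemma cvgn_EFin (R : realType) (u : nat -> R) (a : R) :
  u @ \oo --> a -> (fun n => (u n)%:E) @ \oo --> a%:E.
Proof. by move=> ua; apply: cvg_EFin => //; exact: nearW. Qed.

Section SpectralMeasure.
Context {R : realType} {H : completeNormedModType R} {ip : {dot H for idfun}}.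
Hypothesis Hip : norm_from_dot ip.
Variable E : set R -> H -> H.
Hypothesis HE : projection_valued_measure ip E.
Implicit Types (u v w : H) (B C : set R).

Lemma pvmZD B a u v : measurable B -> E B (a *: u + v) = a *: E B u + E B v.
Proof. by move=> mB; exact: (pvm_linear HE mB). Qed.

Lemma pvmD B u v : measurable B -> E B (u + v) = E B u + E B v.
Proof. by move=> mB; have := pvmZD 1 u v mB; rewrite !scale1r. Qed.

Lemma pvm0 B : measurable B -> E B 0 = 0.
Proof. by move=> mB; have := pvmZD (-1) 0 0 mB; rewrite addr0 scaler0 scaleN1r addNr. Qed.

Lemma pvmZ B a u : measurable B -> E B (a *: u) = a *: E B u.
Proof. by move=> mB; have := pvmZD a u 0 mB; rewrite !addr0 pvm0// addr0. Qed.

Lemma pvmB B u v : measurable B -> E B (u - v) = E B u - E B v.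
Proof. by move=> mB; rewrite pvmD// -scaleN1r pvmZ// scaleN1r. Qed.

Lemma pvm_set0 u : E set0 u = 0.
Proof.
have t0 : trivIset setT (fun _ : nat => set0 : set R).
  by apply/trivIsetP => *; rewrite setI0.
have := pvm_sigma_additive HE (u := u) (fun=> measurable0) t0.
rewrite bigcup0// => h; apply/eqP; rewrite -normr_eq0; apply/eqP.
have /cvg_norm := cvg_series_cvg_0 (cvgP _ h).
by rewrite normr0 => /(cvg_unique _ (cvg_cst _)) ->.
Qed.

Lemma pvm_setT u : E setT u = u.
Proof.
rewrite -[in LHS](pvm_total HE u) -(pvm_setI HE)// ?setTI; first exact: pvm_total HE u.
Qed.

Lemma pvm_idem B u : measurable B -> E B (E B u) = E B u.
Proof. by move=> mB; rewrite -(pvm_setI HE)// setIid. Qed.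

Lemma ip_pvm B u : measurable B -> ip (E B u) u = `|E B u| ^+ 2.
Proof. by move=> mB; rewrite Hip -(pvm_sym HE)// pvm_idem. Qed.

Lemma ip_pvm_pvm B C u v : measurable B -> measurable C ->
  ip (E B u) (E C v) = ip (E (B `&` C) u) v.
Proof. by move=> mB mC; rewrite -(pvm_sym HE)// -(pvm_setI HE)// setIC. Qed.

Lemma norm_pvm_le B u : measurable B -> `|E B u| <= `|u|.
Proof.
move=> mB; have [->|n0] := eqVneq `|E B u| 0; first exact: normr_ge0.
have p : 0 < `|E B u| by rewrite lt_neqAle eq_sym n0 normr_ge0.
rewrite -(ler_pM2l p) -expr2 -ip_pvm//; apply: le_trans (ler_norm _) _.
exact: cauchy_schwarz.
Qed.

(** A measure must be nonnegative on all sets, whereas [E B] is unconstrained when [B] is not Borel;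
    hence the cutoff. The two proofs are arguments so that the measure structure can be attached to
    [smu Hip HE u]. *)
Definition smu of norm_from_dot ip & projection_valued_measure ip E := fun u B =>
  if `[< measurable B >] then spec_meas ip E u B else 0%E.

Lemma smuE u B : measurable B -> smu Hip HE u B = (`|E B u| ^+ 2)%:E.
Proof. by move=> mB; rewrite /smu asboolT// /spec_meas ip_pvm. Qed.

Let smu0 u : smu Hip HE u set0 = 0%E.
Proof. by rewrite smuE// pvm_set0 normr0 expr0n. Qed.

Let smu_ge0 u B : (0 <= smu Hip HE u B)%E.
Proof.
by rewrite /smu; case: asboolP => // mB; rewrite /spec_meas ip_pvm//.
Qed.

Let smu_sigma_additive u : semi_sigma_additive (smu Hip HE u).
Proof.
move=> F mF tF mUF; rewrite smuE// -ip_pvm//.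
have /(cvg_ipl Hip)/(_ u) h := pvm_sigma_additive HE (u := u) mF tF.
have {}h : (fun n => (ip (series (fun n => E (F n) u) n) u)%:E) @ \oo -->
   (ip (E (\bigcup_n F n) u) u)%:E by exact: cvgn_EFin.
move: h; apply: cvg_trans; apply: near_eq_cvg; near=> n.
rewrite /series/= ip_suml -sumEFin; apply: eq_bigr => i _.
by rewrite smuE// ip_pvm.
Unshelve. all: by end_near. Qed.

HB.instance Definition _ u := isMeasure.Build _ _ _ (smu Hip HE u)
  (smu0 u) (smu_ge0 u) (@smu_sigma_additive u).

Import HBNNSimple.

(** The integral is built from simple functions, whose level sets are measurable; there the two set
    functions agree. *)
Lemma integral_spec_meas u (D : set R) (f : R -> \bar R) :
  (\int[spec_meas ip E u]_(x in D) f x)%E = (\int[smu Hip HE u]_(x in D) f x)%E.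
Proof.
rewrite /integral.
suff h (k : {nnsfun R >-> R}) : sintegral (spec_meas ip E u) k = sintegral (smu Hip HE u) k.
  congr (_ - _)%E; congr ereal_sup.
    by apply/seteqP; split => _ [k kf <-]; exists k => //; rewrite h.
  by apply/seteqP; split => _ [k kf <-]; exists k => //; rewrite h.
rewrite /sintegral; apply: eq_fsbigr => x _.
by rewrite /smu asboolT.
Qed.

Lemma smu_setT u : smu Hip HE u setT = (`|u| ^+ 2)%:E.
Proof. by rewrite smuE// pvm_setT. Qed.

Lemma smu_neg u : smu Hip HE u (~` `[0, +oo[%classic) = 0%E.
Proof.
have mC : measurable (~` `[0, +oo[%classic : set R) by exact: measurableC.
rewrite smuE// -[u in E _ u](pvm_total HE) -(pvm_setI HE)//.
by rewrite setICl pvm_set0 normr0 expr0n.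
Qed.

Lemma integral_smu_nng u (f : R -> R) : measurable_fun setT f -> (forall x, 0 <= f x) ->
  (\int[smu Hip HE u]_(x in `[0%R, +oo[%classic) (f x)%:E)%E = (\int[smu Hip HE u]_x (f x)%:E)%E.
Proof.
move=> mf f0.
rewrite [RHS](@ge0_negligible_integral _ _ _ _ setT (~` (`[0%R, +oo[%classic : set R)))//.
- by rewrite setTD setCK.
- exact: measurableC.
- exact/measurable_EFinP.
- by move=> x _; rewrite lee_fin.
- exact: smu_neg.
Qed.

Definition nnsfun_values (h : {nnsfun R >-> R}) : seq R :=
  finmap.enum_fset (fset_set (range h)).

Lemma mem_nnsfun_values h y : (y \in nnsfun_values h) = (y \in range h).
Proof. by rewrite -in_fset_set//; exact: fimfunP. Qed.

Lemma nnsfun_values_ge0 h y : y \in nnsfun_values h -> 0 <= y.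
Proof. by rewrite mem_nnsfun_values inE => -[x _ <-]; exact: fun_ge0. Qed.

Lemma integral_comp_nnsfun (p : R -> R) (h : {nnsfun R >-> R}) u : (forall x, 0 <= p (h x)) ->
  (\int[smu Hip HE u]_x (p (h x))%:E)%E =
  (\sum_(y <- nnsfun_values h) p y * ip (E (h @^-1` [set y]) u) u)%:E.
Proof.
move=> p0.
have p0' y : y \in nnsfun_values h -> 0 <= p y.
  by rewrite mem_nnsfun_values inE => -[x _ <-].
have -> : (fun x => (p (h x))%:E) =
   (* [p] is nonnegative only on the values of [h]; the absolute value makes every summand
      nonnegative, whatever [y]. *)
   (fun x => (\sum_(y <- nnsfun_values h) (`|p y|%:E * (\1_(h @^-1` [set y]) x)%:E))%E).
  apply/funext => x.
  rewrite (bigD1_seq (h x)) ?finmap.fset_uniq//=; last first.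
    by rewrite mem_nnsfun_values inE; exists x.
  rewrite indicE mem_set// mule1 ger0_norm// big1 ?adde0// => y yx.
  by rewrite indicE memNset ?mule0//= => /esym/eqP; rewrite (negbTE yx).
have mi y : measurable_fun setT (fun x => (\1_(h @^-1` [set y]) x)%:E : \bar R).
  exact/measurable_EFinP/measurable_indic.
rewrite ge0_integral_sum//; last first.
  by move=> y; apply: emeasurable_funM.
rewrite -sumEFin; apply: eq_big_seq => y /p0' py.
rewrite ge0_integralZl//.
by rewrite integral_indic// setIT ger0_norm// EFinM ip_pvm// -smuE.
Qed.

(** The operator h(A) of a simple function [h]. *)
Definition sop (h : {nnsfun R >-> R}) u : H :=
  \sum_(y <- nnsfun_values h) y *: E (h @^-1` [set y]) u.

Lemma sopD h u v : sop h (u + v) = sop h u + sop h v.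
Proof.
by rewrite /sop -big_split; apply: eq_bigr => y _; rewrite pvmD// scalerDr.
Qed.

Lemma sopB h u v : sop h (u - v) = sop h u - sop h v.
Proof.
by rewrite /sop -sumrB; apply: eq_bigr => y _; rewrite pvmB// scalerBr.
Qed.

Lemma ip_sop_sym h u v : ip (sop h u) v = ip u (sop h v).
Proof.
rewrite /sop ip_suml ip_sumr; apply: eq_bigr => y _.
by rewrite ipZl ipZr (pvm_sym HE).
Qed.

Lemma integral_nnsfun_smu (h : {nnsfun R >-> R}) u :
  (\int[smu Hip HE u]_x (h x)%:E)%E = (ip (sop h u) u)%:E.
Proof.
rewrite (integral_comp_nnsfun (p := id))//; congr EFin.
by rewrite /sop ip_suml; apply: eq_bigr => y _; rewrite ipZl.
Qed.

Lemma ip_sop_sop h h' u : ip (sop h u) (sop h' u) =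
  \sum_(y <- nnsfun_values h) \sum_(z <- nnsfun_values h')
     y * z * ip (E (h @^-1` [set y]) u) (E (h' @^-1` [set z]) u).
Proof.
rewrite /sop ip_suml; apply: eq_bigr => y _; rewrite ipZl ip_sumr mulr_sumr.
by apply: eq_bigr => z _; rewrite ipZr mulrA.
Qed.

(** The levels of [h'] partition the line, so the sum is the total mass of [smu (E B u)], obtained
    by integrating the constant 1. *)
Lemma sum_ip_level h' u B : measurable B ->
  \sum_(z <- nnsfun_values h') ip (E B u) (E (h' @^-1` [set z]) u) = `|E B u| ^+ 2.
Proof.
move=> mB; have := @integral_comp_nnsfun (fun=> 1) h' (E B u) (fun=> ler01).
rewrite integral_cst// mul1e [X in X = _ -> _]smu_setT => -[->].
apply: eq_bigr => z _.
rewrite mul1r !ip_pvm_pvm// -(pvm_setI HE)//; last exact: measurableI.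
by rewrite -setIA setIid setIC.
Qed.

Lemma sqr_norm_sop h u :
  `|sop h u| ^+ 2 = \sum_(y <- nnsfun_values h) y ^+ 2 * ip (E (h @^-1` [set y]) u) u.
Proof.
rewrite Hip ip_sop_sop; apply: eq_big_seq => y yh.
rewrite (bigD1_seq y) ?finmap.fset_uniq//= [X in _ + X]big1 ?addr0.
  by rewrite ip_pvm_pvm// setIid expr2.
move=> z zy; rewrite ip_pvm_pvm// (_ : _ `&` _ = set0) ?pvm_set0 ?linear0l ?mulr0//.
by apply/seteqP; split => // x /= [-> yz]; rewrite yz eqxx in zy.
Qed.

Lemma integral_sqr_nnsfun_smu (h : {nnsfun R >-> R}) u :
  (\int[smu Hip HE u]_x (h x ^+ 2)%:E)%E = (`|sop h u| ^+ 2)%:E.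
Proof.
by rewrite (integral_comp_nnsfun (p := fun x => x ^+ 2)) ?sqr_norm_sop// => x; exact: sqr_ge0.
Qed.

(** After expanding the square, it remains to bound |h(A) u|^2 by the inner product of h(A) u and
    h'(A) u. Both are sums over the joint level sets, and y <= z on each nonempty one. Together with
    [cvgn_of_sqr_le] this makes monotone approximations of f(A) u converge. *)
Lemma sqr_norm_sopB_le (h h' : {nnsfun R >-> R}) u : (forall x, h x <= h' x) ->
  `|sop h' u - sop h u| ^+ 2 <= `|sop h' u| ^+ 2 - `|sop h u| ^+ 2.
Proof.
move=> hh'; rewrite (sqr_normB Hip) ipC.
suff : `|sop h u| ^+ 2 <= ip (sop h u) (sop h' u) by lra.
rewrite sqr_norm_sop ip_sop_sop big_seq [leRHS]big_seq; apply: ler_sum => y yh.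
rewrite ip_pvm// -(sum_ip_level h')// mulr_sumr big_seq [leRHS]big_seq; apply: ler_sum => z zh.
rewrite ip_pvm_pvm//.
have [->|/set0P[x [/= hx hx']]] := eqVneq (h @^-1` [set y] `&` h' @^-1` [set z]) set0.
  by rewrite pvm_set0 linear0l !mulr0.
rewrite ip_pvm//; last exact: measurableI.
rewrite ler_wpM2r ?sqr_ge0// expr2 ler_wpM2l ?(nnsfun_values_ge0 yh)//.
by rewrite -hx -hx'.
Qed.

Section FunctionalCalculus.
Variable f : R -> R.
Hypotheses (mf : measurable_fun setT f) (f0 : forall x, 0 <= f x).

Let mEf : measurable_fun setT (EFin \o f).
Proof. exact/measurable_EFinP. Qed.

Let h n := nnsfun_approx measurableT mEf n.

Let h_nd n m x : (n <= m)%N -> h n x <= h m x.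
Proof. by move=> nm; have /lefP := nd_nnsfun_approx measurableT mEf nm; exact. Qed.

Let cvg_h x : (fun n => h n x) @ \oo --> f x.
Proof.
have /fine_cvgP[] := @cvg_nnsfun_approx _ _ _ _ measurableT _ mEf (fun x _ => f0 x) x I.
by [].
Qed.

Lemma cvg_integral_sop u :
  (fun n => (ip (sop (h n) u) u)%:E) @ \oo --> (\int[smu Hip HE u]_x (f x)%:E)%E.
Proof.
under eq_fun do rewrite -integral_nnsfun_smu.
have -> : (fun x => (f x)%:E) = (fun x => limn (fun n => (h n x)%:E)).
  by apply/funext => x; apply/esym/cvg_lim => //; apply: cvgn_EFin; exact: cvg_h.
apply: (@cvg_monotone_convergence _ _ _ (smu Hip HE u) setT measurableT
  (fun n x => (h n x)%:E)) => //.
- by move=> n; exact/measurable_EFinP.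
- by move=> n x _; rewrite lee_fin.
- by move=> x _ n m nm; rewrite lee_fin h_nd.
Qed.

Lemma cvg_integral_sqr_sop u :
  (fun n => (`|sop (h n) u| ^+ 2)%:E) @ \oo --> (\int[smu Hip HE u]_x (f x ^+ 2)%:E)%E.
Proof.
under eq_fun do rewrite -integral_sqr_nnsfun_smu.
have -> : (fun x => (f x ^+ 2)%:E) = (fun x => limn (fun n => (h n x ^+ 2)%:E)).
  apply/funext => x; apply/esym/cvg_lim => //; apply: cvgn_EFin.
  exact: (cvgM (cvg_h (x := x)) (cvg_h (x := x))).
apply: (@cvg_monotone_convergence _ _ _ (smu Hip HE u) setT measurableT
  (fun n x => (h n x ^+ 2)%:E)) => //.
- by move=> n; exact/measurable_EFinP/measurable_funX.
- by move=> n x _; rewrite lee_fin sqr_ge0.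
- by move=> x _ n m nm; rewrite lee_fin lerXn2r ?nnegrE ?h_nd.
Qed.

Lemma spec_domE u :
  spec_dom ip E f u = ((\int[smu Hip HE u]_x (f x ^+ 2)%:E < +oo)%E : Prop).
Proof.
rewrite /spec_dom/= integral_spec_meas integral_smu_nng//.
  exact: measurable_funX.
by move=> x; exact: sqr_ge0.
Qed.

Let cvg_sop u : spec_dom ip E f u -> cvgn (fun n => sop (h n) u).
Proof.
rewrite spec_domE => fin.
have cv := cvg_integral_sqr_sop (u := u).
have fn : (\int[smu Hip HE u]_x (f x ^+ 2)%:E)%E \is a fin_num.
  by rewrite ge0_fin_numE//; apply: integral_ge0 => x _; rewrite lee_fin sqr_ge0.
have cr : cvgn (fun n => `|sop (h n) u| ^+ 2).
  by move: cv; rewrite -(fineK fn) => /fine_cvgP[_ /cvgP].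
apply: (cvgn_of_sqr_le _ cr) => n m nm.
by apply: sqr_norm_sopB_le => x; exact: h_nd.
Qed.

Let integral_ip_lim u (l : H) : (fun n => sop (h n) u) @ \oo --> l ->
  (\int[smu Hip HE u]_x (f x)%:E)%E = (ip l u)%:E.
Proof.
move=> /(cvg_ipl Hip)/(_ u) ul; apply: (ecvgn_eq (cvg_integral_sop (u := u))).
exact: cvgn_EFin.
Qed.

(** [v] is the limit of h_n(A) u for simple functions h_n increasing to [f]. The two moments are
    recorded because they determine [v] when [u] is an eigenvector. *)
Lemma spec_graph_exists u : spec_dom ip E f u ->
  exists v, [/\ spec_graph ip E f u v,
    (\int[smu Hip HE u]_x (f x ^+ 2)%:E)%E = (`|v| ^+ 2)%:E &
    (\int[smu Hip HE u]_x (f x)%:E)%E = (ip v u)%:E].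
Proof.
move=> du; have /cvg_ex[v uv] := cvg_sop du; exists v; split; last exact: integral_ip_lim.
  split=> // w dw; have /cvg_ex[w' ww'] := cvg_sop dw.
  rewrite /spec_form !integral_spec_meas !integral_smu_nng//.
  have /integral_ip_lim -> : (fun n => sop (h n) (u + w)) @ \oo --> v + w'.
    by under eq_fun do rewrite sopD; exact: cvgD.
  have /integral_ip_lim -> : (fun n => sop (h n) (u - w)) @ \oo --> v - w'.
    by under eq_fun do rewrite sopB; exact: cvgB.
  (* Symmetry of the simple operators passes to the limit, so the cross terms of the polarization
     add up to 4 [ip v w]. *)
  have e1 : ip v w = ip w' u.
    have a1 : (fun n => ip (sop (h n) u) w) @ \oo --> ip v w by exact: cvg_ipl.
    have a2 : (fun n => ip (sop (h n) w) u) @ \oo --> ip w' u by exact: cvg_ipl.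
    have sw : (fun n => ip (sop (h n) u) w) = (fun n => ip (sop (h n) w) u).
      by apply/funext => n; rewrite ip_sop_sym ipC.
    by rewrite sw in a1; exact: cvgn_eq a1 a2.
  by rewrite /= ipBl !ipBr ipDl !ipDr e1; field.
apply: (ecvgn_eq (@cvg_integral_sqr_sop u) _).
by apply: cvgn_EFin; exact: cvg_sqr_norm.
Qed.

(** The difference d is orthogonal to the domain of f(A), which contains E(B_n) d for B_n the set
    where f <= n. Hence |E(B_n) d|^2 = (E(B_n) d, d) = 0, and the B_n exhaust the line. *)
Lemma spec_graph_unique u v v' : spec_graph ip E f u v -> spec_graph ip E f u v' -> v = v'.
Proof.
move=> [_ uv] [_ uv']; apply/eqP; rewrite -subr_eq0; apply/eqP.
set d := v - v'; pose B n := f @^-1` `[0, n%:R]%classic.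
have mB n : measurable (B n).
  by rewrite -[B n]setTI; exact: (mf measurableT).
have dB n : spec_dom ip E f (E (B n) d).
  rewrite spec_domE (@ge0_negligible_integral _ _ _ _ setT (~` B n))//.
  - rewrite setTD setCK.
    apply: (@le_lt_trans _ _ (\int[smu Hip HE (E (B n) d)]_(x in B n) (n%:R ^+ 2)%:E)%E).
      apply: ge0_le_integral => //.
      + by move=> x _; rewrite lee_fin sqr_ge0.
      + exact/measurable_funTS/measurable_EFinP/measurable_funX.
      + move=> x; rewrite /B/= in_itv/= => /andP[fx0 fxn].
        by rewrite lee_fin lerXn2r ?nnegrE.
    by rewrite integral_cst// [X in (_ * X)%E]smuE// -EFinM ltry.
  - exact: measurableC.
  - exact/measurable_EFinP/measurable_funX.
  - by move=> x _; rewrite lee_fin sqr_ge0.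
  - rewrite [LHS]smuE; last exact: measurableC.
    by rewrite -(pvm_setI HE)// ?setICl ?pvm_set0 ?normr0 ?expr0n//; exact: measurableC.
have mu0 n : smu Hip HE d (B n) = 0%E.
  by rewrite smuE// -ip_pvm// ipC /d ipBl uv// uv'// subrr.
have UB : \bigcup_n B n = setT.
  apply/seteqP; split => // x _; exists (Num.bound (f x)) => //.
  by rewrite /B/= in_itv/= f0/= ltW// archi_boundP.
have ndB : nondecreasing_seq B.
  move=> n m nm; apply/subsetPset => x; rewrite /B/= !in_itv/= => /andP[-> fxn]/=.
  by rewrite (le_trans fxn)// ler_nat.
have := @nondecreasing_cvg_mu _ _ _ (smu Hip HE d) B mB.
rewrite UB => /(_ measurableT ndB).
rewrite (_ : _ \o _ = cst 0%E); last by apply/funext => n /=; rewrite mu0.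
move=> /(ecvgn_eq (cvg_cst _)); rewrite [X in _ = X -> _]smu_setT => -[/esym/eqP].
by rewrite sqrf_eq0 normr_eq0 => /eqP.
Qed.

End FunctionalCalculus.
End SpectralMeasure.

(** * Spectral measure of an eigenvector *)

Section Eigenvectors.
Context {R : realType} {H : completeNormedModType R} {ip : {dot H for idfun}}.
Hypothesis Hip : norm_from_dot ip.
Variable E : set R -> H -> H.
Hypothesis HE : projection_valued_measure ip E.
Local Notation smu := (smu Hip HE).
Implicit Types (u v w : H) (B C : set R).

Lemma spec_formC f u w : spec_form ip E f u w = spec_form ip E f w u.
Proof.
rewrite /spec_form !(integral_spec_meas Hip HE) [u + w]addrC -[u - w]opprB.
congr ((_ - fine _) / _); apply: eq_measure_integral => B mB _.
by rewrite /= !smuE// -scaleN1r (pvmZ HE)// scaleN1r normrN.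
Qed.

Lemma smu_eq0 u B : measurable B -> smu u B = 0%E -> E B u = 0.
Proof.
by move=> mB; rewrite smuE// => -[/eqP]; rewrite sqrf_eq0 normr_eq0 => /eqP.
Qed.

Lemma smu_conull u B : measurable B -> smu u (~` B) = 0%E -> E B u = u.
Proof.
move=> mB u0; have mC := measurableC mB.
have : smu u setT = (smu u B + smu u (~` B))%E.
  by rewrite -(setUCr B); apply: measureU => //; exact: setICr.
rewrite u0 adde0 (smu_setT Hip HE) (smuE Hip HE)// => -[uE].
apply/eqP; rewrite eq_sym -subr_eq0 -normr_eq0 -sqrf_eq0; apply/eqP.
by rewrite (sqr_normB Hip) ipC (ip_pvm Hip HE)// uE; ring.
Qed.

(** The first two moments of [smu u] are mu |u|^2 and mu^2 |u|^2, so (s - mu)^2 has integral 0 and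
    the measure is carried by the point mu. *)
Lemma pvm_eigen u (mu : R) B : 0 < mu -> spec_graph ip E id u (mu *: u) -> measurable B ->
  E B u = \1_B mu *: u.
Proof.
(* The calculus above asks for functions nonnegative on the whole line; [f] agrees with the identity
   on [0, +oo[, which carries the measures. *)
move=> mu0 gid mB; pose f (s : R) := Num.max 0 s.
have mf : measurable_fun setT f by exact: measurable_maxr.
have f0 s : 0 <= f s by rewrite /f le_max lexx.
have fid s : s \in (`[0, +oo[%classic : set R) -> f s = s.
  by rewrite inE/= in_itv/= andbT => s0; rewrite /f; apply/max_idPr.
have domE v : spec_dom ip E id v = spec_dom ip E f v.
  rewrite /spec_dom/= !(integral_spec_meas Hip HE); congr ((_ < _)%E : Prop).
  by apply: eq_integral => s /fid ->.
have formE v w : spec_form ip E id v w = spec_form ip E f v w.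
  rewrite /spec_form !(integral_spec_meas Hip HE); congr ((fine _ - fine _) / _);
  by apply: eq_integral => s /fid ->.
have gf : spec_graph ip E f u (mu *: u).
  case: gid => du gu; split; first by rewrite -domE.
  by move=> w; rewrite -domE => /gu ->.
have [v [gv sqf intf]] := spec_graph_exists Hip HE mf f0 gf.1.
have vE := spec_graph_unique Hip HE mf f0 gf gv; subst v.
(* With 2 mu f moved to the other side of the expanded square, all integrands are nonnegative and
   integrals in the extended reals can be added freely. *)
have int0 : (\int[smu u]_x ((f x - mu) ^+ 2)%:E = 0)%E.
  have mg : measurable_fun setT (fun x => (f x - mu) ^+ 2).
    by apply: measurable_funX; exact: measurable_funB.
  have mf2 : measurable_fun setT (fun x => f x ^+ 2) by exact: measurable_funX.
  have e1 : (\int[smu u]_x (2 * mu * f x)%:E = (2 * mu)%:E * \int[smu u]_x (f x)%:E)%E.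
    under eq_integral do rewrite EFinM.
    apply: ge0_integralZl => //.
    - exact/measurable_EFinP.
    - by move=> x _; rewrite lee_fin.
    - by rewrite lee_fin mulr_ge0// ltW.
  have e2 : (\int[smu u]_x ((f x - mu) ^+ 2 + 2 * mu * f x)%:E =
      \int[smu u]_x ((f x - mu) ^+ 2)%:E + \int[smu u]_x (2 * mu * f x)%:E)%E.
    under eq_integral do rewrite EFinD.
    apply: ge0_integralD => //; try by (apply/measurable_EFinP => //; exact: measurable_funM).
    - by move=> x _; rewrite lee_fin sqr_ge0.
    - by move=> x _; rewrite lee_fin !mulr_ge0// ltW.
  have e3 : (\int[smu u]_x (f x ^+ 2 + mu ^+ 2)%:E =
      \int[smu u]_x (f x ^+ 2)%:E + \int[smu u]_x (cst ((mu ^+ 2)%:E) x))%E.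
    under eq_integral do rewrite EFinD.
    apply: ge0_integralD => //; try exact/measurable_EFinP.
    - by move=> x _; rewrite lee_fin sqr_ge0.
    - by move=> x _; rewrite lee_fin sqr_ge0.
  have e4 : (\int[smu u]_x (cst ((mu ^+ 2)%:E) x) = (mu ^+ 2 * `|u| ^+ 2)%:E)%E.
    rewrite integral_cst//; transitivity ((mu ^+ 2)%:E * smu u setT)%E => //.
    by rewrite (smu_setT Hip HE).
  have : (\int[smu u]_x ((f x - mu) ^+ 2 + 2 * mu * f x)%:E =
          \int[smu u]_x (f x ^+ 2 + mu ^+ 2)%:E)%E.
    by apply: eq_integral => x _; congr EFin; ring.
  rewrite e2 e1 e3 sqf intf e4.
  rewrite normrZ ipZl -Hip exprMn gtr0_norm// -!EFinM -EFinD.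
  case: (\int[smu u]_x _)%E => // r [e]; congr EFin; lra.
have null : smu u (~` [set mu]) = 0%E.
  have mC : measurable (~` [set mu]) by exact: measurableC.
  have mg : measurable_fun setT (fun x => ((f x - mu) ^+ 2)%:E).
    by apply/measurable_EFinP/measurable_funX; exact: measurable_funB.
  have : ae_eq (smu u) setT (fun x => ((f x - mu) ^+ 2)%:E) (cst 0%E).
    apply/(ae_eq_integral_abs (smu u) measurableT mg).1; rewrite -[RHS]int0.
    by apply: eq_integral => x _; rewrite gee0_abs// lee_fin sqr_ge0.
  rewrite /ae_eq/= /almost_everywhere => /(@negligibleS _ _ _ _ _ (~` [set mu])) ng.
  apply/(negligibleP _ mC)/ng => x /= xmu; apply: contra_not xmu => /(_ I)[/eqP].
  rewrite sqrf_eq0 subr_eq0 => /eqP fx.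
  (* Positivity of mu excludes the points x <= 0, where [f] vanishes. *)
  by move: mu0; rewrite -fx /f lt_max ltxx/= => x0; rewrite max_r ?(ltW x0).
have [Bmu|nBmu] := boolP (mu \in B).
  rewrite indicE Bmu scale1r; apply: smu_conull => //.
  apply/eqP; rewrite eq_le measure_ge0 andbT -null le_measure ?inE//.
  - exact: measurableC.
  - exact: measurableC.
  - by move=> x /= nBx xmu; apply: nBx; rewrite xmu; exact: set_mem Bmu.
rewrite indicE (negbTE nBmu) scale0r; apply: smu_eq0 => //.
apply/eqP; rewrite eq_le measure_ge0 andbT -null le_measure ?inE//.
- exact: measurableC.
- by move=> x Bx /= xmu; move: nBmu; rewrite -xmu notin_setE.
Qed.

End Eigenvectors.

(** * Functional calculus on the closed span of the eigenvectors *)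

Section DiscreteSpectrum.
Context {R : realType} {H : completeNormedModType R} {ip : {dot H for idfun}}.
Hypothesis Hip : norm_from_dot ip.
Variable E : set R -> H -> H.
Hypothesis HE : projection_valued_measure ip E.
Variables (e : nat -> H) (nu : nat -> R).
Hypothesis e_on : forall j k, ip (e j) (e k) = (j == k)%:R.
Hypothesis nu_gt0 : forall k, 0 < nu k.
Hypothesis pvm_e : forall k B, measurable B -> E B (e k) = \1_B (nu k) *: e k.
Local Notation smu := (smu Hip HE).
Implicit Types (u v w : H) (B C : set R) (x : nat -> R).

Import HBNNSimple.

Lemma l2seq_indic x B : l2seq x -> l2seq (fun k => \1_B (nu k) * x k).
Proof.
apply: series_le_cvg => k; rewrite ?sqr_ge0// exprMn.
by rewrite indicE; case: (_ \in _); rewrite ?expr1n ?mul1r// expr0n mul0r sqr_ge0.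
Qed.

Lemma pvm_vec x B : l2seq x -> measurable B -> E B (vec e x) = vec e (fun k => \1_B (nu k) * x k).
Proof.
move=> lx mB; apply/esym/vec_eq_lim.
have := cvg_vec Hip e_on lx; set s := series _ => sx.
have -> : series (fun k => (\1_B (nu k) * x k) *: e k) = (fun n => E B (s n)).
  apply/funext => n; rewrite /s /series/=.
  elim: n => [|n IH]; first by rewrite !big_geq// (pvm0 HE).
  rewrite !big_nat_recr//= (pvmD HE)// IH (pvmZ HE)// pvm_e// scalerA.
  by rewrite [x n * _]mulrC.
apply/cvgrPdist_le => eps eps0; near=> n.
rewrite -(pvmB HE)//; apply: le_trans (norm_pvm_le Hip HE _ mB) _.
by near: n; move/cvgrPdist_le: sx; apply.
Unshelve. all: by end_near. Qed.

Let atom x k : {measure set R -> \bar R} :=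
  mscale (NngNum (sqr_ge0 (x k))) (dirac (nu k)).

Lemma smu_vec x B : l2seq x -> measurable B -> smu (vec e x) B = mseries (atom x) 0 B.
Proof.
move=> lx mB; rewrite smuE// pvm_vec// /mseries.
have := cvg_sqr_norm_vec Hip e_on (l2seq_indic (B := B) lx) => /cvgn_EFin h.
apply: (ecvgn_eq h); apply: cvg_trans.
  2: exact: (@is_cvg_nneseries _ (fun k => atom x k B) xpredT 0).
apply: near_eq_cvg; near=> n.
rewrite /series/= -sumEFin; apply: eq_bigr => k _.
rewrite /atom /mscale/= diracE -EFinM exprMn indicE; congr EFin.
by case: (_ \in _); rewrite /= ?expr1n ?expr0n/= mulrC.
Unshelve. all: by end_near. Qed.

Lemma integral_atom x k (g : R -> \bar R) : measurable_fun setT g -> (forall s, 0 <= g s)%E ->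
  (\int[atom x k]_s g s = (x k ^+ 2)%:E * g (nu k))%E.
Proof.
move=> mg g0; rewrite /atom ge0_integral_mscale//; congr (_ * _)%E.
by rewrite integral_dirac// diracE mem_set// mul1e.
Qed.

Lemma integral_smu_vec x (g : R -> R) : l2seq x -> measurable_fun setT g -> (forall s, 0 <= g s) ->
  (\int[smu (vec e x)]_s (g s)%:E = \sum_(k <oo) (g (nu k) * x k ^+ 2)%:E)%E.
Proof.
move=> lx mg g0; have mEg : measurable_fun setT (EFin \o g) by exact/measurable_EFinP.
rewrite (eq_measure_integral (mseries (atom x) 0)); last by move=> B mB _; exact: smu_vec.
rewrite ge0_integral_measure_series//; last by move=> s _; rewrite lee_fin.
have g0E s : (0%R <= (EFin \o g) s)%E by rewrite lee_fin.
by apply: eq_eseriesr => k _; rewrite (integral_atom x k mEg g0E) -EFinM mulrC.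
Qed.

(** The Gevrey weight need not be measurable, since phi is arbitrary. The integral is still a
    supremum over simple functions below [g], which gives the upper bound that membership in a
    Gevrey space requires. *)
Lemma integral_spec_meas_vec_le x (g : R -> R) : l2seq x -> (forall s, 0 <= g s) ->
  (\int[spec_meas ip E (vec e x)]_(s in `[0%R, +oo[%classic) (g s)%:E <=
   \sum_(k <oo) (g (nu k) * x k ^+ 2)%:E)%E.
Proof.
move=> lx g0; rewrite (integral_spec_meas Hip HE) ge0_integralE; last first.
  by move=> s _; rewrite lee_fin.
apply: ge_ereal_sup => _ [h hg <-].
have := integral_nnsfun (smu (vec e x)) measurableT h; rewrite patch_setT => <-.
rewrite integral_smu_vec//.
apply: lee_nneseries => [k _ _|k _]; first by rewrite lee_fin mulr_ge0// sqr_ge0.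
rewrite lee_fin ler_wpM2r ?sqr_ge0//.
have := hg (nu k); rewrite /patch mem_set ?lee_fin//=.
by rewrite in_itv/= ltW.
Qed.

Section FunctionalCalculus.
Variable f : R -> R.
Hypotheses (mf : measurable_fun setT f) (f0 : forall s, 0 <= f s).

Lemma nneseries_sqrE x : l2seq x ->
  (\sum_(k <oo) (x k ^+ 2)%:E = (`|vec e x| ^+ 2)%:E)%E.
Proof.
move=> lx; apply/cvg_lim => //.
have /cvgn_EFin := cvg_sqr_norm_vec Hip e_on lx.
by apply: cvg_trans; apply: near_eq_cvg; apply: nearW => n; rewrite /series/= -sumEFin.
Qed.

Let integral_sqr_vec x : l2seq x ->
  (\int[smu (vec e x)]_s (f s ^+ 2)%:E = \sum_(k <oo) ((f (nu k) * x k) ^+ 2)%:E)%E.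
Proof.
move=> lx; rewrite (integral_smu_vec lx (g := fun s => f s ^+ 2)).
- by apply: eq_eseriesr => k _; rewrite exprMn.
- exact: measurable_funX.
- by move=> s; exact: sqr_ge0.
Qed.

Lemma spec_dom_vec x : l2seq x -> l2seq (fun k => f (nu k) * x k) -> spec_dom ip E f (vec e x).
Proof.
by move=> lx lfx; rewrite (spec_domE Hip HE mf) integral_sqr_vec// nneseries_sqrE// ltry.
Qed.

(** Each term is at most the finite sum. The contrapositive is the way in which loss of derivatives
    is detected. *)
Lemma spec_dom_vec_bound x : l2seq x -> spec_dom ip E f (vec e x) ->
  exists M, forall k, (f (nu k) * x k) ^+ 2 <= M.
Proof.
move=> lx; rewrite (spec_domE Hip HE mf) integral_sqr_vec// => fin.
exists (fine (\sum_(k <oo) ((f (nu k) * x k) ^+ 2)%:E)%E) => k.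
rewrite -lee_fin fineK; last first.
  by rewrite ge0_fin_numE//; apply: nneseries_ge0 => n _ _; rewrite lee_fin sqr_ge0.
rewrite (nneseriesD1 (n := k))// ?leeDl//.
  by apply: nneseries_ge0 => n _ _; rewrite lee_fin sqr_ge0.
by move=> n _; rewrite lee_fin sqr_ge0.
Qed.

Lemma spec_opP u : spec_dom ip E f u -> spec_graph ip E f u (spec_op ip E f u).
Proof.
by move=> du; apply: getPex; have [v [gv _ _]] := spec_graph_exists Hip HE mf f0 du; exists v.
Qed.

Lemma sqr_norm_spec_op u : spec_dom ip E f u ->
  (\int[smu u]_s (f s ^+ 2)%:E = (`|spec_op ip E f u| ^+ 2)%:E)%E.
Proof.
move=> du; have [v [gv fv _]] := spec_graph_exists Hip HE mf f0 du.
by rewrite fv (spec_graph_unique Hip HE mf f0 gv (spec_opP du)).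
Qed.

(** The spectral measure of [e k] is a Dirac mass, so the image v of [e k] satisfies |v|^2 = f(nu
    k)^2 and (v, e k) = f(nu k), which forces |v - f(nu k) e k|^2 = 0. *)
Lemma spec_graph_basis k : spec_graph ip E f (e k) (f (nu k) *: e k).
Proof.
have smu_e B : measurable B -> smu (e k) B = dirac (nu k) B.
  move=> mB; rewrite smuE// pvm_e// diracE indicE.
  have e1 : `|e k| ^+ 2 = 1 by rewrite Hip e_on eqxx.
  by case: (_ \in _); rewrite ?scale1r ?scale0r ?e1// normr0 expr0n.
have int_e (g : R -> R) : measurable_fun setT g -> (\int[smu (e k)]_s (g s)%:E = (g (nu k))%:E)%E.
  move=> mg; rewrite (eq_measure_integral (dirac (nu k))); last by move=> B mB _; exact: smu_e.
  by rewrite integral_dirac ?diracE ?mem_set ?mul1e//; exact/measurable_EFinP.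
have de : spec_dom ip E f (e k).
  by rewrite (spec_domE Hip HE mf) (int_e (fun s => f s ^+ 2)) ?ltry//; exact: measurable_funX.
have [v [gv sqv iv]] := spec_graph_exists Hip HE mf f0 de.
suff -> : f (nu k) *: e k = v by [].
apply/eqP; rewrite eq_sym -subr_eq0 -normr_eq0 -sqrf_eq0; apply/eqP.
rewrite (sqr_normB Hip) normrZ exprMn real_normK ?num_real// ipZr Hip (Hip (e k)).
have -> : ip (e k) (e k) = 1 by rewrite e_on eqxx.
move: sqv iv; rewrite int_e// (int_e (fun s => f s ^+ 2)); last exact: measurable_funX.
by rewrite Hip => -[<-] [<-]; ring.
Qed.

Lemma ip_spec_op_basis u k : spec_dom ip E f u ->
  ip (spec_op ip E f u) (e k) = f (nu k) * ip u (e k).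
Proof.
move=> du; have [de ge] := spec_graph_basis k.
have [_ ->//] := spec_opP du.
by rewrite (spec_formC Hip HE) -ge// ipZl ipC.
Qed.

Lemma spec_op_vec x : l2seq x -> l2seq (fun k => f (nu k) * x k) ->
  spec_op ip E f (vec e x) = vec e (fun k => f (nu k) * x k).
Proof.
move=> lx lfx; have du := spec_dom_vec lx lfx.
have coef k : ip (spec_op ip E f (vec e x)) (e k) = f (nu k) * x k.
  by rewrite ip_spec_op_basis// (ip_vec Hip).
rewrite -[LHS](vec_coef Hip e_on).
  by congr vec; apply/funext => k; rewrite coef.
under eq_fun do rewrite coef.
have := sqr_norm_spec_op du; rewrite integral_sqr_vec// nneseries_sqrE// => -[<-].
exact: cvg_sqr_norm_vec.
Qed.

End FunctionalCalculus.
End DiscreteSpectrum.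

(** * Linear second order equations *)

Section LinearODE.
Context {R : realType}.
Implicit Types (a b t s K M : R) (f g y z q F : R -> R).

Local Notation cont a b f := {within `[a, b], continuous f}.

Lemma within_continuousD a b f g : cont a b f -> cont a b g -> cont a b (fun t => f t + g t).
Proof.
move=> /subspace_continuousP cf /subspace_continuousP cg; apply/subspace_continuousP => x ax.
by apply: cvgD; [exact: cf | exact: cg].
Qed.

Lemma within_continuousN a b f : cont a b f -> cont a b (fun t => - f t).
Proof.
move=> /subspace_continuousP cf; apply/subspace_continuousP => x ax.
by apply: cvgN; exact: cf.
Qed.

Lemma within_continuousM a b f g : cont a b f -> cont a b g -> cont a b (fun t => f t * g t).
Proof.
move=> /subspace_continuousP cf /subspace_continuousP cg; apply/subspace_continuousP => x ax.
by apply: cvgM; [exact: cf | exact: cg].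
Qed.

Lemma within_continuous_cst a b (c : R) : cont a b (fun=> c).
Proof. by apply/subspace_continuousP => x ax; exact: cvg_cst. Qed.

Lemma derive_within_continuous a b f g :
  (forall t, is_derive t 1 f (g t)) -> cont a b f.
Proof.
move=> df; apply: continuous_subspaceT => t.
by apply: differentiable_continuous; apply/derivable1_diffP; case: (df t).
Qed.

Lemma within_continuousS a b a' b' f : a <= a' -> b' <= b -> cont a b f -> cont a' b' f.
Proof.
move=> aa bb; apply: continuous_subspaceW => t /=.
by rewrite !in_itv/= => /andP[at' tb]; rewrite (le_trans aa)// (le_trans tb).
Qed.

Lemma nondecreasing_of_derive a b f g : a <= b -> cont a b f ->
  (forall t, a < t < b -> is_derive t 1 f (g t)) ->
  (forall t, a < t < b -> 0 <= g t) -> f a <= f b.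
Proof.
move=> ab cf df g0; have [<-//|anb] := eqVneq a b.
have {}ab : a < b by rewrite lt_neqAle anb.
have df' t : t \in `]a, b[ -> is_derive t 1 f (g t) by rewrite in_itv; exact: df.
have [c + fE] := MVT ab df' cf.
by rewrite in_itv/= => hc; rewrite -subr_ge0 fE mulr_ge0 ?g0// subr_ge0 ltW.
Qed.

Lemma is_derive_expRM K t : is_derive t 1 (fun s => expR (K * s)) (K * expR (K * t)).
Proof.
have h : is_derive t 1 (fun s : R => K * s) K.
  by apply: is_derive_eq; rewrite /GRing.scale/= mulr1.
by have := @is_derive1_comp R expR (fun s => K * s) t _ _ (is_derive_expR _) h; rewrite mulrC.
Qed.

Lemma gronwall_le K a b f g : a <= b -> cont a b f ->
  (forall t, a < t < b -> is_derive t 1 f (g t)) ->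
  (forall t, a < t < b -> g t <= K * f t) -> f b <= f a * expR (K * (b - a)).
Proof.
move=> ab cf df fg.
suff : - (f a * expR (- K * a)) <= - (f b * expR (- K * b)).
  rewrite lerN2 -(ler_pM2r (expR_gt0 (K * b))) -!mulrA -!expRD.
  by rewrite mulNr addNr expR0 mulr1; have -> : - K * a + K * b = K * (b - a) by ring.
apply: (@nondecreasing_of_derive a b (fun t => - (f t * expR (- K * t)))
   (fun t => (K * f t - g t) * expR (- K * t))) => //.
- apply/within_continuousN/within_continuousM => //.
  by apply: derive_within_continuous => t; exact: is_derive_expRM.
- move=> t ht; have h1 := df t ht; have h2 := is_derive_expRM (- K) t.
  by apply: is_derive_eq; rewrite /GRing.scale/=; ring.
- by move=> t ht; rewrite mulr_ge0 ?expR_ge0// subr_ge0 fg.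
Qed.

Lemma gronwall_ge K a b f g : a <= b -> cont a b f ->
  (forall t, a < t < b -> is_derive t 1 f (g t)) ->
  (forall t, a < t < b -> - K * f t <= g t) -> f a <= f b * expR (K * (b - a)).
Proof.
move=> ab cf df fg.
have h : - f b <= - f a * expR (- K * (b - a)).
  apply: (@gronwall_le (- K) a b (fun t => - f t) (fun t => - g t) ab (within_continuousN cf)).
    by move=> t ht; have h1 := df t ht; exact: is_deriveN.
  by move=> t ht; rewrite mulrN lerN2 fg.
by move: h; rewrite !mulNr lerN2 expRN ler_pdivrMr ?expR_gt0.
Qed.

Lemma primitive_exists a b f : a < b -> cont a b f ->
  exists F, [/\ F a = 0, cont a b F & forall t, a < t < b -> is_derive t 1 F (f t)].
Proof.
move=> ab cf; pose F := parameterized_integral lebesgue_measure a ^~ f.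
have intf : lebesgue_measure.-integrable `[a, b] (EFin \o f).
  by apply: continuous_compact_integrable => //; exact: segment_compact.
exists F; split.
- by rewrite /F /parameterized_integral set_itv1 Rintegral_set1.
- by apply: parameterized_integral_continuous => //; exact: ltW.
- move=> t /andP[at' tb].
  have /(continuous_within_itvP _ ab)[cfo _ _] := cf.
  have cft : {for t, continuous f} by apply: cfo; rewrite in_itv/= at' tb.
  have [dF dFE] := continuous_FTC1_closed tb intf at' cft.
  have dE : 'D_1 F t = f t by rewrite -derive1E; exact: dFE.
  exact: (DeriveDef dF dE).
Qed.

(** In the norm weighted by exp(K (t - a)), integration gains a factor 1 / K. With [G] a primitive
    of the majorant, both G + F and G - F are nondecreasing. *)
Lemma primitive_bound K M a b f F : 0 < K -> 0 <= M -> F a = 0 -> cont a b F ->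
  (forall t, a < t < b -> is_derive t 1 F (f t)) ->
  (forall t, a <= t <= b -> `|f t| <= M * expR (K * (t - a))) ->
  forall t, a <= t <= b -> `|F t| <= M / K * expR (K * (t - a)).
Proof.
move=> K0 M0 Fa cF dF fM t /andP[at' tb].
pose G s := M / K * expR (K * (s - a)).
have dG (s : R) : is_derive s 1 G (M * expR (K * (s - a))).
  have -> : G = (fun s => M / K * expR (- (K * a)) * expR (K * s)).
    by apply/funext => r; rewrite /G -[RHS]mulrA -expRD; congr (_ * expR _); ring.
  have h := is_derive_expRM K s; apply: is_derive_eq; rewrite /GRing.scale/=.
  have -> : K * (s - a) = - (K * a) + K * s by ring.
  rewrite expRD; set u1 := expR _; set u2 := expR _.
  have K1 : K != 0 by exact: lt0r_neq0.
  by field.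
have Ga : 0 <= G a by rewrite /G mulr_ge0 ?expR_ge0// divr_ge0// ltW.
have cG : cont a t G by exact: derive_within_continuous dG.
have cF' : cont a t F by exact: within_continuousS cF.
have sub s : a < s < t -> a < s < b by move=> /andP[-> st]; rewrite (lt_le_trans st).
have subc s : a < s < t -> a <= s <= b by move=> /sub /andP[h1 h2]; rewrite !ltW.
rewrite -/(G t) ler_norml; apply/andP; split.
- have : G a + F a <= G t + F t.
    apply: (@nondecreasing_of_derive a t (fun s => G s + F s)
      (fun s => M * expR (K * (s - a)) + f s) at').
    + exact: within_continuousD.
    + by move=> s hs; have h1 := dF s (sub s hs); have h2 := dG s; exact: is_deriveD.
    + by move=> s /subc/fM; rewrite ler_norml => /andP[h _]; lra.
  by rewrite Fa; lra.
- have : G a + - F a <= G t + - F t.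
    apply: (@nondecreasing_of_derive a t (fun s => G s + - F s)
      (fun s => M * expR (K * (s - a)) + - f s) at').
    + by apply: within_continuousD => //; exact: within_continuousN.
    + move=> s hs; have h1 := dF s (sub s hs); have h2 := dG s.
      by apply: is_deriveD.
    + by move=> s /subc/fM; rewrite ler_norml => /andP[_ h]; lra.
  by rewrite Fa; lra.
Qed.

(** The intervals of radius [d n] around [u n] are nested, because d n - d (n+1) = C / 2^n; the
    limit of their left ends lies in all of them. *)
Lemma geometric_cauchy (u : nat -> R) C : (forall n, `|u n.+1 - u n| <= C / 2 ^+ n) ->
  exists l, forall n, `|u n - l| <= 2 * C / 2 ^+ n.
Proof.
move=> uC.
have C0 : 0 <= C by have := uC 0%N; rewrite expr0 divr1; apply: le_trans.
pose d n := 2 * C / 2 ^+ n.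
have dS n : d n = d n.+1 + C / 2 ^+ n by rewrite /d exprS invfM; field.
have d0 n : 0 <= d n by rewrite divr_ge0 ?mulr_ge0// exprn_ge0.
pose lo n := u n - d n; pose hi n := u n + d n.
have loS : nondecreasing_seq lo.
  apply/nondecreasing_seqP => n; rewrite /lo dS.
  by have := uC n; rewrite ler_norml => /andP[h1 h2]; lra.
have hiS : nonincreasing_seq hi.
  apply/nonincreasing_seqP => n; rewrite /hi [d n]dS.
  by have := uC n; rewrite ler_norml => /andP[h1 h2]; lra.
have lohi n m : lo n <= hi m.
  apply: (@le_trans _ _ (lo (maxn n m))); first by rewrite loS// leq_maxl.
  apply: (@le_trans _ _ (hi (maxn n m))); last by rewrite hiS// leq_maxr.
  by rewrite /lo /hi; have := d0 (maxn n m); lra.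
have clo : cvgn lo.
  by apply: nondecreasing_is_cvgn => //; exists (hi 0%N) => _ [n _ <-]; exact: lohi.
exists (limn lo) => n.
have h1 := nondecreasing_cvgn_le loS clo n.
have h2 : limn lo <= hi n by apply: limr_le => //; apply: nearW => m; exact: lohi.
by rewrite -/(d n) ler_norml; apply/andP; split; move: h1 h2; rewrite /lo /hi; lra.
Qed.

End LinearODE.

(** * Picard iteration in an exponentially weighted norm *)

Section PicardIteration.
Context {R : realType}.
Variables (a b Q y0 z0 : R) (q : R -> R).
Local Notation cont f := {within `[a, b], continuous f}.
Hypotheses (ab : a < b) (cq : cont q) (qQ : forall t, a <= t <= b -> `|q t| <= Q).

Let prim (f : R -> R) : R -> R :=
  xget (fun=> 0) [set F | [/\ F a = 0, cont F & forall t, a < t < b -> is_derive t 1 F (f t)]].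

Let primP (f : R -> R) : cont f ->
  [/\ prim f a = 0, cont (prim f) & forall t, a < t < b -> is_derive t 1 (prim f) (f t)].
Proof. by move=> cf; rewrite /prim; case: xgetP => // h; have [F /h] := primitive_exists ab cf. Qed.

Let zpart (f : R -> R) : R -> R := fun t => z0 + prim (fun s => - (q s * f s)) t.
Let step (f : R -> R) : R -> R := fun t => y0 + prim (zpart f) t.

Let cont_qf f : cont f -> cont (fun s => - (q s * f s)).
Proof. by move=> cf; apply: within_continuousN; exact: within_continuousM. Qed.

Let cont_zpart f : cont f -> cont (zpart f).
Proof.
move=> cf; apply: within_continuousD; first exact: within_continuous_cst.
by have [] := primP (cont_qf cf).
Qed.

Let cont_step f : cont f -> cont (step f).
Proof.
move=> cf; apply: within_continuousD; first exact: within_continuous_cst.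
by have [] := primP (cont_zpart cf).
Qed.

(** [step] multiplies by q once and integrates twice, so its Lipschitz constant in the norm with
    weight [W] is Q / K^2. This choice of K makes it at most 1 / 2, on an interval of any length. *)
Let K := Q + 1.
Let W t := expR (K * (t - a)).

Let Q0 : 0 <= Q.
Proof. by apply: le_trans (qQ (t := a) _) => //; rewrite lexx ltW. Qed.

Let K0 : 0 < K. Proof. by rewrite /K ltr_wpDl. Qed.

Let W1 t : a <= t -> 1 <= W t.
Proof. by move=> at'; rewrite /W -expR0 ler_expR mulr_ge0 ?subr_ge0// ltW. Qed.

Let prim_lip f g M : 0 <= M -> cont f -> cont g ->
  (forall t, a <= t <= b -> `|f t - g t| <= M * W t) ->
  forall t, a <= t <= b -> `|prim f t - prim g t| <= M / K * W t.
Proof.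
move=> M0 cf cg fgM t ht.
have [f0 cF dF] := primP cf; have [g0 cG dG] := primP cg.
apply: (@primitive_bound _ K M a b (fun t => f t - g t) (fun t => prim f t - prim g t)) => //.
- by rewrite f0 g0 subrr.
- by apply: within_continuousD => //; exact: within_continuousN.
- by move=> s hs; have h1 := dF s hs; have h2 := dG s hs; exact: is_deriveB.
Qed.

Let step_lip f g M : 0 <= M -> cont f -> cont g ->
  (forall t, a <= t <= b -> `|f t - g t| <= M * W t) ->
  forall t, a <= t <= b -> `|step f t - step g t| <= M / 2 * W t.
Proof.
move=> M0 cf cg fgM t ht.
have QM : 0 <= Q * M by exact: mulr_ge0.
have h1 : forall t, a <= t <= b -> `|zpart f t - zpart g t| <= Q * M / K * W t.
  move=> s hs; rewrite /zpart opprD addrACA subrr add0r.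
  apply: prim_lip => //; [exact: cont_qf|exact: cont_qf|move=> r hr].
  rewrite -opprD normrN -mulrBr normrM -mulrA.
  by apply: ler_pM => //; [exact: qQ | exact: fgM].
have QMK : 0 <= Q * M / K by rewrite divr_ge0// ltW.
have := prim_lip QMK (cont_zpart cf) (cont_zpart cg) h1 ht.
rewrite /step opprD addrACA subrr add0r => /le_trans; apply; apply: ler_wpM2r; first exact: expR_ge0.
rewrite ler_pdivrMr// ler_pdivrMr// /K.
have : 0 <= M * (Q ^+ 2 + 1) by rewrite mulr_ge0// addr_ge0 ?sqr_ge0.
have -> : M / 2 * (Q + 1) * (Q + 1) = M * (Q ^+ 2 + 1) / 2 + Q * M by field.
by lra.
Qed.

Let Y n := iter n step (fun=> y0).

Let cont_Y n : cont (Y n).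
Proof. by elim: n => [|n IH]; [exact: within_continuous_cst | exact: cont_step]. Qed.

Let prim_le f M : 0 <= M -> cont f -> (forall t, a <= t <= b -> `|f t| <= M * W t) ->
  forall t, a <= t <= b -> `|prim f t| <= M * W t.
Proof.
move=> M0 cf fM t ht; have [f0 cF dF] := primP cf.
have := @primitive_bound _ K M a b f (prim f) K0 M0 f0 cF dF fM t ht.
move/le_trans; apply; apply: ler_wpM2r; first exact: expR_ge0.
by rewrite ler_pdivrMr// /K mulrDr mulr1 lerDr mulr_ge0.
Qed.

(** Weighted bound of the first Picard increment: |z0| from the initial velocity, Q |y0| from the
    integral of q y0. *)
Let M := `|z0| + Q * `|y0|.
Let M0 : 0 <= M. Proof. by rewrite addr_ge0// mulr_ge0. Qed.

Let Y1 t : a <= t <= b -> `|Y 1 t - Y 0 t| <= M * W t.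
Proof.
move=> ht; rewrite /Y/= /step [y0 + _]addrC addrK.
apply: prim_le => // [|s hs]; first exact/cont_zpart/within_continuous_cst.
rewrite /zpart; apply: le_trans (ler_normD _ _) _; rewrite /M mulrDl lerD//.
  by rewrite ler_peMr// W1//; case/andP: hs.
apply: prim_le => // [||r hr]; first by rewrite mulr_ge0.
  exact/cont_qf/within_continuous_cst.
rewrite normrN normrM; apply: (@le_trans _ _ (Q * `|y0|)).
  by rewrite ler_wpM2r// qQ.
by rewrite ler_peMr ?mulr_ge0// W1//; case/andP: hr.
Qed.

Let YS n t : a <= t <= b -> `|Y n.+1 t - Y n t| <= M / 2 ^+ n * W t.
Proof.
elim: n t => [|n IH] t ht; first by rewrite expr0 divr1 Y1.
have := @step_lip (Y n.+1) (Y n) (M / 2 ^+ n) _ (cont_Y (n := n.+1)) (cont_Y (n := n)) IH t ht.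
rewrite exprS invfM mulrCA [X in _ -> _ <= X * _]mulrC; apply.
by rewrite divr_ge0// exprn_ge0.
Qed.

Let Yex : exists y : R -> R, forall t, a <= t <= b -> forall n,
  `|Y n t - y t| <= 2 * M / 2 ^+ n * W t.
Proof.
have h t : exists l, a <= t <= b -> forall n, `|Y n t - l| <= 2 * M / 2 ^+ n * W t.
  have [ht|] := boolP (a <= t <= b); last by exists 0.
  have [|l lP] := @geometric_cauchy _ (fun n => Y n t) (M * W t).
    by move=> n; rewrite mulrAC; exact: YS.
  by exists l => _ n; rewrite mulrAC -mulrA mulrAC; have := lP n; congr (_ <= _); ring.
have [y yP] := choice h; by exists y.
Qed.

Lemma linear_ode : exists y z : R -> R, [/\ y a = y0 /\ z a = z0, cont y, cont z,
  forall t, a < t < b -> is_derive t 1 y (z t) &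
  forall t, a < t < b -> is_derive t 1 z (- (q t * y t))].
Proof.
have [y yP] := Yex.
have WWb t : t <= b -> W t <= W b.
  by move=> tb; rewrite /W ler_expR; apply: ler_wpM2l; [exact: ltW | rewrite lerD2r].
have small e : 0 < e -> exists n, forall t, a <= t <= b -> 2 * M / 2 ^+ n * W t <= e.
  move=> e0; pose n := Num.bound (2 * M * W b / e); exists n => t /andP[at' tb].
  have p2 : 0 < 2 ^+ n :> R by rewrite exprn_gt0.
  rewrite mulrAC ler_pdivrMr//.
  have h1 : 2 * M * W b / e < n%:R.
    by apply: archi_boundP; rewrite divr_ge0 ?mulr_ge0 ?expR_ge0// ltW.
  have h2 : (n%:R : R) < 2 ^+ n by rewrite -natrX ltr_nat ltn_expl.
  have h3 : 2 * M * W t <= 2 * M * W b by rewrite ler_wpM2l ?mulr_ge0 ?WWb.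
  apply: le_trans h3 _; rewrite [e * _]mulrC -ler_pdivrMr// ltW//; exact: lt_trans h2.
have cy : cont y.
  apply/subspace_continuousP => t; rewrite /= in_itv/= => ht; apply/cvgrPdist_lt => e e0.
  have [n nP] := small (e / 4) (divr_gt0 e0 (ltr0n _ 4)).
  have := cont_Y (n := n) => /subspace_continuousP/(_ t); rewrite /= in_itv/= ht => /(_ isT).
  move=> /cvgrPdist_lt/(_ (e / 4) (divr_gt0 e0 (ltr0n _ 4))) Yt; near=> s.
  have hs : a <= s <= b.
    by have : `[a, b]%classic s by [near: s; exact: withinT]; rewrite /= in_itv.
  have h1 := le_trans (yP t ht n) (nP t ht); have h2 := le_trans (yP s hs n) (nP s hs).
  have h3 : `|Y n t - Y n s| < e / 4 by near: s.
  have -> : y t - y s = - (Y n t - y t) + ((Y n t - Y n s) + (Y n s - y s)) by ring.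
  apply: le_lt_trans (ler_normD _ _) _; rewrite normrN.
  have h4 := ler_normD (Y n t - Y n s) (Y n s - y s); lra.
have yE t : a <= t <= b -> step y t = y t.
  move=> ht; apply/eqP; rewrite -subr_eq0 -normr_le0; apply/ler_addgt0Pl => e e0; rewrite addr0.
  have [n nP] := small e e0.
  have h1 := yP t ht n.+1.
  have M2 : 0 <= 2 * M / 2 ^+ n by rewrite divr_ge0 ?mulr_ge0// exprn_ge0.
  have yP' s : a <= s <= b -> `|y s - Y n s| <= 2 * M / 2 ^+ n * W s.
    by move=> hs; rewrite distrC; exact: yP.
  have h2 := step_lip M2 cy (cont_Y (n := n)) yP' ht.
  apply: le_trans (nP t ht).
  have -> : step y t - y t = (step y t - Y n.+1 t) + (Y n.+1 t - y t) by ring.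
  apply: le_trans (ler_normD _ _) _.
  have -> : 2 * M / 2 ^+ n * W t = 2 * M / 2 ^+ n / 2 * W t + 2 * M / 2 ^+ n.+1 * W t.
    by rewrite exprS invfM; field.
  exact: lerD.
(* The pointwise limit [y] is arbitrary outside [a, b]; [step y] equals it on [a, b] and is a
   primitive by construction. *)
exists (step y), (zpart y).
have [p0 cp dp] := primP (cont_zpart cy).
have [p0' cp' dp'] := primP (cont_qf cy).
split.
- by rewrite /step /zpart p0 p0' !addr0.
- exact: cont_step.
- exact: cont_zpart.
- move=> t ht; have h := dp t ht.
  by rewrite -[zpart y t]add0r; exact: is_deriveD.
- move=> t ht; have h := dp' t ht.
  have hE : step y t = y t by apply: yE; case/andP: ht => h1 h2; rewrite !ltW.
  by rewrite hE -[- _]add0r; exact: is_deriveD.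
Unshelve. all: by end_near. Qed.

End PicardIteration.

(** * Wronskian and energy estimates *)

Section Oscillator.
Context {R : realType}.
Implicit Types (a b s t K M : R) (f g y z q F c : R -> R).
Local Notation cont a b f := {within `[a, b], continuous f}.

Definition ode_solution a b q y z :=
  [/\ cont a b y, cont a b z,
  forall t, a < t < b -> is_derive t 1 y (z t) &
  forall t, a < t < b -> is_derive t 1 z (- (q t * y t))].

Lemma derive_eq0_const a b f : a <= b -> cont a b f ->
  (forall t, a < t < b -> is_derive t 1 f 0) -> f b = f a.
Proof.
move=> ab cf df; apply/eqP; rewrite eq_le; apply/andP; split; last first.
  exact: (@nondecreasing_of_derive _ a b f (fun=> 0)).
rewrite -lerN2; apply: (@nondecreasing_of_derive _ a b (fun t => - f t) (fun=> 0)) => //.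
  exact: within_continuousN.
by move=> t ht; have h := df t ht; rewrite -oppr0; exact: is_deriveN.
Qed.

(** The Wronskian of the fundamental system at [a] is constantly 1, so its combinations realise any
    data at t0. Resonant modes need data at [start k], inside the interval. *)
Lemma linear_ode_at a b Q q t0 u v : a < b -> cont a b q ->
  (forall t, a <= t <= b -> `|q t| <= Q) -> a <= t0 <= b ->
  exists y z, [/\ ode_solution a b q y z, y t0 = u & z t0 = v].
Proof.
move=> ab cq qQ /andP[at0 t0b].
have [y1 [z1 [[y1a z1a] cy1 cz1 dy1 dz1]]] := linear_ode 1 0 ab cq qQ.
have [y2 [z2 [[y2a z2a] cy2 cz2 dy2 dz2]]] := linear_ode 0 1 ab cq qQ.
have w1 : y1 t0 * z2 t0 - z1 t0 * y2 t0 = 1.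
  pose w t := y1 t * z2 t + - (z1 t * y2 t).
  have -> : 1 = w a by rewrite /w y1a z1a y2a z2a; ring.
  apply: (@derive_eq0_const a t0 w) => //.
    apply: within_continuousS (lexx a) t0b _.
    by apply: within_continuousD; [|apply: within_continuousN]; exact: within_continuousM.
  move=> t /andP[h1 h2]; have ht : a < t < b by rewrite h1 (lt_le_trans h2).
  have d1 := dy1 t ht; have d2 := dz1 t ht; have d3 := dy2 t ht; have d4 := dz2 t ht.
  by apply: is_derive_eq; rewrite /GRing.scale/=; ring.
pose A := u * z2 t0 - v * y2 t0; pose B := v * y1 t0 - u * z1 t0.
exists (fun t => A * y1 t + B * y2 t), (fun t => A * z1 t + B * z2 t); split.
- split.
  + by apply: within_continuousD; apply: within_continuousM => //; exact: within_continuous_cst.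
  + by apply: within_continuousD; apply: within_continuousM => //; exact: within_continuous_cst.
  + move=> t ht; have d1 := dy1 t ht; have d3 := dy2 t ht.
    by apply: is_derive_eq; rewrite /GRing.scale/=; ring.
  + move=> t ht; have d1 := dz1 t ht; have d3 := dz2 t ht.
    by apply: is_derive_eq; rewrite /GRing.scale/=; ring.
- by rewrite /A /B -[RHS]mulr1 -w1; ring.
- by rewrite /A /B -[RHS]mulr1 -w1; ring.
Qed.

Lemma ode_solutionS a b a' b' q q' y z : a <= a' -> b' <= b ->
  (forall t, a' < t < b' -> q' t = q t) -> ode_solution a b q y z -> ode_solution a' b' q' y z.
Proof.
move=> aa bb qq [cy cz dy dz].
have sub t : a' < t < b' -> a < t < b.
  by move=> /andP[h1 h2]; rewrite (le_lt_trans aa)//= (lt_le_trans h2).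
split; [exact: within_continuousS cy|exact: within_continuousS cz| |].
- by move=> t /sub; exact: dy.
- by move=> t ht; rewrite qq//; exact/dz/sub.
Qed.

Lemma energy_flux (g x w : R) : 0 <= g -> `|2 * g ^+ 2 * x * w| <= g * (g ^+ 2 * x ^+ 2 + w ^+ 2).
Proof.
move=> g0; rewrite ler_norml; apply/andP; split.
  have := mulr_ge0 g0 (sqr_ge0 (g * x + w)); lra.
have := mulr_ge0 g0 (sqr_ge0 (g * x - w)); lra.
Qed.

Definition energy (g : R) y z t := g ^+ 2 * y t ^+ 2 + z t ^+ 2.

Lemma energy_ge0 (g : R) y z t : 0 <= energy g y z t.
Proof. by apply: addr_ge0; [apply: mulr_ge0|]; exact: sqr_ge0. Qed.

(** The energy has derivative 2 g^2 y z (1 - c), at most g |1 - c| times the energy. The rate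
    contains g, so the estimate is uniform in g only if |1 - c| is of order 1 / g. *)
Lemma energy_gronwall (g d : R) c y z s t : 0 <= g -> 0 <= d -> s <= t ->
  ode_solution s t (fun r => c r * g ^+ 2) y z ->
  (forall r, s < r < t -> `|1 - c r| <= d) ->
  energy g y z t <= energy g y z s * expR (g * d * (t - s)) /\
  energy g y z s <= energy g y z t * expR (g * d * (t - s)).
Proof.
move=> g0 d0 st [cy cz dy dz] cd.
have cE : cont s t (energy g y z).
  rewrite /energy; apply: within_continuousD; [apply: within_continuousM|].
  - exact: within_continuous_cst.
  - exact: within_continuousM.
  - exact: within_continuousM.
have dE r : s < r < t -> is_derive r 1 (energy g y z) (2 * g ^+ 2 * y r * z r * (1 - c r)).
  move=> hr; have h1 := dy r hr; have h2 := dz r hr.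
  by rewrite /energy; apply: is_derive_eq; rewrite /GRing.scale/=; ring.
have bE r : s < r < t -> `|2 * g ^+ 2 * y r * z r * (1 - c r)| <= g * d * energy g y z r.
  move=> hr; rewrite normrM [leRHS]mulrAC; apply: ler_pM => //; last exact: cd.
  exact: energy_flux.
split.
- by apply: gronwall_le dE _ => // r /bE; rewrite ler_norml => /andP[].
- by apply: gronwall_ge dE _ => // r /bE; rewrite ler_norml mulNr => /andP[].
Qed.

Lemma ode_solution_unique (g : R) c y z y' z' s t : 0 < g -> s <= t ->
  (forall r, s < r < t -> `|1 - c r| <= 1) ->
  ode_solution s t (fun r => c r * g ^+ 2) y z ->
  ode_solution s t (fun r => c r * g ^+ 2) y' z' ->
  y s = y' s -> z s = z' s -> y t = y' t /\ z t = z' t.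
Proof.
move=> g0 st c1 [cy cz dy dz] [cy' cz' dy' dz'] ys zs.
pose Y r := y r - y' r; pose Z r := z r - z' r.
have sol : ode_solution s t (fun r => c r * g ^+ 2) Y Z.
  split.
  - by apply: within_continuousD => //; exact: within_continuousN.
  - by apply: within_continuousD => //; exact: within_continuousN.
  - by move=> r hr; have h1 := dy r hr; have h2 := dy' r hr; exact: is_deriveB.
  - move=> r hr; have h1 := dz r hr; have h2 := dz' r hr.
    by apply: is_derive_eq; rewrite /Y; ring.
have [+ _] := energy_gronwall (ltW g0) ler01 st sol c1.
rewrite {2}/energy /Y /Z ys zs !subrr expr0n/= mulr0 addr0 mul0r => h.
have := sqr_ge0 (Z t); have := mulr_ge0 (sqr_ge0 g) (sqr_ge0 (Y t)).
move: h; rewrite /energy => h h1 h2.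
have /eqP : Z t ^+ 2 = 0 by rewrite /Z /Y in h1 h2 *; lra.
have /eqP : g ^+ 2 * Y t ^+ 2 = 0 by rewrite /Z /Y in h1 h2 *; lra.
rewrite mulf_eq0 !sqrf_eq0 (gt_eqF g0)/= /Y /Z !subr_eq0.
by move=> /eqP -> /eqP ->.
Qed.

(** With the coefficient inside the energy the terms in y z cancel, and only p' g^2 y^2 is left, at
    most 2 k F since p >= 1 / 2. The rate is the same for all frequencies g. *)
Lemma hyperbolic_gronwall (g k : R) (p dp : R -> R) y z s t : 0 <= g -> 0 <= k -> s <= t ->
  ode_solution s t (fun r => p r * g ^+ 2) y z ->
  (forall r : R, is_derive r 1 p (dp r)) -> (forall r, `|dp r| <= k) -> (forall r, 1 / 2 <= p r) ->
  let F r := p r * g ^+ 2 * y r ^+ 2 + z r ^+ 2 in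
  F t <= F s * expR (2 * k * (t - s)) /\ F s <= F t * expR (2 * k * (t - s)).
Proof.
move=> g0 k0 st [cy cz dy dz] dpE dpk p2 F.
have cp : cont s t p by exact: derive_within_continuous dpE.
have cF : cont s t F.
  rewrite /F; apply: within_continuousD; last exact: within_continuousM.
  apply: within_continuousM; last exact: within_continuousM.
  by apply: within_continuousM => //; exact: within_continuous_cst.
have dF r : s < r < t -> is_derive r 1 F (dp r * (g ^+ 2 * y r ^+ 2)).
  move=> hr; have h1 := dy r hr; have h2 := dz r hr; have h3 := dpE r.
  by rewrite /F; apply: is_derive_eq; rewrite /GRing.scale/=; ring.
have bF r : s < r < t -> `|dp r * (g ^+ 2 * y r ^+ 2)| <= 2 * k * F r.
  move=> hr; have x0 : 0 <= g ^+ 2 * y r ^+ 2 by rewrite mulr_ge0 ?sqr_ge0.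
  rewrite normrM [`|_ ^+ 2 * _|]ger0_norm//.
  apply: le_trans (ler_wpM2r x0 (dpk r)) _.
  rewrite -mulrA [2 * _]mulrC -[k * _ * _]mulrA; apply: ler_wpM2l => //.
  rewrite /F; have := ler_wpM2r x0 (p2 r); have := sqr_ge0 (z r); lra.
split.
- by apply: gronwall_le dF _ => // r /bF; rewrite ler_norml => /andP[].
- by apply: gronwall_ge dF _ => // r /bF; rewrite ler_norml mulNr => /andP[].
Qed.

End Oscillator.

(** * The resonant coefficient *)

Section Resonance.
Context {R : realType}.
Implicit Types (eps x s t g : R).

(** The Colombini-De Giorgi-Spagnolo coefficient: it is read off from the function w =
    [res_sol eps], prescribed in advance, as -w'' / w. *)
Definition res_coef eps x : R := 1 - 8 * eps * (sin x * cos x) - 4 * eps ^+ 2 * sin x ^+ 4.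
Definition res_dcoef eps x : R :=
  - 8 * eps * (cos x ^+ 2 - sin x ^+ 2) - 16 * eps ^+ 2 * (sin x ^+ 3 * cos x).
(** The exponent is 2 eps times the integral of sin^2 from 0 to x. It increases by eps pi on each
    half period, which multiplies the energy at multiples of pi by exp(2 eps pi). *)
Definition res_growth eps x : R := expR (eps * (x - sin x * cos x)).
Definition res_sol eps x : R := sin x * res_growth eps x.
Definition res_dsol eps x : R := (cos x + 2 * eps * sin x ^+ 3) * res_growth eps x.

Lemma is_derive_res_coef eps x : is_derive x 1 (res_coef eps) (res_dcoef eps x).
Proof.
rewrite /res_coef; apply: is_derive_eq; rewrite /res_dcoef /GRing.scale/=; ring.
Qed.

Lemma is_derive_res_growth eps x :
  is_derive x 1 (res_growth eps) (2 * eps * sin x ^+ 2 * res_growth eps x).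
Proof.
have h : is_derive x 1 (fun x => eps * (x - sin x * cos x)) (2 * eps * sin x ^+ 2).
  apply: is_derive_eq; rewrite /GRing.scale/=; have := cos2Dsin2 x => e.
  have -> : sin x ^+ 2 = 1 - cos x ^+ 2 by rewrite -e; ring.
  have -> : 1 - (sin x * - sin x + cos x * cos x) = 1 + sin x ^+ 2 - cos x ^+ 2 by ring.
  have -> : sin x ^+ 2 = 1 - cos x ^+ 2 by rewrite -e; ring.
  ring.
have := @is_derive1_comp R expR _ x _ _ (is_derive_expR _) h.
by rewrite mulrC.
Qed.

Lemma is_derive_res_sol eps x : is_derive x 1 (res_sol eps) (res_dsol eps x).
Proof.
have h := is_derive_res_growth eps x.
rewrite /res_sol; apply: is_derive_eq; rewrite /GRing.scale/= /res_dsol; ring.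
Qed.

Lemma is_derive_res_dsol eps x :
  is_derive x 1 (res_dsol eps) (- (res_coef eps x * res_sol eps x)).
Proof.
have h := is_derive_res_growth eps x.
rewrite /res_dsol; apply: is_derive_eq; rewrite /GRing.scale/= /res_sol /res_coef.
have := cos2Dsin2 x => e.
set G := res_growth eps x; set S := sin x in e *; set C := cos x in e *.
ring.
Qed.

Lemma res_coef_bound eps x : 0 <= eps -> eps <= 1 -> `|1 - res_coef eps x| <= 8 * eps.
Proof.
move=> e0 e1; have := cos2Dsin2 x; rewrite /res_coef.
set S := sin x; set C := cos x => e.
have S2 : 0 <= S ^+ 2 <= 1 by rewrite sqr_ge0 -e lerDr sqr_ge0.
have S4 : 0 <= S ^+ 4 <= 1.
  case/andP: S2 => a b; have -> : S ^+ 4 = S ^+ 2 * S ^+ 2 by ring.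
  by rewrite mulr_ge0//= mulr_ile1.
have sc : `|S * C| <= 1 / 2.
  rewrite ler_norml; have := sqr_ge0 (S + C); have := sqr_ge0 (S - C).
  rewrite sqrrB sqrrD -(mulr_natr (S * C) 2) => h1 h2; apply/andP; split; lra.
have -> : 1 - (1 - 8 * eps * (S * C) - 4 * eps ^+ 2 * S ^+ 4) =
   eps * (8 * (S * C) + 4 * eps * S ^+ 4) by ring.
rewrite normrM (ger0_norm e0) mulrC ler_wpM2r//.
have h : 0 <= eps * S ^+ 4 <= 1.
  by case/andP: S4 => a b; rewrite mulr_ge0//= mulr_ile1.
move: sc; rewrite !ler_norml => /andP[h1 h2]; case/andP: h => h3 h4.
apply/andP; split; lra.
Qed.

Lemma res_dcoef_bound eps x : 0 <= eps -> eps <= 1 -> `|res_dcoef eps x| <= 24 * eps.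
Proof.
move=> e0 e1; have := cos2Dsin2 x; rewrite /res_dcoef.
set S := sin x; set C := cos x => e.
have S2 : 0 <= S ^+ 2 <= 1 by rewrite sqr_ge0 -e lerDr sqr_ge0.
have C2 : 0 <= C ^+ 2 <= 1 by rewrite sqr_ge0 -e lerDl sqr_ge0.
have sc : `|S ^+ 3 * C| <= 1.
  have -> : S ^+ 3 * C = S ^+ 2 * (S * C) by ring.
  rewrite normrM ger0_norm ?sqr_ge0// mulr_ile1 ?sqr_ge0//; first by case/andP: S2.
  rewrite ler_norml; have := sqr_ge0 (S + C); have := sqr_ge0 (S - C).
  rewrite sqrrB sqrrD -(mulr_natr (S * C) 2) => h1 h2; apply/andP; split; lra.
have -> : - 8 * eps * (C ^+ 2 - S ^+ 2) - 16 * eps ^+ 2 * (S ^+ 3 * C) =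
   eps * (8 * (S ^+ 2 - C ^+ 2) - 16 * (eps * (S ^+ 3 * C))) by ring.
rewrite normrM (ger0_norm e0) mulrC ler_wpM2r//.
have h : `|eps * (S ^+ 3 * C)| <= 1 by rewrite normrM mulr_ile1// ger0_norm.
move: h; rewrite !ler_norml => /andP[h1 h2].
case/andP: S2 => ? ?; case/andP: C2 => ? ?.
apply/andP; split; lra.
Qed.

Lemma res_coef_lip eps x x' : 0 <= eps -> eps <= 1 ->
  `|res_coef eps x - res_coef eps x'| <= 24 * eps * `|x - x'|.
Proof.
move=> e0 e1; wlog xx : x x' / x' <= x => [h|].
  by have [/h//|/ltW/h] := leP x' x; rewrite distrC [`|x' - x|]distrC.
have [|c _ ->] := @MVT_segment R (res_coef eps) (res_dcoef eps) x' x xx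
    (fun t _ => is_derive_res_coef eps t).
  by apply: derive_within_continuous => t; exact: is_derive_res_coef.
by rewrite normrM ler_wpM2r// res_dcoef_bound.
Qed.

Lemma sin_pin n : sin (n%:R * pi) = 0 :> R.
Proof. by elim: n => [|n IH]; rewrite ?mul0r ?sin0// mulrSr mulrDl mul1r sinDpi IH oppr0. Qed.

Lemma res_coef_pin eps n : res_coef eps (n%:R * pi) = 1.
Proof. by rewrite /res_coef sin_pin; ring. Qed.

Lemma is_derive_affine (f : R -> R) (g s t d : R) :
  is_derive (g * (t - s)) 1 f d -> is_derive t 1 (fun t => f (g * (t - s))) (g * d).
Proof.
move=> df; have h : is_derive t 1 (fun t : R => g * (t - s)) g.
  by apply: is_derive_eq; rewrite /GRing.scale/=; ring.
by have := @is_derive1_comp R f _ t _ _ df h; rewrite mulrC.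
Qed.

Lemma res_solution (g s a b eps B : R) : 0 < g ->
  ode_solution a b (fun t => res_coef eps (g * (t - s)) * g ^+ 2)
    (fun t => B / g * res_sol eps (g * (t - s))) (fun t => B * res_dsol eps (g * (t - s))).
Proof.
move=> g0; have gn0 : g != 0 by exact: lt0r_neq0.
have d1 t : is_derive t 1 (fun t => B / g * res_sol eps (g * (t - s)))
    (B * res_dsol eps (g * (t - s))).
  have h := is_derive_affine (is_derive_res_sol eps (g * (t - s))).
  by apply: is_derive_eq; rewrite /GRing.scale/=; field.
have d2 t : is_derive t 1 (fun t => B * res_dsol eps (g * (t - s)))
    (- (res_coef eps (g * (t - s)) * g ^+ 2 * (B / g * res_sol eps (g * (t - s))))).
  have h := is_derive_affine (is_derive_res_dsol eps (g * (t - s))).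
  by apply: is_derive_eq; rewrite /GRing.scale/=; field.
split; [exact: derive_within_continuous d1|exact: derive_within_continuous d2| |].
- by move=> t _; exact: d1.
- by move=> t _; exact: d2.
Qed.

Lemma res_growth_nondecreasing eps x x' : 0 <= eps -> x <= x' ->
  res_growth eps x <= res_growth eps x'.
Proof.
move=> e0 xx; apply: (@nondecreasing_of_derive R x x' (res_growth eps)
  (fun x => 2 * eps * sin x ^+ 2 * res_growth eps x)) => //.
- by apply: derive_within_continuous => t; exact: is_derive_res_growth.
- by move=> t _; exact: is_derive_res_growth.
- move=> t _; apply: mulr_ge0; last exact: expR_ge0.
  by apply: mulr_ge0; [lra | exact: sqr_ge0].
Qed.

Lemma res_energy_le eps x : 0 <= eps -> eps <= 1 / 2 ->
  res_sol eps x ^+ 2 + res_dsol eps x ^+ 2 <= 6 * res_growth eps x ^+ 2.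
Proof.
move=> e0 e1; rewrite /res_sol /res_dsol !exprMn -mulrDl; apply: ler_wpM2r; first exact: sqr_ge0.
have := cos2Dsin2 x; set S := sin x; set C := cos x => e.
have S2 : 0 <= S ^+ 2 <= 1 by rewrite sqr_ge0 -e lerDr sqr_ge0.
have S6 : 0 <= (S ^+ 3) ^+ 2 <= 1.
  case/andP: S2 => a b; rewrite sqr_ge0/=.
  have -> : (S ^+ 3) ^+ 2 = (S ^+ 2) ^+ 3 by ring.
  exact: exprn_ile1.
have eS : 0 <= (2 * eps * S ^+ 3) ^+ 2 <= 1.
  rewrite sqr_ge0/= exprMn mulr_ile1 ?sqr_ge0//; last by case/andP: S6.
  by rewrite exprn_ile1 ?mulr_ge0//; lra.
(* For q = 2 eps S^3, (C + q)^2 <= 2 C^2 + 2 q^2 <= 4, and S^2 adds at most 1. *)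
have := sqr_ge0 (C - 2 * eps * S ^+ 3); rewrite sqrrB sqrrD -!(mulr_natr (C * _) 2).
case/andP: eS => h1 h2; case/andP: S2 => h3 h4; lra.
Qed.

End Resonance.

(** * Gluing the oscillations into one coefficient *)

Section Coefficient.
Context {R : realType}.
Variables (omega : R -> R) (G : nat -> R) (N : nat -> nat).
Hypothesis omega_ge0 : forall a, 0 <= a -> 0 <= omega a.
Hypothesis omega_incr : forall a b, 0 <= a -> a < b -> omega a < omega b.
Hypothesis omega0 : omega 0 = 0.
Hypothesis omega_quot : forall a b, 0 < a -> a <= b -> a / omega a <= b / omega b.
Hypothesis omega_small : forall e, 0 < e -> exists2 d, 0 < d & forall x, 0 <= x < d -> omega x < e.
Implicit Types (s t : R) (k j : nat).

(** [G 0] is reserved for the low frequency mode, so the resonant frequencies begin with [G 1], and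
    [G k] is the one preceding [freq k]. *)
Definition freq k := G k.+1.
Definition ampl k := omega (1 / freq k).
Definition start k : R := 2^-1 ^+ k.+1.
(** The length is a whole number of half periods, so the oscillation takes the value 1 at both ends.
    By [N_le] the interval I_k lies in [2^-(k+1), 2^-k]. *)
Definition stop k : R := start k + (N k)%:R * pi / freq k.

Hypothesis G_gt0 : forall k, 0 < G k.
Hypothesis G_incr : forall k, G k < G k.+1.
Hypothesis ampl_small : forall k, 16 * ampl k <= 1.
Hypothesis ampl_prev : forall k, 8 * ampl k * G k <= 1.
Hypothesis N_le : forall k, (N k)%:R * pi / freq k <= start k.

Lemma freq_gt0 k : 0 < freq k. Proof. exact: G_gt0. Qed.
Local Hint Resolve freq_gt0 : core.

Lemma start_gt0 k : 0 < start k.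
Proof. by rewrite exprn_gt0// invr_gt0. Qed.

Lemma startS k : start k = 2 * start k.+1.
Proof. by rewrite /start [in RHS]exprS mulrA mulfV ?mul1r. Qed.

Lemma start_stop k : start k <= stop k.
Proof. by rewrite lerDl divr_ge0 ?(ltW (freq_gt0 k))// mulr_ge0// pi_ge0. Qed.

Lemma stop_le k : stop k <= 2 * start k.
Proof. by rewrite mulr_natl mulr2n lerD2l. Qed.

Lemma stop_le_start j k : (j < k)%N -> stop k <= start j.
Proof.
elim: k => // k IH; rewrite ltnS leq_eqVlt => /predU1P[->|/IH jk].
  by rewrite startS stop_le.
by apply: le_trans jk; apply: le_trans (start_stop k); rewrite startS stop_le.
Qed.

Lemma omega_le s t : 0 <= s -> s <= t -> omega s <= omega t.
Proof. by move=> s0; rewrite le_eqVlt => /predU1P[->//|/omega_incr-/(_ s0)/ltW]. Qed.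

Lemma ampl_ge0 k : 0 <= ampl k.
Proof. by rewrite omega_ge0// divr_ge0// ltW. Qed.

Lemma ampl_le1 k : ampl k <= 1.
Proof. by have := ampl_small k; have := ampl_ge0 k; lra. Qed.

Lemma freq_le j k : (j <= k)%N -> freq j <= freq k.
Proof.
move=> jk; rewrite -(subnK jk); elim: (k - j)%N => [|n IH]; first by rewrite add0n.
by rewrite addSn; apply: le_trans IH _; exact: ltW (G_incr _).
Qed.

Lemma ampl_le j k : (j <= k)%N -> ampl k <= ampl j.
Proof.
move=> /freq_le jk; apply: omega_le; first by rewrite divr_ge0// ltW.
by rewrite !div1r lef_pV2 ?posrE ?freq_gt0.
Qed.

Definition bump k t := res_coef (ampl k) (freq k * (t - start k)) - 1.
Definition active k t := start k <= t <= stop k.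
(** Consecutive intervals may share an endpoint; the bumps vanish there, so the choice of k does not
    affect the value. The default 0 gives the value 1 off the intervals. *)
Definition coef t := 1 + xget 0 [set v | exists k, active k t /\ v = bump k t].

Lemma bump_start k : bump k (start k) = 0.
Proof. by rewrite /bump subrr mulr0 -[X in res_coef _ X](mul0r pi) (res_coef_pin _ 0) subrr. Qed.

Lemma bump_stop k : bump k (stop k) = 0.
Proof.
rewrite /bump /stop [start k + _]addrC addrK [freq k * _]mulrC divfK; last exact: lt0r_neq0.
by rewrite res_coef_pin subrr.
Qed.

Lemma bump_unique j k t : active j t -> active k t -> bump j t = bump k t.
Proof.
wlog jk : j k / (j < k)%N => [h aj ak|].
  by have [/h->|/h->|->] := ltngtP j k.
move=> /andP[jt _] /andP[_ tk]; have h := stop_le_start jk.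
have -> : t = start j by apply/eqP; rewrite eq_le jt (le_trans tk).
rewrite bump_start; have -> : start j = stop k.
  by apply/eqP; rewrite eq_le h (le_trans jt).
by rewrite bump_stop.
Qed.

Lemma coef_active k t : active k t -> coef t = res_coef (ampl k) (freq k * (t - start k)).
Proof.
move=> ak; rewrite /coef; case: xgetP => [v _ [j [aj ->]]|/(_ (bump k t))]; last first.
  by case; exists k.
by rewrite (bump_unique aj ak) /bump addrC subrK.
Qed.

Lemma coef_inactive t : (forall k, ~~ active k t) -> coef t = 1.
Proof.
move=> na; rewrite /coef; case: xgetP => [v _ [j [aj _]]|_]; last by rewrite addr0.
by have := na j; rewrite aj.
Qed.

Lemma coef_bump k t : active k t -> coef t = 1 + bump k t.
Proof. by move=> /coef_active ->; rewrite /bump [RHS]addrC subrK. Qed.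

Lemma coef_start k : coef (start k) = 1.
Proof. by rewrite (coef_bump (k := k)) ?bump_start ?addr0// /active lexx start_stop. Qed.

Lemma coef_stop k : coef (stop k) = 1.
Proof. by rewrite (coef_bump (k := k)) ?bump_stop ?addr0// /active lexx start_stop. Qed.

Lemma activeP t : (exists k, active k t) \/ (forall k, ~~ active k t).
Proof.
by have [h|h] := pselect (exists k, active k t); [left|right => k; apply/negP => ak; apply: h; exists k].
Qed.

Lemma coef_near1 t : `|1 - coef t| <= 1 / 2.
Proof.
have [[k ak]|/coef_inactive ->] := activeP t; last by rewrite subrr normr0.
rewrite (coef_active ak); apply: le_trans (res_coef_bound _ (ampl_ge0 k) (ampl_le1 k)) _.
by have := ampl_small k; lra.
Qed.

(** To the left of [start k] only intervals of larger index are met, and the amplitudes decrease. By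
    [ampl_prev] the bound times [freq k] is at most 1, so that mode k hardly moves there. *)
Lemma coef_before k t : t <= start k -> `|1 - coef t| <= 8 * ampl k.+1.
Proof.
move=> tk; have a0 := ampl_ge0 k.+1.
have [[j aj]|/coef_inactive ->] := activeP t; last by rewrite subrr normr0; lra.
have [kj|jk] := ltnP k j.
  rewrite (coef_active aj); apply: le_trans (res_coef_bound _ (ampl_ge0 j) (ampl_le1 j)) _.
  by rewrite ler_wpM2l// ampl_le.
suff -> : coef t = 1 by rewrite subrr normr0; lra.
suff -> : t = start k by exact: coef_start.
apply/eqP; rewrite eq_le tk; case/andP: aj => jt _; apply: le_trans jt.
move: jk; rewrite leq_eqVlt => /predU1P[->//|/stop_le_start]; apply: le_trans.
exact: start_stop.
Qed.

Lemma coef_gap j t : stop j.+1 <= t <= start j -> coef t = 1.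
Proof.
move=> /andP[h1 h2]; have [[i ai]|/coef_inactive//] := activeP t.
case/andP: (ai) => h3 h4; have [ij|ji] := leqP i j.
  have ss : start j <= start i.
    move: ij; rewrite leq_eqVlt => /predU1P[->//|/stop_le_start]; apply: le_trans.
    exact: start_stop.
  by have -> : t = start i; [apply/eqP; rewrite eq_le h3 (le_trans h2)|exact: coef_start].
have tt : stop i <= stop j.+1.
  move: ji; rewrite leq_eqVlt => /predU1P[->//|/stop_le_start]; move/le_trans; apply.
  exact: start_stop.
by have -> : t = stop i; [apply/eqP; rewrite eq_le h4 (le_trans tt)|exact: coef_stop].
Qed.

Lemma coef_after t : stop 0 <= t -> coef t = 1.
Proof.
move=> h1; have [[i ai]|/coef_inactive//] := activeP t.
case/andP: (ai) => h3 h4; have tt : stop i <= stop 0.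
  case: i {ai h3 h4} => // i; apply: le_trans (stop_le_start (ltn0Sn i)) _.
  exact: start_stop.
by have -> : t = stop i; [apply/eqP; rewrite eq_le h4 (le_trans tt)|exact: coef_stop].
Qed.

(** Let d = |s - t|. If d < 1 / freq k, the Lipschitz bound 24 ampl freq d is at most 24 omega(d) by
    monotonicity of the quotient. Otherwise ampl k <= omega(d), and the oscillation is at most 16
    ampl k. *)
Lemma bump_omega k s t : `|bump k s - bump k t| <= 24 * omega `|s - t|.
Proof.
set d := `|s - t|; have -> : bump k s - bump k t =
  res_coef (ampl k) (freq k * (s - start k)) - res_coef (ampl k) (freq k * (t - start k)).
  by rewrite /bump; ring.
have [->|st] := eqVneq s t; first by rewrite subrr normr0 mulr_ge0// omega_ge0// /d.
have d0 : 0 < d by rewrite normr_gt0 subr_eq0.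
have gp : 0 < 1 / freq k by rewrite divr_gt0.
have a0 := ampl_ge0 k; have a1 := ampl_le1 k.
have [dg|gd] := ltP d (1 / freq k).
  apply: le_trans (res_coef_lip _ _ a0 a1) _; rewrite -mulrA ler_wpM2l//.
  have -> : freq k * (s - start k) - freq k * (t - start k) = freq k * (s - t) by ring.
  rewrite normrM (gtr0_norm (freq_gt0 k)) -/d.
  have o1 : 0 < omega d by rewrite -omega0 omega_incr.
  have o2 : 0 < ampl k by rewrite -omega0 /ampl omega_incr.
  have := omega_quot d0 (ltW dg); rewrite -/(ampl k) ler_pdivrMr// mulrAC ler_pdivlMr// => h.
  have -> : ampl k * (freq k * d) = freq k * (d * ampl k) by ring.
  apply: le_trans (ler_wpM2l (ltW (freq_gt0 k)) h) _.
  by rewrite mulrA div1r mulfV ?mul1r//; exact: lt0r_neq0.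
have -> : forall x y : R, x - y = (1 - y) - (1 - x) by move=> x y; ring.
apply: le_trans (ler_normB _ _) _.
have h1 := res_coef_bound (freq k * (s - start k)) a0 a1.
have h2 := res_coef_bound (freq k * (t - start k)) a0 a1.
have : ampl k <= omega d by exact: omega_le (ltW gp) gd.
lra.
Qed.

(** If no interval contains both points, each is compared with an endpoint between them, where the
    coefficient is 1; this doubles the constant 24. *)
Lemma coef_omega s t : `|coef s - coef t| <= 48 * omega `|s - t|.
Proof.
wlog st : s t / s <= t => [h|].
  by have [/h//|/ltW/h] := leP s t; rewrite distrC [`|t - s|]distrC.
have st0 : 0 <= t - s by rewrite subr_ge0.
have o0 : 0 <= omega (t - s) by exact: omega_ge0.
have [[k /andP[ks kt]]|nk] := pselect (exists k, active k s && active k t).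
  rewrite (coef_bump ks) (coef_bump kt) opprD addrACA subrr add0r.
  apply: le_trans (bump_omega _ _ _) _; rewrite [`|s - t|]distrC ger0_norm//; lra.
have hs : `|coef s - 1| <= 24 * omega (t - s).
  have [[j aj]|/coef_inactive ->] := activeP s; last by rewrite subrr normr0 mulr_ge0.
  have jt : stop j < t.
    rewrite ltNge; apply/negP => tj; apply: nk; exists j; rewrite aj/= /active tj andbT.
    by case/andP: aj => h _; exact: le_trans st.
  rewrite (coef_bump aj) [1 + _]addrC addrK -[bump j s]subr0 -(bump_stop j).
  apply: le_trans (bump_omega _ _ _) _; rewrite ler_wpM2l// omega_le//.
  by case/andP: aj => _ h; rewrite distrC ger0_norm ?subr_ge0// lerD2r ltW.
have ht : `|coef t - 1| <= 24 * omega (t - s).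
  have [[j aj]|/coef_inactive ->] := activeP t; last by rewrite subrr normr0 mulr_ge0.
  have js : s < start j.
    rewrite ltNge; apply/negP => js; apply: nk; exists j; rewrite aj andbT /active js/=.
    by case/andP: aj => _ h; exact: le_trans h.
  rewrite (coef_bump aj) [1 + _]addrC addrK -[bump j t]subr0 -(bump_start j).
  apply: le_trans (bump_omega _ _ _) _; rewrite ler_wpM2l// omega_le//.
  by case/andP: aj => h _; rewrite ger0_norm ?subr_ge0// lerD2l lerN2 ltW.
rewrite [`|s - t|]distrC (ger0_norm st0).
have -> : coef s - coef t = (coef s - 1) - (coef t - 1) by ring.
by apply: le_trans (ler_normB _ _) _; lra.
Qed.

Lemma coef_continuous a b : {within `[a, b], continuous coef}.
Proof.
apply: continuous_subspaceT => t; apply/cvgrPdist_lt => e e0.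
have e48 : 0 < e / 48 by rewrite divr_gt0.
have [d d0 dP] := omega_small e48; near=> s.
apply: le_lt_trans (coef_omega _ _) _; rewrite mulrC -ltr_pdivlMr//.
apply: dP; rewrite normr_ge0/=.
by near: s; exists d => //= s; rewrite /ball_/=.
Unshelve. all: by end_near. Qed.

End Coefficient.

(** * Resonant modes before, during and after their interval *)

Section Modes.
Context {R : realType}.
Variables (omega : R -> R) (G : nat -> R) (N : nat -> nat).
Hypothesis omega_ge0 : forall a, 0 <= a -> 0 <= omega a.
Hypothesis omega_incr : forall a b, 0 <= a -> a < b -> omega a < omega b.
Hypothesis omega0 : omega 0 = 0.
Hypothesis omega_quot : forall a b, 0 < a -> a <= b -> a / omega a <= b / omega b.
Hypothesis omega_small : forall e, 0 < e -> exists2 d, 0 < d & forall x, 0 <= x < d -> omega x < e.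
Implicit Types (s t : R) (k j : nat).

Local Notation freq := (freq G).
Local Notation ampl := (ampl omega G).
Local Notation start := (@start R).
Local Notation stop := (stop G N).
Local Notation coef := (coef omega G N).
Local Notation active := (active G N).
Hypothesis G_gt0 : forall k, 0 < G k.
Hypothesis G_incr : forall k, G k < G k.+1.
Hypothesis ampl_small : forall k, 16 * ampl k <= 1.
Hypothesis ampl_prev : forall k, 8 * ampl k * G k <= 1.
Hypothesis N_le : forall k, (N k)%:R * pi / freq k <= start k.

Lemma start_le_half k : start k <= 1 / 2.
Proof.
rewrite /start exprS -[leRHS]mulr1 div1r ler_wpM2l ?invr_ge0//.
by rewrite exprn_ile1 ?invr_ge0// invf_le1// ler1n.
Qed.

Let freq_pos k : 0 < freq k := freq_gt0 G_gt0 k.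
Let ampl_nneg k : 0 <= ampl k := ampl_ge0 omega_ge0 G_gt0 k.
Let ampl1 k : ampl k <= 1 := ampl_le1 omega_ge0 G_gt0 ampl_small k.

Lemma coef_ge t : 1 / 2 <= coef t.
Proof.
have := coef_near1 omega_ge0 G_gt0 ampl_small N_le t.
by rewrite ler_norml => /andP[_ h]; lra.
Qed.

Lemma coef_le t : coef t <= 3 / 2.
Proof.
have := coef_near1 omega_ge0 G_gt0 ampl_small N_le t.
by rewrite ler_norml => /andP[h _]; lra.
Qed.

Lemma G_le j k : (j <= k)%N -> G j <= G k.
Proof.
move=> jk; rewrite -(subnK jk); elim: (k - j)%N => [|n IH]; first by rewrite add0n.
by rewrite addSn; apply: le_trans IH _; exact: ltW (G_incr _).
Qed.

Section Hyperbolic.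
Variables (k : nat) (y z : R -> R).
Hypothesis sol : ode_solution (-1) 2 (fun t => coef t * freq k ^+ 2) y z.

Let F t := coef t * freq k ^+ 2 * y t ^+ 2 + z t ^+ 2.
(** After I_k only oscillations j < k are met, with |c'| <= 24 ampl j freq j <= 3 / 2 G k;
    [hyperbolic_gronwall] doubles this. Thus the rate does not involve [freq k]. *)
Let K := 3 * G k.
Let rel s t := F t <= F s * expR (K * (t - s)) /\ F s <= F t * expR (K * (t - s)).

Let rel_trans s t r : rel s t -> rel t r -> rel s r.
Proof.
move=> [h1 h2] [h3 h4].
rewrite /rel; have -> : K * (r - s) = K * (t - s) + K * (r - t) by ring.
rewrite expRD; split.
  by apply: le_trans h3 _; rewrite mulrA ler_wpM2r ?expR_ge0.
by apply: le_trans h2 _; rewrite [expR _ * expR _]mulrC mulrA ler_wpM2r ?expR_ge0.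
Qed.

Let rel_piece (p dp : R -> R) s t : -1 <= s -> s <= t -> t <= 2 ->
  (forall r : R, is_derive r 1 p (dp r)) -> (forall r, `|dp r| <= 3 / 2 * G k) ->
  (forall r, 1 / 2 <= p r) -> (forall r, s <= r <= t -> coef r = p r) -> rel s t.
Proof.
move=> s1 st t2 dpE dpk p2 cp.
have sol' : ode_solution s t (fun r => p r * freq k ^+ 2) y z.
  apply: ode_solutionS s1 t2 _ sol => r /andP[h1 h2].
  by rewrite cp// !ltW.
have k0 : 0 <= 3 / 2 * G k by rewrite mulr_ge0// ltW.
have := hyperbolic_gronwall (ltW (freq_pos k)) k0 st sol' dpE dpk p2.
rewrite /= -(cp s) ?lexx// -(cp t) ?lexx ?st//.
by have -> : 2 * (3 / 2 * G k) * (t - s) = K * (t - s) by rewrite /K; field.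
Qed.

Let rel_const s t : -1 <= s -> s <= t -> t <= 2 -> (forall r, s <= r <= t -> coef r = 1) -> rel s t.
Proof.
move=> s1 st t2 c1; apply: (@rel_piece (fun=> 1) (fun=> 0)) => //.
  by move=> r; rewrite normr0 mulr_ge0// ltW.
by move=> r; lra.
Qed.

Let rel_active j s t : (j < k)%N -> active j s -> active j t -> s <= t -> rel s t.
Proof.
move=> jk /andP[js sj] /andP[jt tj] st.
have a0 := ampl_nneg j; have a1 := ampl1 j; have a16 := ampl_small j.
have st0 := start_gt0 j (R := R); have st2 := stop_le N_le j.
have st1 : start j <= 1 / 2 by exact: start_le_half.
apply: (@rel_piece (fun r => res_coef (ampl j) (freq j * (r - start j)))
  (fun r => freq j * res_dcoef (ampl j) (freq j * (r - start j)))) => //.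
- by lra.
- by lra.
- by move=> r; apply: is_derive_affine; exact: is_derive_res_coef.
- move=> r; rewrite normrM (gtr0_norm (freq_pos j)).
  apply: le_trans (ler_wpM2l (ltW (freq_pos j)) (res_dcoef_bound _ a0 a1)) _.
  have h : freq j <= G k by exact: G_le.
  have h2 : freq j * (16 * ampl j) <= freq j by rewrite ler_piMr// ltW.
  by lra.
- move=> r; have := res_coef_bound (freq j * (r - start j)) a0 a1.
  by rewrite ler_norml => /andP[_ h]; lra.
- move=> r /andP[sr rt]; apply: coef_active => //.
  by rewrite /active (le_trans js)//= (le_trans rt).
Qed.

(** The coefficient is only piecewise differentiable, so the comparison is propagated by induction
    on the number i of intervals met to the right of I_k. Each step crosses a gap, where the
    coefficient is 1, and at most one active interval. *)
Let rel_stop i t : (i <= k)%N -> stop k <= t -> t <= stop (k - i)%N -> rel (stop k) t.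
Proof.
have s0 : 0 <= stop k by apply: le_trans (start_stop N G_gt0 k); exact/ltW/start_gt0.
elim: i t => [|i IH] t ik kt ti.
  have -> : t = stop k by apply/eqP; rewrite eq_le kt andbT; rewrite subn0 in ti.
  by rewrite /rel subrr mulr0 expR0 mulr1.
set j := (k - i.+1)%N in ti *.
have jk : (j < k)%N by rewrite /j -subSn// subSS leq_subr.
have jS : (k - i)%N = j.+1 by rewrite /j -subSn// subSS.
have h0 := stop_le N_le j; have h1 := start_gt0 j (R := R).
have st1 : start j <= 1 / 2 by exact: start_le_half.
have [tj|jt] := leP t (stop j.+1); first by apply: IH; rewrite ?jS// ltnW.
have kj : stop k <= stop j.+1.
  move: jk; rewrite leq_eqVlt => /predU1P[->//|/(stop_le_start G_gt0 N_le)]; move/le_trans; apply.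
  exact: start_stop.
have hj : stop j.+1 <= start j by exact: stop_le_start.
have r1 : rel (stop k) (stop j.+1) by apply: IH; rewrite ?jS// ltnW.
have gap r : stop j.+1 <= r -> r <= start j -> rel (stop j.+1) r.
  move=> h2 h3; apply: rel_const => //; [lra|lra|].
  by move=> q /andP[h4 h5]; apply: (coef_gap omega G_gt0 N_le (j := j)); rewrite h4 (le_trans h5).
have [tj|jt'] := leP t (start j); first by apply: rel_trans r1 _; apply: gap => //; exact: ltW.
apply: rel_trans (rel_trans r1 (gap _ hj (lexx _))) _.
apply: (rel_active jk) => //; last exact: ltW.
- by rewrite /active lexx start_stop.
- by rewrite /active (ltW jt').
Qed.

(** Since 1 / 2 <= c <= 3 / 2, the two energies are comparable with a product of constants equal to
    3. The constant is rounded up so that it can also absorb, in [resonant_mode], the factor 6 of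
    [res_energy_le] and the factor e lost before I_k. *)
Lemma energy_after t : stop k <= t -> t <= 1 ->
  energy (freq k) y z t <= 6 * expR (1 + 3 * G k) * energy (freq k) y z (stop k) /\
  energy (freq k) y z (stop k) <= 6 * expR (1 + 3 * G k) * energy (freq k) y z t.
Proof.
move=> kt t1.
have s0 : 0 <= stop k by apply: le_trans (start_stop N G_gt0 k); exact/ltW/start_gt0.
have r1 : rel (stop k) t.
  have [t0|t0] := leP t (stop 0); first by apply: (@rel_stop k) => //; rewrite subnn.
  have k0 : stop k <= stop 0.
    case: (k) => // j; apply: le_trans (stop_le_start G_gt0 N_le (ltn0Sn j)) _.
    exact: start_stop.
  apply: rel_trans (rel_stop (leqnn k) k0 _) _; first by rewrite subnn.
  apply: rel_const => //; [lra|exact: ltW|lra|].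
  by move=> r /andP[h _]; exact: coef_after.
have K0 : 0 <= K by rewrite mulr_ge0// ltW.
have eK : expR (K * (t - stop k)) <= expR (1 + 3 * G k).
  rewrite ler_expR -/K; apply: (@le_trans _ _ (K * 1)); last by rewrite mulr1; lra.
  by rewrite ler_wpM2l//; lra.
have FE r : F r <= 3 / 2 * energy (freq k) y z r /\ energy (freq k) y z r <= 2 * F r.
  have h1 := coef_ge r; have h2 := coef_le r.
  have x0 : 0 <= freq k ^+ 2 * y r ^+ 2 by rewrite mulr_ge0 ?sqr_ge0.
  have := ler_wpM2r x0 h1; have := ler_wpM2r x0 h2; have := sqr_ge0 (z r).
  by rewrite /F /energy; split; lra.
have F0 r : 0 <= F r.
  have [_ h] := FE r; have := energy_ge0 (freq k) y z r; lra.
have [r2 r3] := r1; have [f1 f2] := FE (stop k); have [f3 f4] := FE t.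
have e0 := expR_ge0 (1 + 3 * G k).
have h1 : F t <= F (stop k) * expR (1 + 3 * G k) by apply: le_trans r2 _; rewrite ler_wpM2l.
have h2 : F (stop k) <= F t * expR (1 + 3 * G k) by apply: le_trans r3 _; rewrite ler_wpM2l.
have E1 := energy_ge0 (freq k) y z t; have E2 := energy_ge0 (freq k) y z (stop k).
have g1 := ler_wpM2r e0 f1; have g2 := ler_wpM2r e0 f3.
have p1 := mulr_ge0 E1 e0; have p2 := mulr_ge0 E2 e0.
by split; lra.
Qed.

End Hyperbolic.

Hypothesis coef_cont : forall a b : R, {within `[a, b], continuous coef}.

(** Solutions are taken on [-1, 2] so that all of [0, 1] is interior: the derivatives at 0 and T are
    then ordinary ones. *)
Lemma mode_exists (g t0 u v : R) : 0 < g -> -1 <= t0 <= 2 ->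
  exists y z, [/\ ode_solution (-1) 2 (fun t => coef t * g ^+ 2) y z, y t0 = u & z t0 = v].
Proof.
move=> g0 ht0; apply: (@linear_ode_at R (-1) 2 (3 / 2 * g ^+ 2)) => //; first by lra.
  by apply: within_continuousM => //; exact: within_continuous_cst.
move=> t _; rewrite normrM (ger0_norm (sqr_ge0 g)) ler_wpM2r ?sqr_ge0//.
by rewrite ger0_norm ?coef_le//; have := coef_ge t; lra.
Qed.

(** A mode with y = 0 at [start k] has the data of a multiple of the explicit solution, so
    uniqueness identifies them on I_k. *)
Lemma resonant_energy k y z t : ode_solution (-1) 2 (fun t => coef t * freq k ^+ 2) y z ->
  y (start k) = 0 -> active k t ->
  energy (freq k) y z t = z (start k) ^+ 2 *
    (res_sol (ampl k) (freq k * (t - start k)) ^+ 2 +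
     res_dsol (ampl k) (freq k * (t - start k)) ^+ 2).
Proof.
move=> sol y0 /andP[kt tk]; set B := z (start k).
have s0 := start_gt0 k (R := R); have s1 := start_le_half k; have s2 := stop_le N_le k.
have g0 := freq_pos k.
have sol1 : ode_solution (start k) t (fun r => coef r * freq k ^+ 2) y z.
  by apply: ode_solutionS sol => //; lra.
have sol2 : ode_solution (start k) t (fun r => coef r * freq k ^+ 2)
    (fun t => B / freq k * res_sol (ampl k) (freq k * (t - start k)))
    (fun t => B * res_dsol (ampl k) (freq k * (t - start k))).
  apply: ode_solutionS (lexx _) (lexx _) _ (res_solution (start k) (start k) t (ampl k) B g0).
  move=> r /andP[h1 h2]; congr (_ * _); apply: coef_active => //.
  by rewrite /active ltW//= (le_trans _ tk)// ltW.
have c1 r : start k < r < t -> `|1 - coef r| <= 1.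
  move=> _; apply: le_trans (coef_near1 omega_ge0 G_gt0 ampl_small N_le r) _; lra.
have [] := ode_solution_unique g0 kt c1 sol1 sol2.
- by rewrite subrr mulr0 /res_sol sin0 mul0r mulr0.
- rewrite subrr mulr0 /res_dsol sin0 cos0 /res_growth sin0 mul0r subrr mulr0 expR0 expr0n/=.
  by rewrite mulr0 addr0 !mulr1.
move=> yE zE; rewrite /energy yE zE !exprMn exprVn; field.
exact: lt0r_neq0.
Qed.

(** The mode is normalised to a / M at [stop k]. Later it changes at most by a factor M; going back
    through I_k divides it by exp(2 ampl N pi), and before I_k at most a factor e is lost. The lower
    bound a / M^2 involves [G k] but not [freq k]. *)
Lemma resonant_mode k (a : R) : 0 < a -> exists y z,
  let M := 6 * expR (1 + 3 * G k) in
  [/\ ode_solution (-1) 2 (fun t => coef t * freq k ^+ 2) y z,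
   forall t, 0 <= t <= 1 -> freq k * energy (freq k) y z t <= a,
   forall t, stop k <= t <= 1 -> a / M ^+ 2 <= freq k * energy (freq k) y z t &
   freq k * energy (freq k) y z 0 <= a * expR (- (2 * ampl k * ((N k)%:R * pi)))].
Proof.
move=> a0; pose M := 6 * expR (1 + 3 * G k); set L := (N k)%:R * pi.
have g0 := freq_pos k; have gn0 := lt0r_neq0 g0; have e0 := ampl_nneg k.
have s0 := start_gt0 k (R := R); have s1 := start_le_half k; have s2 := stop_le N_le k.
have ss := start_stop N G_gt0 k.
have M0 : 0 < M by rewrite mulr_gt0 ?expR_gt0.
have Mn0 := lt0r_neq0 M0.
have M6 : 6 <= M.
  by rewrite /M ler_peMr// -expR0 ler_expR addr_ge0// mulr_ge0// ltW.
have Me : expR 1 <= M.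
  apply: (@le_trans _ _ (expR (1 + 3 * G k))).
    by rewrite ler_expR lerDl mulr_ge0// ltW.
  by rewrite /M ler_peMl ?expR_ge0//; lra.
pose D := expR (ampl k * L).
have D1 : 1 <= D.
  by rewrite /D -expR0 ler_expR mulr_ge0// mulr_ge0// pi_ge0.
have D0 : 0 < D by rewrite expR_gt0.
have Dn0 := lt0r_neq0 D0.
(* The velocity at [start k] for which the amplification by D^2 leads exactly to a / M. *)
pose B := Num.sqrt (a / (M * freq k)) / D.
have B2 : freq k * B ^+ 2 = a / M / D ^+ 2.
  rewrite /B exprMn sqr_sqrtr ?exprVn; last by rewrite divr_ge0 ?mulr_ge0// ltW.
  by field; rewrite ?gn0 ?Dn0 ?Mn0.
have [|y [z [sol ys zs]]] := @mode_exists (freq k) (start k) 0 B g0.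
  by apply/andP; split; lra.
exists y, z => M'; rewrite -/M in M' *.
have En t := energy_ge0 (freq k) y z t.
have before t : 0 <= t <= start k -> freq k * energy (freq k) y z t <= expR 1 * (a / M / D ^+ 2).
  move=> /andP[t0 ts].
  have sol1 : ode_solution t (start k) (fun r => coef r * freq k ^+ 2) y z.
    by apply: ode_solutionS sol => //; lra.
  have d0 : 0 <= 8 * ampl k.+1 by rewrite mulr_ge0.
  have [|_] := energy_gronwall (ltW g0) d0 ts sol1.
    by move=> r /andP[_ h]; apply: coef_before => //; exact: ltW.
  rewrite {2}/energy ys zs expr0n/= mulr0 add0r => h.
  rewrite -B2 mulrCA; apply: ler_wpM2l; first exact: ltW.
  apply: le_trans h _; rewrite mulrC ler_wpM2r ?sqr_ge0// ler_expR.
  have h := ampl_prev k.+1; rewrite -/(freq k) in h.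
  have h1 : 0 <= freq k * (8 * ampl k.+1) by rewrite mulr_ge0// ltW.
  have h2 : freq k * (8 * ampl k.+1) <= 1 by rewrite mulrC.
  by apply: mulr_ile1 => //; lra.
have during t : active k t -> freq k * energy (freq k) y z t <= 6 * (a / M).
  move=> at'; rewrite (resonant_energy sol ys at') zs mulrA B2.
  have h := res_energy_le (freq k * (t - start k)) e0.
  have e2 : ampl k <= 1 / 2 by have := ampl_small k; lra.
  have le1 : res_growth (ampl k) (freq k * (t - start k)) <= D.
    have -> : D = res_growth (ampl k) L by rewrite /res_growth /L sin_pin mul0r subr0.
    apply: res_growth_nondecreasing => //; case/andP: at' => _ h2.
    by rewrite [freq k * _]mulrC -ler_pdivlMr// lerBlDl.
  have g2 := expR_ge0 (ampl k * (freq k * (t - start k) -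
     sin (freq k * (t - start k)) * cos (freq k * (t - start k)))).
  rewrite -/(res_growth _ _) in g2.
  have le2 : res_growth (ampl k) (freq k * (t - start k)) ^+ 2 <= D ^+ 2.
    by rewrite ler_pXn2r// nnegrE ltW.
  have aM : 0 <= a / M / D ^+ 2 by rewrite !divr_ge0 ?sqr_ge0// ltW.
  apply: le_trans (ler_wpM2l aM (h e2)) _.
  have := ler_wpM2l aM le2.
  have -> : a / M / D ^+ 2 * D ^+ 2 = a / M by field; rewrite ?gn0 ?Dn0 ?Mn0.
  by lra.
have atstop : freq k * energy (freq k) y z (stop k) = a / M.
  rewrite (resonant_energy sol ys) ?zs; last by rewrite /active lexx ss.
  have -> : freq k * (stop k - start k) = L.
    by rewrite /stop [start k + _]addrC addrK [freq k * _]mulrC divfK.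
  rewrite mulrA B2 /res_sol /res_dsol /L sin_pin -/L.
  have c2 := cos2Dsin2 L; rewrite {2}/L sin_pin expr0n/= addr0 in c2.
  rewrite expr0n/= mul0r mulr0 addr0 expr0n/= add0r exprMn c2 mul1r.
  have -> : res_growth (ampl k) L = D by rewrite /res_growth /L sin_pin mul0r subr0.
  by field; rewrite ?gn0 ?Dn0 ?Mn0.
have after t : stop k <= t -> t <= 1 ->
   freq k * energy (freq k) y z t <= a /\ a / M ^+ 2 <= freq k * energy (freq k) y z t.
  move=> kt t1; have [h1 h2] := energy_after sol kt t1; rewrite -/M in h1 h2.
  have := ler_wpM2l (ltW g0) h1; have := ler_wpM2l (ltW g0) h2.
  rewrite !(mulrCA _ M) atstop [M * (a / M)]mulrC divfK// => h3 h4; split => //.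
  by rewrite expr2 invfM mulrA ler_pdivrMr// [leRHS]mulrC.
split => //.
- move=> t /andP[t0 t1]; have [ts|st] := leP t (start k).
    apply: le_trans (before _ _) _; first by rewrite t0.
    rewrite mulrA ler_pdivrMr ?exprn_gt0// mulrA ler_pdivrMr//.
    have D2 : 1 <= D ^+ 2 by rewrite exprn_ege1.
    have := ler_wpM2l (ltW a0) Me.
    have : a * M <= a * D ^+ 2 * M by rewrite -mulrA ler_wpM2l ?(ltW a0)// ler_peMl// ltW.
    by lra.
  have [tp|pt] := leP t (stop k).
    apply: le_trans (during _ _) _; first by rewrite /active tp ltW.
    by rewrite mulrA ler_pdivrMr// mulrC ler_wpM2l// ltW.
  by have [] := after t (ltW pt) t1.
- by move=> t /andP[h1 h2]; have [] := after t h1 h2.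
- apply: le_trans (before 0 _) _; first by rewrite lexx ltW.
  have -> : expR (- (2 * ampl k * L)) = (D ^+ 2)^-1.
    by rewrite expRN /D -expRM_natl; congr (expR _)^-1; rewrite mulrA.
  rewrite mulrA ler_wpM2r ?invr_ge0 ?sqr_ge0// mulrA ler_pdivrMr// mulrC.
  by rewrite ler_wpM2l// ltW.
Qed.

End Modes.

(** * The sequence of frequencies *)

Section ScalarConstruction.
Context {R : realType}.
Variables (lambda : nat -> R) (omega phi : R -> R).
Hypothesis lambda_gt0 : forall k, 0 < lambda k.
Hypothesis lambda_incr : forall j k, (j < k)%N -> lambda j < lambda k.
Hypothesis lambda_unbounded : forall M : R, exists k, M < lambda k.
Hypothesis omega_ge0 : forall a : R, 0 <= a -> 0 <= omega a.
Hypothesis omega_cont : {within `[0, +oo[%classic, continuous omega}.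
Hypothesis omega_incr : forall a b : R, 0 <= a -> a < b -> omega a < omega b.
Hypothesis omega0 : omega 0 = 0.
Hypothesis omega_quot : forall a b : R, 0 < a -> a <= b -> a / omega a <= b / omega b.
Hypothesis phi_ge1 : forall s : R, 0 <= s -> 1 <= phi s.
Hypothesis phi_lim : s / phi s * omega (1 / s) @[s --> +oo] --> +oo.

Lemma omega_small e : 0 < e -> exists2 d, 0 < d & forall x, 0 <= x < d -> omega x < e.
Proof.
move=> e0; move/subspace_continuousP : omega_cont => /(_ 0).
rewrite /= in_itv/= lexx => /(_ isT)/cvgrPdist_lt/(_ e e0)[d /= d0 dP].
exists d => // x /andP[x0 xd].
have := dP x; rewrite /ball_/= sub0r normrN ger0_norm// => /(_ xd).
rewrite in_itv/= x0 => /(_ isT) h; have {h} : `|omega 0 - omega x| < e := h.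
rewrite omega0 sub0r normrN ger0_norm//.
exact: omega_ge0.
Qed.

(** The bound a / M^2 of [resonant_mode] for a = 2^-(k+1) and preceding frequency x, known before
    the next frequency is chosen. *)
Definition lower k x : R := 2^-1 ^+ k.+1 / (6 * expR (1 + 3 * x)) ^+ 2.

Lemma lower_gt0 k x : 0 < lower k x.
Proof. by rewrite divr_gt0// exprn_gt0// mulr_gt0// expR_gt0. Qed.

(** Requirements on a frequency x' following x. In order: small amplitude; nearly constant energy of
    the mode x before its own interval; room for I_k; growth that beats the Gevrey weight; and x' so
    large that x'^(1 / (k+1)) makes up for the lower bound. *)
Definition admissible k x x' (N : nat) :=
  [/\ 16 * omega (1 / x') <= 1, 8 * omega (1 / x') * x <= 1,
     N%:R * pi / x' <= 2^-1 ^+ k.+1,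
     k.+1%:R * phi x' <= 2 * omega (1 / x') * (N%:R * pi) &
     1 <= x' /\ (k.+1%:R / lower k x) ^+ k.+1 <= x'].

Lemma admissible_near k x : 0 < x -> \forall x' \near +oo, exists N, admissible k x x' N.
Proof.
move=> x0; set l : R := 2^-1 ^+ k.+1.
have l0 : 0 < l by rewrite exprn_gt0// invr_gt0.
have o1 e : 0 < e -> \forall x' \near +oo, omega (1 / x') < e.
  move=> e0; have [d d0 dP] := omega_small e0; near=> x'.
  have x'0 : 0 < x' by near: x'; apply: nbhs_pinfty_gt; exact: num_real.
  apply: dP; rewrite divr_ge0 ?ltW//= ltr_pdivrMr// mulrC -ltr_pdivrMr//.
  by near: x'; apply: nbhs_pinfty_gt; exact: num_real.
near=> x'.
have x'0 : 0 < x' by near: x'; apply: nbhs_pinfty_gt; exact: num_real.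
have h1 : omega (1 / x') < 1 / 16 by near: x'; apply: o1.
have h2 : omega (1 / x') < 1 / (8 * x) by near: x'; apply: o1; rewrite divr_gt0// mulr_gt0.
have h3 : 2 * pi / l < x' by near: x'; apply: nbhs_pinfty_gt; exact: num_real.
have h4 : k.+1%:R / l <= x' / phi x' * omega (1 / x').
  by near: x'; move/cvgryPge : phi_lim; exact.
have h5 : (k.+1%:R / lower k x) ^+ k.+1 < x' by near: x'; apply: nbhs_pinfty_gt; exact: num_real.
have h6 : 1 < x' by near: x'; apply: nbhs_pinfty_gt; exact: num_real.
have p0 : 0 < pi :> R := pi_gt0 R.
have y0 : 0 <= x' * l / pi by rewrite divr_ge0 ?mulr_ge0// ltW.
have /andP[t1 t2] := truncn_itv y0.
(* The largest number of half periods that fits in length l; as x' l > 2 pi, it fills more than half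
   of l. *)
exists (Num.truncn (x' * l / pi)); split.
- lra.
- by move: h2; rewrite ltr_pdivlMr ?mulr_gt0// => h2; lra.
- by rewrite ler_pdivrMr// [leRHS]mulrC -ler_pdivlMr//.
- have ph : 0 < phi x' by apply: lt_le_trans (phi_ge1 _); rewrite ?ltW.
  move: h4; rewrite mulrAC ler_pdivlMr// mulrAC ler_pdivrMr// => h4.
  apply: le_trans h4 _.
  have o0 : 0 <= omega (1 / x') by rewrite omega_ge0// divr_ge0// ltW.
  have h7 : x' * l <= 2 * ((Num.truncn (x' * l / pi))%:R * pi).
    move: t2; rewrite ltr_pdivrMr// mulrSr mulrDl mul1r => t2.
    by move: h3; rewrite ltr_pdivrMr// => h3; lra.
  by have := ler_wpM2l o0 h7; lra.
- by split; exact: ltW.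
Unshelve. all: by end_near. Qed.

Lemma sequence_exists : exists (n N : nat -> nat), [/\ n 0%N = 0%N,
  forall k, (n k < n k.+1)%N &
  forall k, admissible k (lambda (n k)) (lambda (n k.+1)) (N k)].
Proof.
have step k n : exists p : nat * nat, (n < p.1)%N /\ admissible k (lambda n) (lambda p.1) p.2.
  have [X [_ XP]] := admissible_near k (lambda_gt0 n).
  have [i Xi] := lambda_unbounded (Num.max X (lambda n)).
  move: Xi; rewrite gt_max => /andP[Xi ni].
  have [N aN] := XP _ Xi; exists (i, N); split => //=.
  rewrite ltnNge; apply/negP; rewrite leq_eqVlt => /predU1P[in_|/lambda_incr h].
    by rewrite in_ ltxx in ni.
  by have := lt_trans h ni; rewrite ltxx.
have [f fP] := choice (fun kn : nat * nat => step kn.1 kn.2).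
pose n := fix n k := if k is k'.+1 then (f (k', n k')).1 else 0%N.
exists n, (fun k => (f (k, n k)).2); split => //.
  by move=> k /=; have [] := fP (k, n k).
by move=> k /=; have [] := fP (k, n k).
Qed.

Lemma scalar_solutions : exists (n : nat -> nat) (c : R -> R) (T : R) (y z : nat -> R -> R)
    (A d : nat -> R), let L k := lambda (n k) in
  [/\ (forall k, (n k < n k.+1)%N) /\ 0 < T <= 1,
   (forall t, 1 / 2 <= c t <= 3 / 2) /\ (forall s t, `|c s - c t| <= 48 * omega `|s - t|),
   {within `[-1, 2], continuous c} /\
   (forall k, ode_solution (-1) 2 (fun t => c t * L k ^+ 2) (y k) (z k)),
   [/\ cvgn (series A),
     forall k t, 0 <= t <= T -> L k * energy (L k) (y k) (z k) t <= A k &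
     forall k, L k.+1 * energy (L k.+1) (y k.+1) (z k.+1) 0 <=
       expR (- (k.+1%:R * phi (L k.+1)))] &
   (forall k, [/\ 0 < d k, (k.+1%:R / d k) ^+ k.+1 <= L k.+1, 1 <= L k.+1 &
     forall t, 2^-1 ^+ k <= t <= T -> d k <= L k.+1 * energy (L k.+1) (y k.+1) (z k.+1) t]) /\
   (forall m s t, 0 <= s -> s <= t -> t <= T ->
     t - s <= \sum_(0 <= j < m.+1) L j ^+ 2 * (y j t ^+ 2 - y j s ^+ 2))].
Proof.
have [n [N [n0 n_incr nP]]] := sequence_exists.
pose L k := lambda (n k).
have L0 k : 0 < L k by exact: lambda_gt0.
have Li k : L k < L k.+1 by exact: lambda_incr.
have as_ k : 16 * ampl omega L k <= 1 by have [] := nP k.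
have ap k : 8 * ampl omega L k * L k <= 1 by have [] := nP k.
have Nl k : (N k)%:R * pi / freq L k <= start k by have [] := nP k.
pose c := coef omega L N.
have cc a b : {within `[a, b], continuous c}.
  exact: (coef_continuous omega_ge0 omega_incr omega0 omega_quot omega_small L0 as_ Nl).
have mode0 := @mode_exists R omega L N omega_ge0 L0 as_ Nl cc.
(* With these data L0^2 y z is 4 at time 0, hence at least 1 up to a small time T; its double is the
   derivative of L0^2 y^2. *)
have [|y0 [z0 [sol0 y00 z00]]] := mode0 (L 0%N) 0 (2 / L 0%N) (2 / L 0%N) (L0 0%N).
  by apply/andP; split; lra.
have a0 k : 0 < 2^-1 ^+ k.+1 :> R by rewrite exprn_gt0// invr_gt0.
have modeS k := @resonant_mode R omega L N omega_ge0 omega_incr L0 Li as_ ap Nl cc k _ (a0 k).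
have [Y YP] := choice modeS; have [Z ZP] := choice YP => {YP}.
pose y k := if k is j.+1 then Y j else y0; pose z k := if k is j.+1 then Z j else z0.
have sol k : ode_solution (-1) 2 (fun t => c t * L k ^+ 2) (y k) (z k).
  by case: k => [|k] //; have [] := ZP k.
have [T /andP[T0 T1] TP] : exists2 T, 0 < T <= 1 &
    forall t, 0 <= t <= T -> 1 <= L 0%N ^+ 2 * y 0%N t * z 0%N t.
  have [cy cz _ _] := sol 0%N.
  have cF : {within `[-1, 2], continuous (fun t => L 0%N ^+ 2 * y 0%N t * z 0%N t)}.
    apply: within_continuousM => //; apply: within_continuousM => //.
    exact: within_continuous_cst.
  have i0 : `[-1, 2]%classic (0 : R) by rewrite /= in_itv/=; apply/andP; split; lra.
  move/subspace_continuousP : cF => /(_ 0 i0)/cvgrPdist_lt/(_ 1 (ltr0n R 1))[e /= e0 eP].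
  exists (Num.min 1 (e / 2)); first by rewrite lt_min ltr01 divr_gt0//= ge_min lexx.
  move=> t /andP[t0]; rewrite le_min => /andP[t1 te].
  have h : `|L 0%N ^+ 2 * y0 0 * z0 0 - L 0%N ^+ 2 * y0 t * z0 t| < 1.
    apply: eP; last by rewrite /= in_itv/=; apply/andP; split; lra.
    by rewrite /ball_/= sub0r normrN ger0_norm//; lra.
  rewrite y00 z00 in h.
  have e4 : L 0%N ^+ 2 * (2 / L 0%N) * (2 / L 0%N) = 4.
    by field; exact: lt0r_neq0.
  by move: h; rewrite e4 ltr_norml => /andP[_ h]; lra.
pose E k t := energy (L k) (y k) (z k) t.
(* The low mode is bounded by Gronwall's inequality with |1 - c| <= 1 on a time at most 1; the 1
   takes care of the resonant modes. *)
pose C := 1 + L 0%N * E 0%N 0 * expR (L 0%N).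
have C1 : 1 <= C by rewrite /C lerDl mulr_ge0 ?expR_ge0// mulr_ge0 ?energy_ge0// ltW.
have high k t : 0 <= t <= T -> L k.+1 * E k.+1 t <= 2^-1 ^+ k.+1.
  move=> /andP[t0 tT]; have [_ h _ _] := ZP k; apply: h.
  by rewrite t0 (le_trans tT).
exists n, c, T, y, z, (fun k => C * 2^-1 ^+ k), (fun k => lower k (L k)); split.
- by rewrite T0 T1.
- split; last by move=> s t; exact: coef_omega.
  by move=> t; rewrite coef_ge// coef_le.
- by split => //; exact: cc.
- split.
  + apply: is_cvg_geometric_series; rewrite ger0_norm ?invr_ge0// invf_lt1// ltr1n//.
  + case=> [|k] t ht; last first.
      by apply: le_trans (high _ _ ht) _; rewrite ler_peMl// exprn_ge0// invr_ge0.
    rewrite expr0 mulr1; case/andP: ht => t0 tT.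
    have solt : ode_solution 0 t (fun r => c r * L 0%N ^+ 2) (y 0%N) (z 0%N).
      by apply: ode_solutionS (sol 0%N) => //; lra.
    have c1 r : 0 < r < t -> `|1 - c r| <= 1.
      move=> _; apply: le_trans (coef_near1 omega_ge0 L0 as_ Nl r) _; lra.
    have [h _] := energy_gronwall (ltW (L0 0%N)) ler01 t0 solt c1.
    have h1 : expR (L 0%N * 1 * (t - 0)) <= expR (L 0%N).
      by rewrite ler_expR mulr1 subr0 ler_piMr ?(ltW (L0 0%N))// (le_trans tT).
    have h2 := ler_wpM2l (energy_ge0 (L 0%N) (y 0%N) (z 0%N) 0) h1.
    have h3 := ler_wpM2l (ltW (L0 0%N)) (le_trans h h2).
    apply: le_trans h3 _; rewrite /C mulrA lerDr//.
  + move=> k; have [_ _ _ h] := ZP k; apply: le_trans h _.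
    have [_ _ _ h _] := nP k.
    apply: (@le_trans _ _ (1 * expR (- (2 * ampl omega L k * ((N k)%:R * pi))))).
      by rewrite ler_wpM2r ?expR_ge0// exprn_ile1 ?invr_ge0// invf_le1// ler1n.
    by rewrite mul1r ler_expR lerN2.
- split.
  + move=> k; have [_ _ _ _ [h1 h2]] := nP k; split => //; first exact: lower_gt0.
    move=> t /andP[kt tT]; have [_ _ h _] := ZP k; apply: h.
    rewrite (le_trans tT)// andbT; apply: le_trans kt.
    have h := stop_le Nl k; apply: le_trans h _.
    by rewrite /start exprS mulrA mulfV ?mul1r.
  + move=> m s t s0 st tT.
    have st0 : 0 <= t - s by rewrite subr_ge0.
    have mvt k : exists2 r, 0 <= r <= T &
        L k ^+ 2 * (y k t ^+ 2 - y k s ^+ 2) = 2 * L k ^+ 2 * y k r * z k r * (t - s).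
      have [cy _ dy _] := sol k.
      have ccy : {within `[s, t], continuous (fun t => y k t ^+ 2)}.
        by apply: within_continuousM; apply: within_continuousS cy => //; lra.
      have dyy r : r \in `]s, t[ -> is_derive r 1 (fun t => y k t ^+ 2) (2 * y k r * z k r).
        rewrite in_itv/= => /andP[h1 h2].
        have h3 : is_derive r 1 (y k) (z k r) by apply: dy; apply/andP; split; lra.
        by apply: is_derive_eq; rewrite /GRing.scale/=; ring.
      have [r + rE] := MVT_segment st dyy ccy.
      rewrite in_itv/= => /andP[h1 h2]; exists r; first by apply/andP; split; lra.
      by rewrite rE; ring.
    rewrite big_nat_recl//=.
    (* The low mode gains at least 2 (t - s), and the first m resonant ones lose at most (1 - 2^-m)
       (t - s), the sum of their bounds 2^-(k+1). *)
    have low : 2 * (t - s) <= L 0%N ^+ 2 * (y 0%N t ^+ 2 - y 0%N s ^+ 2).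
      have [r hr ->] := mvt 0%N; rewrite ler_wpM2r//.
      by have := TP r hr; lra.
    have hi : - ((1 - 2^-1 ^+ m) * (t - s)) <=
        \sum_(0 <= i < m) L i.+1 ^+ 2 * (y i.+1 t ^+ 2 - y i.+1 s ^+ 2).
      elim: m => [|m IH]; first by rewrite expr0 subrr mul0r oppr0 big_geq.
      rewrite big_nat_recr//=.
      have [r hr rE] := mvt m.+1.
      have h1 := energy_flux (y m.+1 r) (z m.+1 r) (ltW (L0 m.+1)).
      have h2 : `|2 * L m.+1 ^+ 2 * y m.+1 r * z m.+1 r| <= 2^-1 ^+ m.+1.
        by apply: le_trans h1 (high m r hr).
      move: h2; rewrite ler_norml => /andP[h2 _].
      have h3 := ler_wpM2r st0 h2; rewrite -rE in h3.
      have e2 : (2^-1 : R) ^+ m = 2 * 2^-1 ^+ m.+1 by rewrite exprS mulrA mulfV ?mul1r.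
      rewrite e2 in IH; move: IH h3; set q := 2^-1 ^+ m.+1; set S := \sum_(_ <= _ < _) _.
      by set D := L m.+1 ^+ 2 * _; lra.
    have p1 : 0 <= 2^-1 ^+ m * (t - s) by rewrite mulr_ge0// exprn_ge0// invr_ge0.
    move: p1 hi low; set q := 2^-1 ^+ m; set S := \sum_(_ <= _ < _) _.
    by set D := L 0%N ^+ 2 * _; lra.
Unshelve. all: by end_near. Qed.

End ScalarConstruction.

(** * Regularity of the vector-valued solution *)

Lemma cvgD0 (R : realType) (T : Type) (F : set_system T) (FF : Filter F) (f g : T -> R) :
  f @ F --> 0 -> g @ F --> 0 -> (fun s => f s + g s) @ F --> 0.
Proof. by move=> f0 g0; rewrite -[0](addr0 0); exact: cvgD. Qed.

Lemma cvgMl0 (R : realType) (T : Type) (F : set_system T) (FF : Filter F) (f : T -> R) (c : R) :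
  f @ F --> 0 -> (fun s => c * f s) @ F --> 0.
Proof. by move=> f0; rewrite -(mulr0 c); exact: cvgMr. Qed.

Lemma cvgX0 (R : realType) (T : Type) (F : set_system T) (FF : Filter F) (f : T -> R) :
  f @ F --> 0 -> (fun s => f s ^+ 2) @ F --> 0.
Proof. by move=> f0; rewrite -(mulr0 (0 : R)); exact: cvgM. Qed.

(** Dominated convergence for series along a filter: [A] controls the tails uniformly, and the
    finite head tends to 0 termwise. The bound is on partial sums, as [sqr_norm_vec_le] expects. *)
Lemma tannery (R : realType) (T : Type) (F : set_system T) (FF : Filter F)
    (g : T -> nat -> R) (A : nat -> R) :
  cvgn (series A) -> (\forall s \near F, forall k, 0 <= g s k <= A k) ->
  (forall k, (fun s => g s k) @ F --> 0) ->
  forall e, 0 < e -> \forall s \near F, forall n, series (g s) n <= e.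
Proof.
move=> cA gA g0 e e0.
have e2 : 0 < e / 2 by rewrite divr_gt0.
have [N _ NP] := (cvgrPdist_lt _ _).1 cA _ e2.
have fin : (fun s => series (g s) N) @ F --> 0.
  rewrite /series/=; elim: N {NP} => [|N IH].
    by under eq_fun do rewrite big_geq//; exact: cvg_cst.
  rewrite (_ : (fun s => \sum_(0 <= k < N.+1) g s k) =
    (fun s => \sum_(0 <= k < N) g s k + g s N)).
    exact: cvgD0.
  by apply/funext => s; rewrite big_nat_recr.
near=> s => n.
have hA : forall k, 0 <= g s k <= A k by near: s.
have A0 k : 0 <= A k by have /andP[h1 h2] := hA k; exact: le_trans h2.
have nd : nondecreasing_seq (series (g s)).
  by apply: nondecreasing_series => k _ _; case/andP: (hA k).
have ndA : nondecreasing_seq (series A) by apply: nondecreasing_series => k _ _.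
have hN : series (g s) N <= e / 2.
  have : `|0 - series (g s) N| < e / 2.
    by near: s; move/cvgrPdist_lt : fin; exact.
  by rewrite sub0r normrN ltr_norml => /andP[_ /ltW].
have [nN|Nn] := leqP n N; first by apply: le_trans (nd _ _ nN) _; lra.
have -> : series (g s) n = series (g s) N + \sum_(N <= k < n) g s k.
  by rewrite /series/= -big_cat_nat//= ltnW.
have : \sum_(N <= k < n) g s k <= \sum_(N <= k < n) A k.
  by apply: ler_sum => k _; case/andP: (hA k).
have -> : \sum_(N <= k < n) A k = series A n - series A N.
  by rewrite sub_series_geq// ltnW.
have h1 := nondecreasing_cvgn_le ndA cA n.
have h2 := nondecreasing_cvgn_le ndA cA N.
have := NP N (leqnn N); rewrite ger0_norm ?subr_ge0// => h3.
lra.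
Unshelve. all: by end_near. Qed.

Section GraphNorm.
Context {R : realType} {H : completeNormedModType R} {ip : {dot H for idfun}}.
Hypothesis Hip : norm_from_dot ip.
Variable E : set R -> H -> H.
Hypothesis HE : projection_valued_measure ip E.
Variables (e : nat -> H) (L : nat -> R).
Hypothesis e_on : forall j k, ip (e j) (e k) = (j == k)%:R.
Hypothesis L_gt0 : forall k, 0 < L k.
Hypothesis pvm_e : forall k B, measurable B -> E B (e k) = \1_B (L k ^+ 2) *: e k.
Implicit Types (x : nat -> R) (b : R).

Let nu_gt0 k : 0 < L k ^+ 2.
Proof. by rewrite exprn_gt0. Qed.

(** The factor by which A^b multiplies the k-th coefficient. *)
Definition wt b k := (L k ^+ 2) `^ b.

Lemma wt_gt0 b k : 0 < wt b k. Proof. exact: powR_gt0. Qed.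

Lemma sqr_wt b k : wt b k ^+ 2 = L k `^ (4 * b).
Proof.
rewrite /wt -powR_mulrn ?powR_ge0// -powRrM -(powR_mulrn 2 (ltW (L_gt0 k))) -powRrM.
by congr (_ `^ _); ring.
Qed.

Lemma sqr_wtn b k n : 4 * b = n%:R -> wt b k ^+ 2 = L k ^+ n.
Proof. by rewrite sqr_wt => ->; rewrite powR_mulrn// ltW. Qed.

Let mpow b : measurable_fun setT (fun s : R => s `^ b).
Proof. exact: measurable_powR. Qed.

Let pow0 b (s : R) : 0 <= s `^ b. Proof. exact: powR_ge0. Qed.

Lemma l2seq_le x (A : nat -> R) : cvgn (series A) -> (forall k, x k ^+ 2 <= A k) -> l2seq x.
Proof.
move=> cA xA; apply: series_le_cvg cA => // k; first exact: sqr_ge0.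
exact: le_trans (sqr_ge0 _) (xA k).
Qed.

Lemma pow_dom_vec b x : l2seq x -> l2seq (fun k => wt b k * x k) -> pow_dom ip E b (vec e x).
Proof. by move=> h1 h2; exact: (spec_dom_vec Hip HE e_on pvm_e (@mpow b)). Qed.

Lemma pow_op_vec b x : l2seq x -> l2seq (fun k => wt b k * x k) ->
  pow_op ip E b (vec e x) = vec e (fun k => wt b k * x k).
Proof.
by move=> h1 h2; exact: (spec_op_vec Hip HE e_on pvm_e (@mpow b) (pow0 b)).
Qed.

Lemma ip_pow_op b v k : pow_dom ip E b v -> ip (pow_op ip E b v) (e k) = wt b k * ip v (e k).
Proof.
exact: (ip_spec_op_basis Hip HE e_on pvm_e (@mpow b) (pow0 b)).
Qed.

Lemma cvg_norm_vec (T : Type) (F : set_system T) (FF : Filter F) (X : T -> nat -> R)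
    (A : nat -> R) :
  cvgn (series A) -> (\forall s \near F, forall k, X s k ^+ 2 <= A k) ->
  (forall k, (fun s => X s k) @ F --> 0) ->
  (fun s => `|vec e (X s)|) @ F --> 0.
Proof.
move=> cA XA X0; apply/cvgrPdist_le => eps eps0.
have h k : (fun s => X s k ^+ 2) @ F --> 0 by exact: cvgX0.
have tn := @tannery R T F FF (fun s k => X s k ^+ 2) A cA.
near=> s; rewrite sub0r normrN normr_id.
have xA : forall k, X s k ^+ 2 <= A k by near: s.
rewrite -(ler_pXn2r (n := 2)) ?nnegrE ?(ltW eps0)//.
apply: (sqr_norm_vec_le Hip e_on (l2seq_le cA xA)).
near: s; apply: tn => //; last by rewrite exprn_gt0.
by apply: filterS XA => s h1 k; rewrite sqr_ge0 h1.
Unshelve. all: by end_near. Qed.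

Lemma cvg_graph_norm b (T : Type) (F : set_system T) (FF : Filter F) (X : T -> nat -> R)
    (A : nat -> R) :
  cvgn (series A) ->
  (\forall s \near F, forall k, X s k ^+ 2 <= A k) ->
  (\forall s \near F, forall k, (wt b k * X s k) ^+ 2 <= A k) ->
  (forall k, (fun s => X s k) @ F --> 0) ->
  (fun s => graph_norm ip E b (vec e (X s))) @ F --> 0.
Proof.
move=> cA XA wXA X0.
have : (fun s => `|vec e (X s)| + `|vec e (fun k => wt b k * X s k)|) @ F --> 0.
  have h1 : (fun s => `|vec e (X s)|) @ F --> 0 by exact: cvg_norm_vec XA X0.
  have wX0 k : (fun s => wt b k * X s k) @ F --> 0 by exact: cvgMl0.
  have h2 : (fun s => `|vec e (fun k => wt b k * X s k)|) @ F --> 0 by exact: cvg_norm_vec wXA wX0.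
  exact: cvgD0.
apply: cvg_trans; apply: near_eq_cvg; near=> s.
have h1 : forall k, X s k ^+ 2 <= A k by near: s.
have h2 : forall k, (wt b k * X s k) ^+ 2 <= A k by near: s.
by rewrite /graph_norm pow_op_vec//; exact: l2seq_le cA _.
Unshelve. all: by end_near. Qed.

End GraphNorm.

Lemma cvge_to0 (R : realType) (T : Type) (F : set_system T) (FF : Filter F) (g : T -> \bar R) :
  (forall e, 0 < e -> \forall s \near F, (0 <= g s <= e%:E)%E) -> g @ F --> 0%E.
Proof.
move=> h; apply/fine_cvgP; split.
  have := h 1 ltr01; apply: filterS => s /andP[s0 s1].
  by rewrite ge0_fin_numE// (le_lt_trans s1)// ltry.
apply/cvgrPdist_le => e e0; have := h e e0; apply: filterS => s /andP[s0 s1].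
have fin : g s \is a fin_num by rewrite ge0_fin_numE// (le_lt_trans s1)// ltry.
rewrite /= sub0r normrN ger0_norm ?fine_ge0//.
by rewrite -lee_fin fineK.
Qed.

Lemma within_continuous_cvg (R : realType) (a b t : R) (f : R -> R) (D : set R) :
  {within `[a, b], continuous f} -> a < t < b -> f @ within D (nbhs t) --> f t.
Proof.
move=> cf /andP[at' tb]; apply: cvg_within_filter.
have /(continuous_within_itvP _ (lt_trans at' tb))[h _ _] := cf.
by apply: h; rewrite in_itv/= at'.
Qed.

(** As r lies between s and t, a bound for [g] on [0, T] dominates the quotients of all modes at
    once; as r is as close to t as s is, each quotient converges. *)
Lemma difference_quotient (R : realType) (a b s t : R) (f g : R -> R) :
  {within `[a, b], continuous f} -> (forall r, a < r < b -> is_derive r 1 f (g r)) ->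
  a < s < b -> a < t < b -> s != t ->
  exists r, [/\ Num.min s t <= r <= Num.max s t, `|r - t| <= `|s - t| &
    (s - t)^-1 * (f s - f t) = g r].
Proof.
move=> cf df.
have main (x w : R) : a < x < b -> a < w < b -> x < w ->
    exists r, x <= r <= w /\ (w - x)^-1 * (f w - f x) = g r.
  move=> /andP[ax xb] /andP[aw wb] xw.
  have cf' : {within `[x, w], continuous f} by apply: within_continuousS cf; exact: ltW.
  have df' r : r \in `]x, w[ -> is_derive r 1 f (g r).
    by rewrite in_itv/= => /andP[h1 h2]; apply: df; rewrite (lt_trans ax)//= (lt_trans h2).
  have [r + rE] := MVT xw df' cf'; rewrite in_itv/= => /andP[h1 h2].
  exists r; split; first by rewrite !ltW.
  by rewrite rE mulrC mulfK// subr_eq0 gt_eqF.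
move=> hs ht; rewrite neq_lt => /orP[st|ts].
- have [r [/andP[h1 h2] rE]] := main s t hs ht st.
  exists r; split; first by rewrite min_l ?max_r ?h1 ?h2// ltW.
    by rewrite ![`|_ - t|]distrC !ger0_norm ?subr_ge0// ?(ltW st)//; lra.
  by rewrite -rE -opprB invrN mulNr -mulrN opprB.
- have [r [/andP[h1 h2] rE]] := main t s ht hs ts.
  exists r; split; first by rewrite min_r ?max_l ?h1 ?h2// ltW.
    by rewrite !ger0_norm ?subr_ge0// ?(ltW ts)//; lra.
  by rewrite -rE.
Qed.

Lemma cvg_difference_quotient (R : realType) (a b t : R) (f g : R -> R) (D : set R) :
  {within `[a, b], continuous f} -> {within `[a, b], continuous g} ->
  (forall r, a < r < b -> is_derive r 1 f (g r)) ->
  a < t < b -> (forall s, D s -> a < s < b) ->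
  (fun s => (s - t)^-1 * (f s - f t) - g t) @ within (D `\ t) (nbhs t) --> 0.
Proof.
move=> cf cg df ht Dab; apply/cvgrPdist_le => eps eps0.
have gt : g @ nbhs t --> g t.
  by case/andP: (ht) => h1 h2; have /(continuous_within_itvP _ (lt_trans h1 h2))[h _ _] := cg;
    apply: h; rewrite in_itv/= h1.
have [d /= d0 dP] := (cvgrPdist_le _ _).1 gt eps eps0.
near=> s; rewrite sub0r normrN.
have [Ds /eqP st] : (D `\ t) s by near: s; exact: withinT.
have [r [_ rt ->]] := difference_quotient cf df (Dab _ Ds) ht st.
rewrite distrC; apply: dP; rewrite /ball_/= distrC; apply: le_lt_trans rt _.
near: s; apply: cvg_within; exists d => //= s; rewrite /ball_/= distrC; exact.
Unshelve. all: by end_near. Qed.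

(** * Solving the equation in the scale of domains D(A^b) *)

Section Evolution.
Context {R : realType} {H : completeNormedModType R} {ip : {dot H for idfun}}.
Hypothesis Hip : norm_from_dot ip.
Variable E : set R -> H -> H.
Hypothesis HE : projection_valued_measure ip E.
Variables (e : nat -> H) (L : nat -> R).
Hypothesis e_on : forall j k, ip (e j) (e k) = (j == k)%:R.
Hypothesis L_gt0 : forall k, 0 < L k.
Hypothesis pvm_e : forall k B, measurable B -> E B (e k) = \1_B (L k ^+ 2) *: e k.
Variables (T r : R) (c : R -> R) (y z : nat -> R -> R) (A : nat -> R).
Hypothesis T01 : 0 < T <= 1.
Hypothesis r_ge1 : 1 <= r.
Hypothesis rL_ge1 : forall k, 1 <= r * L k.
Hypothesis c_cont : {within `[-1, 2], continuous c}.
Hypothesis c_bound : forall t, 1 / 2 <= c t <= 3 / 2.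
Hypothesis sol : forall k, ode_solution (-1) 2 (fun t => c t * L k ^+ 2) (y k) (z k).
Hypothesis A_cvg : cvgn (series A).
Hypothesis A_bound : forall k t, 0 <= t <= T -> L k * energy (L k) (y k) (z k) t <= A k.

Local Notation wt := (wt L).
Let u t := vec e (y^~ t).
Let du t := vec e (z^~ t).
(** One majorant for all series below. The largest terms are those of the second derivative: c^2 <=
    9 / 4, and the square of a difference costs a factor 4. *)
Let B k := 9 * (r ^+ 3 * A k).

Lemma B_cvg : cvgn (series B).
Proof.
have -> : series B = (fun n => 9 * (r ^+ 3 * series A n)).
  by apply/funext => n; rewrite /series/= -!mulr_sumr.
by apply: is_cvgMr; exact: is_cvgMr.
Qed.

Let r3 : 1 <= r ^+ 3. Proof. exact: exprn_ege1. Qed.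

Let A_ge k t : 0 <= t <= T -> L k ^+ 3 * y k t ^+ 2 + L k * z k t ^+ 2 <= A k.
Proof.
by move=> ht; apply: le_trans (A_bound k ht); rewrite /energy le_eqVlt; apply/orP; left;
  apply/eqP; ring.
Qed.

Let Ly0 k t : 0 <= L k ^+ 3 * y k t ^+ 2.
Proof. by rewrite mulr_ge0 ?sqr_ge0// exprn_ge0// ltW. Qed.

Let Lz0 k t : 0 <= L k * z k t ^+ 2.
Proof. by rewrite mulr_ge0 ?sqr_ge0// ltW. Qed.

Let A0 k : 0 <= A k.
Proof.
have h : 0 <= (0 : R) <= T by case/andP: T01 => /ltW ->; rewrite lexx.
by have := A_ge k h; have := Ly0 k 0; have := Lz0 k 0; lra.
Qed.

Let rA k : A k <= r ^+ 3 * A k. Proof. by rewrite ler_peMl. Qed.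

Let r0 : 0 <= r. Proof. by rewrite (le_trans ler01). Qed.

(** The first frequencies may be below 1; r L >= 1 gives L^n <= r^3 L^3 for n <= 3. *)
Let y_le n k t : (n <= 3)%N -> 0 <= t <= T -> L k ^+ n * y k t ^+ 2 <= r ^+ 3 * A k.
Proof.
move=> n3 ht; apply: (@le_trans _ _ (r ^+ 3 * (L k ^+ 3 * y k t ^+ 2))); last first.
  rewrite ler_wpM2l ?exprn_ge0//; have := A_ge k ht; have := Lz0 k t; lra.
rewrite mulrA ler_wpM2r ?sqr_ge0// -[X in L k ^+ X]addn0.
have -> : r ^+ 3 * L k ^+ 3 = r ^+ n * L k ^+ n * (r * L k) ^+ (3 - n).
  by rewrite -!exprMn -exprD subnKC.
rewrite addn0 -[leLHS]mulr1; apply: ler_pM => //; last exact: exprn_ege1.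
  by rewrite exprn_ge0// ltW.
by rewrite ler_peMl ?exprn_ege1// exprn_ge0// ltW.
Qed.

Let z_le n k t : (n <= 1)%N -> 0 <= t <= T -> L k ^+ n * z k t ^+ 2 <= r ^+ 3 * A k.
Proof.
move=> n1 ht; apply: (@le_trans _ _ (r * (L k * z k t ^+ 2))).
  case: n n1 => [|[|//]] _.
    by rewrite expr0 mulrA ler_wpM2r ?sqr_ge0.
  by rewrite expr1 ler_peMl.
apply: (@le_trans _ _ (r * A k)).
  by rewrite ler_wpM2l//; have := A_ge k ht; have := Ly0 k t; lra.
rewrite ler_wpM2r// -[leLHS]expr1; exact: ler_weXn2l.
Qed.

Let w1 k : wt (1 / 4) k ^+ 2 = L k ^+ 1.
Proof. by apply: sqr_wtn => //; field. Qed.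

Let w2 k : wt (1 / 2) k ^+ 2 = L k ^+ 2.
Proof. by apply: sqr_wtn => //; field. Qed.

Let w3 k : wt (3 / 4) k ^+ 2 = L k ^+ 3.
Proof. by apply: sqr_wtn => //; field. Qed.

Let le9 (x : R) k : x <= r ^+ 3 * A k -> x <= B k.
Proof. by have := rA k; have := A0 k; rewrite /B; lra. Qed.

Let l2B x : (forall k, x k ^+ 2 <= r ^+ 3 * A k) -> l2seq x.
Proof. by move=> h; apply: (l2seq_le B_cvg) => k; exact: le9. Qed.

Lemma l2_y t : 0 <= t <= T -> l2seq (y^~ t).
Proof. by move=> ht; apply: l2B => k; have := y_le k (leq0n _) ht; rewrite expr0 mul1r. Qed.

Lemma l2_z t : 0 <= t <= T -> l2seq (z^~ t).
Proof. by move=> ht; apply: l2B => k; have := z_le k (leq0n _) ht; rewrite expr0 mul1r. Qed.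

Lemma l2_wy2 t : 0 <= t <= T -> l2seq (fun k => wt (1 / 2) k * y k t).
Proof. by move=> ht; apply: l2B => k; rewrite exprMn w2; exact: y_le. Qed.

Lemma l2_wy3 t : 0 <= t <= T -> l2seq (fun k => wt (3 / 4) k * y k t).
Proof. by move=> ht; apply: l2B => k; rewrite exprMn w3; exact: y_le. Qed.

Let T_sub t : 0 <= t <= T -> -1 < t < 2.
Proof. by case/andP: T01 => a1 a2 /andP[b1 b2]; apply/andP; split; lra. Qed.

Let sqrB4 (a b m : R) : a ^+ 2 <= m -> b ^+ 2 <= m -> (a - b) ^+ 2 <= 4 * m.
Proof. by have := sqr_ge0 (a + b); lra. Qed.

Lemma C0_pow_vec b (x : nat -> R -> R) :
  (forall k, {within `[-1, 2], continuous (x k)}) ->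
  (forall k t, 0 <= t <= T -> x k t ^+ 2 <= r ^+ 3 * A k) ->
  (forall k t, 0 <= t <= T -> (wt b k * x k t) ^+ 2 <= r ^+ 3 * A k) ->
  C0_pow ip E b T (fun t => vec e (x^~ t)).
Proof.
move=> cx xA wxA t; rewrite in_itv/= => ht.
have l2x s : 0 <= s <= T -> l2seq (x^~ s) by move=> hs; apply: l2B => k; exact: xA.
split.
  by apply: (pow_dom_vec Hip HE e_on pvm_e); [exact: l2x|apply: l2B => k; exact: wxA].
have : (fun s => graph_norm ip E b (vec e (fun k => x k s - x k t)))
    @ within `[0, T]%classic (nbhs t) --> 0.
  apply: (@cvg_graph_norm _ _ _ Hip _ HE _ _ e_on pvm_e b _ _ (within_filter _ _)
    (fun s k => x k s - x k t) B B_cvg).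
  - near=> s => k.
    have hs : 0 <= s <= T by have : `[0, T]%classic s by near: s; exact: withinT.
    have := sqrB4 (xA k s hs) (xA k t ht); rewrite /B; have := rA k; have := A0 k; lra.
  - near=> s => k.
    have hs : 0 <= s <= T by have : `[0, T]%classic s by near: s; exact: withinT.
    rewrite mulrBr; have := sqrB4 (wxA k s hs) (wxA k t ht); rewrite /B;
    have := rA k; have := A0 k; lra.
  - by move=> k; apply/subr_cvg0; exact: within_continuous_cvg (cx k) (T_sub ht).
apply: cvg_trans; apply: near_eq_cvg; near=> s.
have hs : 0 <= s <= T by have : `[0, T]%classic s by near: s; exact: withinT.
by rewrite (vecB Hip e_on); [|exact: l2x|exact: l2x].
Unshelve. all: by end_near. Qed.

Lemma C0_u1 : C0_pow ip E (1 / 4) T u.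
Proof.
apply: C0_pow_vec => [k|k t ht|k t ht]; first by have [] := sol k.
  by have := y_le k (leq0n _) ht; rewrite expr0 mul1r.
by rewrite exprMn w1; exact: y_le.
Qed.

Lemma C0_u3 : C0_pow ip E (3 / 4) T u.
Proof.
apply: C0_pow_vec => [k|k t ht|k t ht]; first by have [] := sol k.
  by have := y_le k (leq0n _) ht; rewrite expr0 mul1r.
by rewrite exprMn w3; exact: y_le.
Qed.

Lemma C0_du1 : C0_pow ip E (1 / 4) T du.
Proof.
apply: C0_pow_vec => [k|k t ht|k t ht]; first by have [] := sol k.
  by have := z_le k (leq0n _) ht; rewrite expr0 mul1r.
by rewrite exprMn w1; exact: z_le.
Qed.

Lemma C1_u : C1_pow ip E (1 / 4) T u du.
Proof.
split; [exact: C0_u1|exact: C0_du1|move=> t; rewrite in_itv/= => ht].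
pose X s k := (s - t)^-1 * (y k s - y k t) - z k t.
have DP s : (`[0, T]%classic `\ t) s -> 0 <= s <= T /\ s != t.
  by rewrite /= in_itv/= => -[h /eqP].
have XE s k : (`[0, T]%classic `\ t) s -> exists2 p, 0 <= p <= T & X s k = z k p - z k t.
  move=> /DP[hs st]; have [cy _ dy _] := sol k.
  have [p [/andP[p1 p2] _ pE]] := difference_quotient cy dy (T_sub hs) (T_sub ht) st.
  exists p; last by rewrite /X pE.
  case/andP: hs => s0 sT; case/andP: ht => t0 tT; apply/andP; split.
    by apply: le_trans p1; rewrite le_min s0.
  by apply: le_trans p2 _; rewrite ge_max sT.
have : (fun s => graph_norm ip E (1 / 4) (vec e (X s)))
    @ within (`[0, T]%classic `\ t) (nbhs t) --> 0.
  apply: (@cvg_graph_norm _ _ _ Hip _ HE _ _ e_on pvm_e (1 / 4) _ _ (within_filter _ _)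
    X B B_cvg).
  - near=> s => k.
    have hs : (`[0, T]%classic `\ t) s by near: s; exact: withinT.
    have [p hp ->] := XE s k hs.
    have h1 := z_le k (leq0n _) hp; have h2 := z_le k (leq0n _) ht.
    rewrite !expr0 !mul1r in h1 h2.
    have := sqrB4 h1 h2; rewrite /B; have := rA k; have := A0 k; lra.
  - near=> s => k.
    have hs : (`[0, T]%classic `\ t) s by near: s; exact: withinT.
    have [p hp ->] := XE s k hs; rewrite exprMn w1.
    have h1 := z_le k (leqnn _) hp; have h2 := z_le k (leqnn _) ht.
    rewrite !expr1 in h1 h2 *.
    have h3 : 0 <= L k * (z k p + z k t) ^+ 2 by rewrite mulr_ge0 ?sqr_ge0// ltW.
    move: h1 h2 h3; rewrite /B; have := rA k; have := A0 k; lra.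
  - move=> k; have [cy cz dy _] := sol k; apply: cvg_difference_quotient cy cz dy (T_sub ht) _.
    by move=> s; rewrite /= in_itv; exact: T_sub.
apply: cvg_trans; apply: near_eq_cvg; near=> s.
have /DP[hs st] : (`[0, T]%classic `\ t) s by near: s; exact: withinT.
rewrite /u /du (vecB Hip e_on); [|exact: l2_y|exact: l2_y].
have lyy := l2seqB (l2_y hs) (l2_y ht).
rewrite -(vecZ Hip e_on)// (vecB Hip e_on)//; first exact: l2seqZ.
exact: l2_z.
Unshelve. all: by end_near. Qed.

Lemma pow_op_u1 t : 0 <= t <= T -> pow_op ip E (1 / 2) (u t) =
  vec e (fun k => wt (1 / 2) k * y k t).
Proof.
move=> ht; apply: (pow_op_vec Hip HE e_on pvm_e); [exact: l2_y|exact: l2_wy2].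
Qed.

Lemma pow_op_u3 t : 0 <= t <= T -> pow_op ip E (3 / 4) (u t) =
  vec e (fun k => wt (3 / 4) k * y k t).
Proof.
move=> ht; apply: (pow_op_vec Hip HE e_on pvm_e); [exact: l2_y|exact: l2_wy3].
Qed.

Let wt_pos b k : 0 < wt b k := wt_gt0 L_gt0 b k.

Let w13 k : wt (3 / 4) k * wt (1 / 4) k = L k ^+ 2.
Proof.
have p : 0 <= L k ^+ 2 by rewrite exprn_ge0// ltW.
apply/eqP; rewrite -(eqrXn2 (n := 2))//; first last.
  by rewrite mulr_ge0// ltW.
by rewrite exprMn w1 w3; apply/eqP; ring.
Qed.

(** Dividing the k-th coefficient of the error by that of A^(1/4) gives a sequence X, and the error
    acts on v as (vec X, A^(1/4) v). So the dual norm is at most |vec X|, which tends to 0 by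
    domination: after the division, c L^2 y has square c^2 L^3 y^2. *)
Lemma dual_derivative_du (ddu : R -> H -> R) :
  (forall t v, 0 <= t <= T -> pow_dom ip E (1 / 4) v ->
     ddu t v = - (c t * ip (pow_op ip E (3 / 4) (u t)) (pow_op ip E (1 / 4) v))) ->
  dual_derivative ip E (1 / 4) T du ddu.
Proof.
move=> dduE t; rewrite in_itv/= => ht.
pose X s k := ((s - t)^-1 * (z k s - z k t) + c t * L k ^+ 2 * y k t) / wt (1 / 4) k.
have DP s : (`[0, T]%classic `\ t) s -> 0 <= s <= T /\ s != t.
  by rewrite /= in_itv/= => -[h /eqP].
pose q k p := - (c p * L k ^+ 2 * y k p).
have XE s k : (`[0, T]%classic `\ t) s -> exists2 p, 0 <= p <= T &
    X s k = (q k p - q k t) / wt (1 / 4) k.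
  move=> /DP[hs st]; have [_ cz _ dz] := sol k.
  have [p [/andP[p1 p2] _ pE]] := difference_quotient cz dz (T_sub hs) (T_sub ht) st.
  exists p; last by rewrite /X pE /q opprK.
  case/andP: hs => s0 sT; case/andP: ht => t0 tT; apply/andP; split.
    by apply: le_trans p1; rewrite le_min s0.
  by apply: le_trans p2 _; rewrite ge_max sT.
have q_le k p : 0 <= p <= T -> (q k p / wt (1 / 4) k) ^+ 2 <= 9 / 4 * (r ^+ 3 * A k).
  move=> hp; rewrite /q exprMn sqrrN !exprMn exprVn w1.
  have Ln0 : L k != 0 by exact: lt0r_neq0.
  have -> : c p ^+ 2 * (L k ^+ 2) ^+ 2 * y k p ^+ 2 / L k ^+ 1 =
    c p ^+ 2 * (L k ^+ 3 * y k p ^+ 2) by field.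
  apply: ler_pM; [exact: sqr_ge0|exact: Ly0| |exact: y_le].
  have /andP[c1 c2] := c_bound p.
  have := mulr_ge0 (y := 3 / 2 + c p) (x := 3 / 2 - c p); rewrite subr_ge0 => /(_ c2 _).
  have h : 0 <= 3 / 2 + c p by lra.
  by move=> /(_ h); lra.
have X_le s k : (`[0, T]%classic `\ t) s -> X s k ^+ 2 <= B k.
  move=> hs; have [p hp ->] := XE s k hs; rewrite mulrBl.
  have := sqrB4 (q_le k p hp) (q_le k t ht); rewrite /B; lra.
have X0 k : (fun s => X s k) @ within (`[0, T]%classic `\ t) (nbhs t) --> 0.
  have [cy cz _ dz] := sol k.
  have cq : {within `[-1, 2], continuous (fun t => - (c t * L k ^+ 2 * y k t))}.
    apply: within_continuousN; apply: within_continuousM => //.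
    by apply: within_continuousM => //; exact: within_continuous_cst.
  have D2 s : `[0, T]%classic s -> -1 < s < 2 by rewrite /= in_itv; exact: T_sub.
  have -> : (fun s => X s k) =
      (fun s => (wt (1 / 4) k)^-1 * ((s - t)^-1 * (z k s - z k t) - q k t)).
    by apply/funext => s; rewrite /X /q opprK mulrC.
  by apply: cvgMl0; exact: (cvg_difference_quotient cz cq dz (T_sub ht) D2).
have nX : (fun s => `|vec e (X s)|) @ within (`[0, T]%classic `\ t) (nbhs t) --> 0.
  have XB : \forall s \near within (`[0, T]%classic `\ t) (nbhs t), forall k, X s k ^+ 2 <= B k.
    by near=> s => k; apply: X_le; near: s; exact: withinT.
  exact: (@cvg_norm_vec _ _ _ Hip _ e_on _ _ (within_filter _ _) _ _ B_cvg XB X0).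
(* Testing with 0 shows that the supremum in the dual norm is nonnegative; over an empty set it
   would be -oo. *)
have zero_in : [set v | pow_dom ip E (1 / 4) v /\ graph_norm ip E (1 / 4) v <= 1] 0.
  have l0 : l2seq (fun _ : nat => 0 : R).
    by apply: (l2seq_le B_cvg) => k; rewrite expr0n/= /B mulr_ge0// mulr_ge0// exprn_ge0.
  have w0 : (fun k => wt (1 / 4) k * 0) = (fun=> 0) by apply/funext => k; rewrite mulr0.
  have lw0 : l2seq (fun k => wt (1 / 4) k * 0) by rewrite w0.
  have v0 : vec e (fun=> 0) = 0.
    by apply: vec_eq_lim; rewrite /series/=; under eq_fun do
      (rewrite big1; last by move=> i _; rewrite scale0r); exact: cvg_cst.
  rewrite /= -v0; split; first exact: (pow_dom_vec Hip HE e_on pvm_e).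
  rewrite /graph_norm (pow_op_vec Hip HE e_on pvm_e)//.
  by rewrite w0 v0 normr0 addr0.
apply: cvge_to0 => eps eps0; near=> s.
have hs' : (`[0, T]%classic `\ t) s by near: s; exact: withinT.
have [hs st] := DP s hs'.
have lX : l2seq (X s) by apply: (l2seq_le B_cvg) => k; exact: X_le.
apply/andP; split.
  apply: (@le_trans _ _ (`|(s - t)^-1 * (ip (du s) 0 - ip (du t) 0) - ddu t 0|%:E)).
    by rewrite lee_fin.
  by apply: ereal_sup_ubound; exists 0.
apply: ge_ereal_sup => _ [v [dv gv] <-]; rewrite lee_fin.
set w := pow_op ip E (1 / 4) v.
have wn : `|w| <= 1 by apply: le_trans gv; rewrite /graph_norm lerDr.
rewrite dduE// -/w opprK.
have -> : (s - t)^-1 * (ip (du s) v - ip (du t) v) + c t * ip (pow_op ip E (3 / 4) (u t)) w =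
    ip (vec e (X s)) w.
  have lzz := l2seqB (l2_z hs) (l2_z ht).
  rewrite -ipBl -ipZl -ipZl pow_op_u3// /du (vecB Hip e_on); [|exact: l2_z|exact: l2_z].
  rewrite -!(vecZ Hip e_on)//; last exact: l2_wy3.
  have h1 := cvg_ip_vec Hip e_on v (l2seqZ (a := (s - t)^-1) lzz).
  have h2 := cvg_ip_vec Hip e_on w (l2seqZ (a := c t) (l2_wy3 ht)).
  have h3 := cvg_ip_vec Hip e_on w lX.
  have sE : series (fun k => X s k * ip (e k) w) =
      (fun n => series (fun k => (s - t)^-1 * (z k s - z k t) * ip (e k) v) n +
                series (fun k => c t * (wt (3 / 4) k * y k t) * ip (e k) w) n).
    apply/funext => n; rewrite /series/= -big_split/=; apply: eq_bigr => k _.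
    rewrite ![ip (e k) _]ipC (ip_pow_op Hip HE e_on pvm_e)// /X.
    have wn0 : wt (1 / 4) k != 0 by exact: lt0r_neq0.
    by rewrite -w13; field; rewrite ?wn0 ?subr_eq0 ?st.
  rewrite sE in h3; apply: (cvgn_eq _ h3); exact: cvgD.
apply: le_trans (cauchy_schwarz Hip _ _) _.
apply: (@le_trans _ _ `|vec e (X s)|); first by rewrite ler_piMr.
have : `|0 - `|vec e (X s)| | <= eps.
  by near: s; move/cvgrPdist_le : nX; exact.
by rewrite sub0r normrN normr_id.
Unshelve. all: by end_near. Qed.

End Evolution.

(** * The nonlinearity *)

(** A generalised inverse, the supremum of the times with Psi t <= x, is defined for all x;
    admitting t = 0 keeps the set nonempty for x below Psi 0. *)
Lemma expanding_inverse (R : realType) (T : R) (Psi : R -> R) : 0 <= T ->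
  (forall s t, 0 <= s -> s <= t -> t <= T -> t - s <= Psi t - Psi s) ->
  exists tau : R -> R, (forall t, 0 <= t <= T -> tau (Psi t) = t) /\
    forall x x', `|tau x - tau x'| <= `|x - x'|.
Proof.
move=> T0 PsiP.
pose S x := [set t : R | 0 <= t <= T /\ (t = 0 \/ Psi t <= x)].
have S0 x : S x 0 by split; [rewrite lexx T0|left].
have Sub x : has_ubound (S x) by exists T => t [/andP[_ tT] _].
have Ssup x : has_sup (S x) by split; [exists 0|].
have sup_le x t : S x t -> t <= sup (S x) by move=> h; exact: ub_le_sup.
exists (fun x => sup (S x)); split.
  move=> t ht; apply/eqP; rewrite eq_le; apply/andP; split; last by apply: sup_le; split => //; right.
  apply: ge_sup; first by exists 0.
  move=> s [/andP[s0 sT] [->|Ps]]; first by case/andP: ht.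
  rewrite leNgt; apply/negP => ts; case/andP: ht => t0 tT.
  by have := PsiP t s t0 (ltW ts) sT; lra.
move=> x x'; wlog xx : x x' / x' <= x => [h|].
  by have [/h//|/ltW/h] := leP x' x; rewrite distrC [`|x' - x|]distrC.
have mono : sup (S x') <= sup (S x).
  apply: ge_sup; first by exists 0.
  move=> s [hs [s0|Ps]]; apply: sup_le; split => //; first by left.
  by right; exact: le_trans xx.
rewrite !ger0_norm ?subr_ge0//; rewrite leNgt; apply/negP => lt.
have e0 : 0 < (sup (S x) - sup (S x') - (x - x')) / 2 by rewrite divr_gt0// subr_gt0.
have [t [/andP[t0 tT] hP] ht] := sup_adherent e0 (Ssup x).
have sx0 := sup_le _ _ (S0 x').
set a := sup (S x) in lt e0 ht mono; set a' := sup (S x') in lt e0 ht mono sx0.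
have tx : Psi t <= x by case: hP => // tE; exfalso; move: ht; rewrite tE; lra.
(* A time above the supremum for x', but more than x - x' before t: then Psi w > x', and expansion
   gives Psi t > x. *)
pose w := (a' + (t - (x - x'))) / 2.
have w1 : a' < w by rewrite /w; lra.
have w2 : w + (x - x') < t by rewrite /w; lra.
have wT : w <= T by lra.
have Pw : x' < Psi w.
  rewrite ltNge; apply/negP => Pw; have : S x' w by split; [apply/andP; split; lra|right].
  by move=> /sup_le; rewrite -/a'; lra.
have wt : w <= t by lra.
have w0 : 0 <= w by lra.
by have := PsiP w t w0 wt tT; lra.
Qed.

Lemma geometric_nneseries_lty (R : realType) (g : nat -> R) (C q : R) : 0 <= q < 1 ->
  (forall k, 0 <= g k <= C * q ^+ k) -> (\sum_(k <oo) (g k)%:E < +oo)%E.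
Proof.
move=> /andP[q0 q1] gC.
have cg : cvgn (series (fun k => C * q ^+ k)).
  by apply: is_cvg_geometric_series; rewrite ger0_norm.
have cv : cvgn (series g).
  apply: series_le_cvg cg => k; case/andP: (gC k) => // h1 h2; exact: le_trans h2.
have -> : (\sum_(k <oo) (g k)%:E)%E = (limn (series g))%:E.
  apply/cvg_lim => //; have /cvgn_EFin : series g @ \oo --> limn (series g) by [].
  by apply: cvg_trans; apply: near_eq_cvg; apply: nearW => n; rewrite /series/= -sumEFin.
by rewrite ltry.
Qed.

(* A majorant [exp (r - j) <= C exp (- j)] for the terms with [j >= r]; the finitely
   many other terms only affect [C]. *)
Lemma gevrey_summable (R : realType) (g ph : nat -> R) (r : R) :
  (forall k, 1 <= ph k) -> (forall k, 0 <= g k) ->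
  (forall k, g k.+1 <= expR (- (k.+1%:R * ph k.+1))) ->
  (\sum_(k <oo) (g k * expR (r * ph k))%:E < +oo)%E.
Proof.
move=> ph1 g0 gexp; pose q := expR (-1) : R.
have q01 : 0 <= q < 1 by rewrite expR_ge0/= expR_lt1 oppr_lt0.
have t0 k : 0 <= g k * expR (r * ph k) by rewrite mulr_ge0 ?expR_ge0.
have [N rN] : exists N : nat, r < N%:R.
  by exists (Num.bound `|r|); apply: le_lt_trans (ler_norm _) (archi_boundP (normr_ge0 _)).
pose C := expR r + \sum_(j < N.+1) g j * expR (r * ph j) * expR j%:R.
apply: (@geometric_nneseries_lty _ _ C q) => // k; rewrite t0/=.
have S0 (M : nat) : 0 <= \sum_(j < M) g j * expR (r * ph j) * expR j%:R.
  by apply: sumr_ge0 => j _; rewrite mulr_ge0 ?expR_ge0.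
have qk : q ^+ k = (expR k%:R)^-1 by rewrite /q -expRM_natl -expRN mulrN1.
rewrite qk ler_pdivlMr ?expR_gt0//.
have [kN|Nk] := ltnP k N.+1.
  rewrite /C (bigD1 (Ordinal kN))//= addrCA lerDl addr_ge0 ?expR_ge0//.
  by apply: sumr_ge0 => j _; rewrite mulr_ge0 ?expR_ge0.
apply: (@le_trans _ _ (expR r)); last by rewrite /C lerDl.
case: k Nk {qk} => // k Nk.
apply: (@le_trans _ _ (expR (- (k.+1%:R * ph k.+1)) * expR (r * ph k.+1) * expR k.+1%:R)).
  by rewrite ler_wpM2r ?expR_ge0// ler_wpM2r ?expR_ge0.
rewrite -!expRD ler_expR.
have h : r - k.+1%:R <= 0.
  by rewrite subr_le0 ltW// (lt_le_trans rN)// ler_nat ltnW.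
have := ph1 k.+1; move: (ph k.+1) => p p1.
have : (r - k.+1%:R) * p <= (r - k.+1%:R) * 1 by rewrite ler_wnM2l.
lra.
Qed.

Unset Implicit Arguments.
Set Strict Implicit.
Set Printing Implicit Defensive.

Theorem theorem3p1 (R : realType) (H : completeNormedModType R)
    (ip : {dot H for idfun}) (D : set H) (A : H -> H)
    (E : set R -> H -> H) (e : nat -> H) (lambda : nat -> R)
    (omega phi : R -> R)
    (Hip : norm_from_dot ip)
    (Hsep : separable_space H)
    (Asa : self_adjoint ip D A)
    (Age0 : nonneg_op ip D A)
    (AE : spectral_resolution ip E D A)
    (e_orthonormal : forall j k, ip (e j) (e k) = (j == k)%:R)
    (lambda_gt0 : forall k, 0 < lambda k)
    (lambda_incr : forall j k, (j < k)%N -> lambda j < lambda k)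
    (lambda_unbounded : forall M : R, exists k, M < lambda k)
    (e_eigen : forall k, D (e k) /\ A (e k) = lambda k ^+ 2 *: e k)
    (omega_ge0 : forall a : R, 0 <= a -> 0 <= omega a)
    (omega_cont : {within `[0, +oo[%classic, continuous omega})
    (omega_incr : forall a b : R, 0 <= a -> a < b -> omega a < omega b)
    (omega0 : omega 0 = 0)
    (omega_subadd : forall a b : R, 0 <= a -> 0 <= b ->
       omega (a + b) <= omega a + omega b)
    (omega_quot : forall a b : R, 0 < a -> a <= b -> a / omega a <= b / omega b)
    (phi_ge1 : forall s : R, 0 <= s -> 1 <= phi s)
    (phi_lim : s / phi s * omega (1 / s) @[s --> +oo] --> +oo) :
  exists (m : R -> R) (T0 : R) (u du : R -> H),
    [/\ (forall x : R, 0 <= x -> 1 / 2 <= m x <= 3 / 2),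
        0 < T0,
        omega_continuous omega `[0, +oo[%classic m,
        kirchhoff_solution ip E m T0 u du &
        (forall r : R, 0 < r ->
           gevrey_space ip E phi r (3 / 4) (u 0) /\
           gevrey_space ip E phi r (1 / 4) (du 0)) /\
        (forall t : R, 0 < t <= T0 ->
           forall b : R, 1 / 2 < b -> ~ phase_space ip E b (u t, du t))].
Proof.
have [HE DE gA] := AE.
have [n [c [T [y [z [Aseq [d]]]]]]] := scalar_solutions lambda_gt0 lambda_incr lambda_unbounded
  omega_ge0 omega_cont omega_incr omega0 omega_quot phi_ge1 phi_lim.
set L := fun k => lambda (n k).
move=> [[n_incr T01] [c_bound c_omega] [c_cont sol] [A_cvg A_bound gev] [loss mono]].
have n_mono j k : (j < k)%N -> (n j < n k)%N.
  by apply: (@homo_ltn _ n (fun a b => (a < b)%N)) => // p q s; exact: ltn_trans.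
have n_inj : injective n.
  move=> j k njk; apply/eqP; case: (ltngtP j k) => // /n_mono; by rewrite njk ltnn.
pose f k := e (n k).
have f_on j k : ip (f j) (f k) = (j == k)%:R by rewrite /f e_orthonormal inj_eq.
have L_gt0 k : 0 < L k by exact: lambda_gt0.
have pvm_f k (B : set R) : measurable B -> E B (f k) = \1_B (L k ^+ 2) *: f k.
  have [De Ae] := e_eigen (n k).
  by apply: (pvm_eigen Hip HE) => //; [exact: exprn_gt0|rewrite -Ae; exact: gA].
(* [L] is increasing, so its first term decides how far the frequencies can be below 1. *)
pose r := Num.max 1 (L 0%N)^-1.
have r1 : 1 <= r by rewrite /r le_max lexx.
have rL k : 1 <= r * L k.
  apply: (@le_trans _ _ ((L 0%N)^-1 * L 0%N)); first by rewrite mulVf// gt_eqF.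
  apply: ler_pM; [by rewrite invr_ge0 ltW|exact: ltW| |].
    by rewrite /r le_max lexx orbT.
  by case: k => // k; exact/ltW/lambda_incr/n_mono.
pose u t := vec f (y^~ t); pose du t := vec f (z^~ t).
have T0 : 0 < T by case/andP: T01.
have C0u := C0_u3 Hip HE f_on L_gt0 pvm_f T01 r1 rL sol A_cvg A_bound.
have C1u := C1_u Hip HE f_on L_gt0 pvm_f T01 r1 rL sol A_cvg A_bound.
have ly := l2_y L_gt0 T01 r1 rL A_cvg A_bound.
have lz := l2_z L_gt0 T01 r1 rL A_cvg A_bound.
pose Psi t := `|pow_op ip E (1 / 2) (u t)| ^+ 2.
have PsiP s t : 0 <= s -> s <= t -> t <= T -> t - s <= Psi t - Psi s.
  move=> s0 st tT.
  have hs : 0 <= s <= T by rewrite s0 (le_trans st).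
  have ht : 0 <= t <= T by rewrite tT (le_trans s0).
  have pE := pow_op_u1 Hip HE f_on L_gt0 pvm_f T01 r1 rL A_cvg A_bound.
  have lw := l2_wy2 L_gt0 T01 r1 rL A_cvg A_bound.
  have ct := cvg_sqr_norm_vec Hip f_on (lw t ht); have cs := cvg_sqr_norm_vec Hip f_on (lw s hs).
  rewrite /Psi /u (pE t ht) (pE s hs).
  have w2 k v : (wt L (1 / 2) k * v) ^+ 2 = L k ^+ 2 * v ^+ 2.
    by rewrite exprMn (@sqr_wtn _ _ L_gt0 _ _ 2)//; field.
  set Xt := `|_| ^+ 2; set Xs := `|_| ^+ 2.
  have cts : (fun m => series (fun k => (wt L (1 / 2) k * y k t) ^+ 2) m -
      series (fun k => (wt L (1 / 2) k * y k s) ^+ 2) m) @ \oo --> Xt - Xs by exact: cvgB.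
  rewrite -(cvg_lim (@Rhausdorff R) cts); apply: limr_ge; first by apply/cvg_ex; eexists; exact: cts.
  near=> m; have m0 : (0 < m)%N by near: m; exact: nbhs_infty_gt.
  apply: le_trans (mono m.-1 s t s0 st tT) _; rewrite prednK//.
  rewrite /series/= -sumrB le_eqVlt; apply/orP; left; apply/eqP.
  by apply: eq_bigr => k _; rewrite !w2; ring.
have [tau [tauK tau_lip]] := expanding_inverse (ltW T0) PsiP.
exists (c \o tau), T, u, du; split.
- by move=> x _; exact: c_bound.
- exact: T0.
- exists 48 => a b _ _; apply: le_trans (c_omega _ _) _; rewrite ler_wpM2l//.
  have := tau_lip a b; rewrite le_eqVlt => /predU1P[->//|h].
  by apply/ltW/omega_incr.
- split => //.
  exists (fun t v => - ((c \o tau) (Psi t) *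
     ip (pow_op ip E (3 / 4) (u t)) (pow_op ip E (1 / 4) v))); split; last first.
    by move=> t v _ _; rewrite /Psi addNr.
  apply: (dual_derivative_du Hip HE f_on L_gt0 pvm_f T01 r1 rL c_cont c_bound sol A_cvg A_bound).
  by move=> t v ht _; rewrite /= tauK.
- split.
  + move=> q q0; have h0 : 0 <= (0 : R) <= T by rewrite lexx ltW.
    (* At s = L^2 the weight s^(2b) is L^(4b), that is L^3 for b = 3/4 and L for b = 1/4: the
       weights of the two parts of [L * energy]. *)
    have gs (b : R) (x : nat -> R) (p : nat) : 2 * b = p%:R / 2 -> l2seq x ->
       (forall k, L k ^+ p * x k ^+ 2 <= L k * energy (L k) (y k) (z k) 0) ->
       gevrey_space ip E phi q b (vec f x).
      move=> bp lx xE; rewrite /gevrey_space/=.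
      apply: le_lt_trans (integral_spec_meas_vec_le Hip HE f_on _ pvm_f lx _) _.
      * by move=> k; rewrite exprn_gt0.
      * by move=> s; rewrite mulr_ge0 ?powR_ge0 ?expR_ge0.
      have gE k : (L k ^+ 2) `^ (2 * b) * expR (q * phi (Num.sqrt (L k ^+ 2))) * x k ^+ 2 =
          L k ^+ p * x k ^+ 2 * expR (q * phi (L k)).
        rewrite sqrtr_sqr gtr0_norm// bp -powR_mulrn ?ltW// -powRrM.
        have -> : 2%:R * (p%:R / 2) = p%:R :> R by field.
        by rewrite powR_mulrn ?ltW//; ring.
      under eq_eseriesr do rewrite gE.
      apply: (@gevrey_summable _ (fun k => L k ^+ p * x k ^+ 2) (fun k => phi (L k))).
      * by move=> k; apply: phi_ge1; exact: ltW.
      * by move=> k; rewrite mulr_ge0 ?sqr_ge0// exprn_ge0// ltW.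
      * by move=> k; apply: le_trans (xE k.+1) (gev k).
    split.
      apply: (gs _ _ 3%N); [by field|exact: ly|move=> k].
      have := mulr_ge0 (ltW (L_gt0 k)) (sqr_ge0 (z k 0)); rewrite /energy => h; lra.
    apply: (gs _ _ 1%N); [by field|exact: lz|move=> k].
    have := mulr_ge0 (exprn_ge0 3 (ltW (L_gt0 k))) (sqr_ge0 (y k 0)); rewrite /energy => h.
    by rewrite expr1; lra.
  + move=> t /andP[t0 tT] b b2 [/= dy dz].
    have ht : 0 <= t <= T by rewrite tT ltW.
    have sq a (x : nat -> R) : l2seq x -> pow_dom ip E a (vec f x) ->
       exists M, forall k, L k `^ (4 * a) * x k ^+ 2 <= M.
      move=> lx dx; have [M MP] := spec_dom_vec_bound Hip HE f_on pvm_f (measurable_powR a) lx dx.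
      by exists M => k; rewrite -sqr_wt// -exprMn; exact: MP.
    have [M1 M1P] := sq _ _ (ly t ht) dy; have [M2 M2P] := sq _ _ (lz t ht) dz.
    have b0 : 0 < 2 * b - 1 by lra.
    (* A single late mode contradicts the bounds M1 and M2: I_k is over at time t, the exponent 2 b
       - 1 is at least 1 / (k+1), and k + 1 exceeds M1 + M2. *)
    have [k [k1 k2 k3]] : exists k : nat, [/\ 2^-1 ^+ k <= t, k.+1%:R^-1 <= 2 * b - 1 &
        M1 + M2 < k.+1%:R].
      have t1 : 0 < t^-1 by rewrite invr_gt0.
      have b1 : 0 < (2 * b - 1)^-1 by rewrite invr_gt0.
      pose S := `|M1 + M2| + t^-1 + (2 * b - 1)^-1.
      have S0 : 0 <= S by rewrite !addr_ge0// ltW.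
      have MS : M1 + M2 <= S.
        by have := ler_norm (M1 + M2); rewrite /S; lra.
      have tS : t^-1 <= S by have := normr_ge0 (M1 + M2); rewrite /S; lra.
      have bS : (2 * b - 1)^-1 <= S by have := normr_ge0 (M1 + M2); rewrite /S; lra.
      exists (Num.bound S); have := archi_boundP S0; set N := Num.bound S => SN.
      have N1 : N%:R <= N.+1%:R :> R by rewrite ler_nat.
      split.
      - rewrite exprVn -[leRHS]invrK lef_pV2 ?posrE ?exprn_gt0//.
        apply: (le_trans tS); apply: (le_trans (ltW SN)).
        by rewrite -natrX ler_nat ltnW// ltn_expl.
      - by rewrite -[leRHS]invrK lef_pV2 ?posrE//; lra.
      - by lra.
    have [d0 dL L1 dP] := loss k.
    have ht' : 2^-1 ^+ k <= t <= T by rewrite k1.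
    have h1 := dP t ht'.
    have h2 : k.+1%:R / d k <= L k.+1 `^ (2 * b - 1).
      have x0 : 0 <= k.+1%:R / d k by rewrite divr_ge0// ltW.
      apply: (@le_trans _ _ (L k.+1 `^ k.+1%:R^-1)); last exact: ler_powR.
      have -> : k.+1%:R / d k = ((k.+1%:R / d k) ^+ k.+1) `^ k.+1%:R^-1.
        by rewrite -powR_mulrn// -powRrM mulfV ?powRr1.
      apply: ge0_ler_powR => //; [by rewrite nnegrE exprn_ge0|by rewrite nnegrE ltW].
    have h3 : k.+1%:R <= L k.+1 `^ (2 * b - 1) * (L k.+1 * energy (L k.+1) (y k.+1) (z k.+1) t).
      rewrite -[leLHS](divfK (lt0r_neq0 d0)); apply: ler_pM => //; last exact: ltW.
      by rewrite divr_ge0// ltW.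
    (* The weights of V_b are L^(2b+2) and L^(2b), which is L^(2b-1) times those of the critical
       quantity. *)
    have h4 : L k.+1 `^ (2 * b - 1) * (L k.+1 * energy (L k.+1) (y k.+1) (z k.+1) t) =
       L k.+1 `^ (4 * ((b + 1) / 2)) * y k.+1 t ^+ 2 + L k.+1 `^ (4 * (b / 2)) * z k.+1 t ^+ 2.
      have Ln0 : L k.+1 != 0 by rewrite gt_eqF.
      have -> : 4 * ((b + 1) / 2) = (2 * b - 1) + 3%:R by field.
      have -> : 4 * (b / 2) = (2 * b - 1) + 1%:R by field.
      rewrite !powRD ?Ln0 ?implybT// !powR_mulrn ?(ltW (L_gt0 _))// /energy.
      by ring.
    have := M1P k.+1; have := M2P k.+1; lra.
Unshelve. all: by end_near. Qed.
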